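(* There exist $\varepsilon_1\in(0,\varepsilon_0]$, a constant $c>0$, and a function $r:(0,\varepsilon_1)\to\mathbb R$ with $r(\varepsilon)=\mathcal O(\varepsilon^{-1})$ as $\varepsilon\downarrow0$, such that $$\sigma_{\mathrm{ess}}(\mathcal L_\varepsilon)\cap\{z\in\mathbb C:\operatorname{Re}(z)\ge -c\,\varepsilon^{-2}+r(\varepsilon)\}=\emptyset\qquad\text{for all }\varepsilon\in(0,\varepsilon_1).$$
   Context: Fix $\alpha\in(0,1/2)$ and $\beta>2$. For $\varepsilon\neq0$ let $f_\varepsilon(u)=-u^3+(1+\alpha)u^2+(3\varepsilon^{-2}-\alpha)u-(1+\alpha)\varepsilon^{-2}$. Let $\varepsilon_0>0$ and $z^-,z^0,z^+:\{\varepsilon\in\mathbb C:0<|\varepsilon|<\varepsilon_0\}\to\mathbb C$ be holomorphic functions with $f_\varepsilon(z^-_\varepsilon)=f_\varepsilon(z^0_\varepsilon)=f_\varepsilon(z^+_\varepsilon)=0$, real-valued with $z^-_\varepsilon<z^0_\varepsilon<z^+_\varepsilon$ for $\varepsilon\in(0,\varepsilon_0)$, and with $z^0_\varepsilon=\frac{1+\alpha}{3}+\mathcal O(\varepsilon^2)$, $z^\pm_\varepsilon=\pm\sqrt3\,\varepsilon^{-1}+\frac{1+\alpha}{3}+\mathcal O(\varepsilon)$ as $\varepsilon\to0$ (such $\varepsilon_0$ and functions exist). For $\varepsilon\in(0,\varepsilon_0)$ set $A_\varepsilon=z^+_\varepsilon-z^-_\varepsilon$, $\Phi^{\mathrm{hux}}(x)=(1+\exp(-x/\sqrt2))^{-1}$,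 $\Phi_\varepsilon(x)=A_\varepsilon\Phi^{\mathrm{hux}}(A_\varepsilon x)+z^-_\varepsilon$ and $s_\varepsilon=\sqrt2\,A_\varepsilon\left(\frac{z^0_\varepsilon-z^-_\varepsilon}{z^+_\varepsilon-z^-_\varepsilon}-\frac12\right)$; then $u(t,x)=\Phi_\varepsilon(x-s_\varepsilon t)$ is a travelling wave solution of $\partial_tu=\partial_x^2u+f_\varepsilon(u)$. Let $w_\beta(x)=(1+|x|^2)^{-\beta/2}$, $L^2(\mathbb R,w_\beta)$ the (complex) $L^2$-space with norm $(\int|u|^2w_\beta\,dx)^{1/2}$, $T:L^2(\mathbb R,w_\beta)\to L^2(\mathbb R)$, $Tu=w_\beta^{1/2}u$ (an isometric isomorphism), and $H=T^{-1}(H^2(\mathbb R))$. The linearization $\mathcal L_\varepsilon$ about the wave is the closed, densely defined operator on $L^2(\mathbb R,w_\beta)$ with domain $H$ given by $$\mathcal L_\varepsilon u=\partial_x^2u+s_\varepsilon\partial_xu+f_\varepsilon'(\Phi_\varepsilon)u.$$ A closed operator on a Banach space is Fredholm if its range is closed and its kernel and cokernel are finite-dimensional. For a closed operator $\mathcal A$, $\sigma_{\mathrm{ess}}(\mathcal A)$ (Schechter essential spectrum) is the set of $\lambda\in\mathbb C$ such that $\mathcal A-\lambda I$ is not Fredholm, or is Fredholm with non-zero index. *)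

(* Defs.v *)
From HB Require Import structures.
From mathcomp Require Import all_boot all_order all_algebra.
From mathcomp Require Import all_classical all_reals all_analysis.
From mathcomp Require Import complex.
Set Implicit Arguments.
Unset Strict Implicit.
Unset Printing Implicit Defensive.
Import Order.TTheory GRing.Theory Num.Theory.
Import numFieldNormedType.Exports.
Local Open Scope classical_set_scope.
Local Open Scope ring_scope.
Local Open Scope complex_scope.

(* Throughout, complex numbers are written (R[i])^o rather than R[i]: both are
   the same type, but (R[i])^o is the one carrying the canonical structure of
   a normed module over R[i] (R[i] itself is an lmodType over R). *)

(* A complex normed space is presented by a space V of representatives, a
   linear subspace X of V and a seminorm nu on X; the normed space is the
   quotient of X by the vectors of seminorm zero (as L^2 is obtained from square
   integrable functions). An unbounded operator is given by its graph on
   representatives, a linear subspace A of X * X. *)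
Section Fredholm.
Variables (R : realType) (V : lmodType R[i]) (X : set V) (nu : V -> R).
Implicit Types (A : set (V * V)) (M N : set V).

(* n is the dimension of M / N, for linear subspaces N `<=` M:
   the classes of e 0, ..., e (n - 1) form a basis. *)
Definition quotient_dim M N (n : nat) : Prop :=
  exists e : 'I_n -> V, (forall i, M (e i)) /\
    forall v, M v ->
      exists! c : 'rV[R[i]]_n, N (v - \sum_(i < n) c ord0 i *: e i).

Definition null_space : set V := [set v | X v /\ nu v = 0].

Definition op_ker A : set V :=
  [set u | exists2 v, A (u, v) & null_space v].

Definition op_range A : set V :=
  [set v | X v /\ exists u v', A (u, v') /\ null_space (v - v')].

Definition range_closed A : Prop :=
  forall (v_ : nat -> V) (v : V),
    (forall n, op_range A (v_ n)) -> X v ->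
    nu (v_ n - v) @[n --> \oo] --> (0 : R) -> op_range A v.

(* A is Fredholm, with n-dimensional kernel and m-dimensional cokernel. *)
Definition fredholm_with A (n m : nat) : Prop :=
  [/\ range_closed A, quotient_dim (op_ker A) null_space n
    & quotient_dim X (op_range A) m].

Definition fredholm A : Prop := exists n m, fredholm_with A n m.

Definition fredholm_index A (k : int) : Prop :=
  exists n m, fredholm_with A n m /\ k = n%:Z - m%:Z.

Definition op_shift A (lambda : R[i]) : set (V * V) :=
  [set p | exists2 v, A (p.1, v) & p.2 = v - lambda *: p.1].

Definition essential_spectrum A : set R[i] :=
  [set lambda | ~ fredholm (op_shift A lambda) \/
     exists2 k : int, fredholm_index (op_shift A lambda) k & k != 0].

End Fredholm.

Section FunctionSpaces.
Variable R : realType.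
Implicit Types (u g : R -> (R[i])^o) (w phi : R -> R).

Definition sqnormc (z : R[i]) : R := complex.Re z ^+ 2 + complex.Im z ^+ 2.

Definition L2 w : set (R -> (R[i])^o) :=
  [set u | [/\ measurable_fun setT (fun x => complex.Re (u x)),
               measurable_fun setT (fun x => complex.Im (u x))
    & (\int[lebesgue_measure]_x (sqnormc (u x) * w x)%:E < +oo)%E]].

Definition L2norm w u : R :=
  Num.sqrt (\int[lebesgue_measure]_x (sqnormc (u x) * w x)).

Definition test_function phi : Prop :=
  (forall n x, derivable (derive1n n phi) x 1) /\
  compact (closure [set x | phi x != 0]).

Definition real_weak_deriv (k : nat) (u g : R -> R) : Prop :=
  [/\ locally_integrable setT u, locally_integrable setT g
    & forall phi, test_function phi ->
        \int[lebesgue_measure]_x (u x * derive1n k phi x) =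
        (-1) ^+ k * \int[lebesgue_measure]_x (g x * phi x)].

(* g is a k-th weak derivative of u; testing against real functions suffices
   by linearity. *)
Definition weak_deriv (k : nat) u g : Prop :=
  real_weak_deriv k (fun x => complex.Re (u x)) (fun x => complex.Re (g x)) /\
  real_weak_deriv k (fun x => complex.Im (u x)) (fun x => complex.Im (g x)).

Definition H2 : set (R -> (R[i])^o) :=
  [set u | L2 (cst 1) u /\
     exists u1 u2, [/\ L2 (cst 1) u1, L2 (cst 1) u2,
                       weak_deriv 1 u u1 & weak_deriv 2 u u2]].

Definition weight (beta : R) (x : R) : R := (1 + `|x| ^+ 2) `^ (- beta / 2).

Definition weight_isometry (beta : R) u : R -> (R[i])^o :=
  fun x => (Num.sqrt (weight beta x))%:C * u x.

End FunctionSpaces.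

(* Generic in K, as both the real and the complex cubic are needed. *)
Definition nagumo (K : fieldType) (alpha eps u : K) : K :=
  - u ^+ 3 + (1 + alpha) * u ^+ 2 + (3 * eps ^- 2 - alpha) * u
  - (1 + alpha) * eps ^- 2.

Section Front.
Variable R : realType.

Definition huxley (x : R) : R := (1 + expR (- x / Num.sqrt 2))^-1.

(* zm, z0, zp are the real roots of the cubic, in increasing order. *)
Definition front (zm zp x : R) : R :=
  let A := zp - zm in A * huxley (A * x) + zm.

Definition front_speed (zm z0 zp : R) : R :=
  Num.sqrt 2 * (zp - zm) * ((z0 - zm) / (zp - zm) - 1 / 2).

(* The operator is given by its graph on representatives. Weak derivatives are
   unique up to null sets only, so u may be related to several representatives
   of the same class. *)
Definition linearization (alpha beta eps zm z0 zp : R) :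
    set ((R -> (R[i])^o) * (R -> (R[i])^o)) :=
  [set p | H2 (weight_isometry beta p.1) /\
     exists u1 u2, [/\ weak_deriv 1 p.1 u1, weak_deriv 2 p.1 u2
       & p.2 = fun x => u2 x + (front_speed zm z0 zp)%:C * u1 x
           + (derive1 (nagumo alpha eps) (front zm zp x))%:C * p.1 x]].

Definition holomorphic_on (D : set (R[i])^o) (f : (R[i])^o -> (R[i])^o) : Prop :=
  forall e, D e -> derivable f e 1.

Definition punctured_disc (r : R) : set (R[i])^o :=
  [set e | 0 < `|e : R[i]| < r%:C].

End Front.

(* Main.v *)
Require Import Defs.
From mathcomp Require Import all_boot all_order all_algebra.
From mathcomp Require Import all_classical all_reals all_analysis.
From mathcomp Require Import complex ring lra measurable_realfun.
Set Implicit Arguments.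
Unset Strict Implicit.
Unset Printing Implicit Defensive.
Import Order.TTheory GRing.Theory Num.Theory.
Import numFieldNormedType.Exports.
Local Open Scope classical_set_scope.
Local Open Scope ring_scope.
Local Open Scope complex_scope.

(** Write L - lambda = D^2 + s D + P, where P is a quadratic polynomial in the
    logistic profile h of the front, with limits p- and p+ at -oo and +oo. As
    f'(z-) and f'(z+) are asymptotic to -6 eps^-2, both Re p- and Re p+ are
    negative when Re lambda >= - eps^-2 and eps is small, so that c = 1 and
    r = 0 will do. The equation r^2 + s r + p = 0 has then, for p = p- and p+,
    a root r-, r+ with Re r < 0 and Re (s + r) < 0. Interpolating,
    r(x) := r- + (r+ - r-) h(x) gives L - lambda = (D + s + r)(D - r) + V with
    V = kappa h (1 - h), for P + r' + s r + r^2 is quadratic in h and vanishes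
    at h = 0 and h = 1. The first-order factors have inverses G2 and G1 given
    by explicit exponentially decaying kernels, bounded on the weighted space
    and on bounded functions, and
    L - lambda = (D + s + r)(1 + G2 V G1)(D - r). As V decays exponentially, G2 V
    maps the weighted space to bounded functions, so that the middle factor may
    be studied on these. There G2 V G1 is the sum of an operator of norm at most
    1/2 and of one of finite rank, since V is small near infinity and G1 k is,
    up to a fixed factor, slowly varying. Hence 1 + G2 V G1, and with it
    L - lambda, is Fredholm of index zero. *)

(** * Linear algebra modulo a subspace *)

(** The values of f' at the two end states need not agree, so in general no single
    constant-coefficient operator differs from L - lambda by a decaying potential. Interpolating
    with the profile itself works because h' is a multiple of h (1 - h): the derivative of r then
    contributes to the decaying remainder only. The index vanishes because of signs: r has negative
    real part at both ends and - (s + r) positive real part at both ends, so that the two factors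
    are inverted by integrating from -oo and from +oo respectively, while their homogeneous
    solutions grow exponentially at one end, where the weight decays only polynomially. Bounded
    functions are taken at every point, not up to null sets: values at grid nodes then make sense as
    the coordinates of a finite-rank operator, and the Neumann series converges uniformly.
    Everything ends in a square matrix, whose left kernel and cokernel have the same dimension. As
    the true leading coefficient is 6, the choice c = 1 leaves room for all lower-order terms, which
    is why r = 0 suffices. *)

Section ComplexNorm.
Variable R : realType.
Implicit Types z : R[i].

(* An L^1-type norm, submultiplicative and additive on real and imaginary
   parts, so that integral estimates reduce to real-valued functions. *)
Definition N1 z : R := `|complex.Re z| + `|complex.Im z|.

Lemma N1_ge0 z : 0 <= N1 z.
Proof. by rewrite addr_ge0. Qed.

Lemma N1_0 : N1 0 = 0.
Proof. by rewrite /N1 /= normr0 addr0. Qed.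

Lemma N1_eq0 z : N1 z = 0 -> z = 0.
Proof.
case: z => a b /eqP; rewrite /N1 /= paddr_eq0// !normr_eq0 => /andP[/eqP-> /eqP->].
by [].
Qed.

Lemma N1D z1 z2 : N1 (z1 + z2) <= N1 z1 + N1 z2.
Proof.
case: z1 z2 => a b [c d]; rewrite /N1 /=.
have := ler_normD a c; have := ler_normD b d; lra.
Qed.

Lemma N1N z : N1 (- z) = N1 z.
Proof. by case: z => a b; rewrite /N1 /= !normrN. Qed.

Lemma N1B z1 z2 : N1 (z1 - z2) <= N1 z1 + N1 z2.
Proof. by rewrite -(N1N z2) N1D. Qed.

Lemma N1M z1 z2 : N1 (z1 * z2) <= N1 z1 * N1 z2.
Proof.
case: z1 z2 => a b [c d]; rewrite /N1 /=.
have := ler_normB (a * c) (b * d); have := ler_normD (a * d) (b * c).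
by rewrite !normrM; lra.
Qed.

Lemma N1_real (c : R) : N1 c%:C = `|c|.
Proof. by rewrite /N1 /= normr0 addr0. Qed.

Lemma N1_sum (I : Type) (s : seq I) (F : I -> R[i]) :
  N1 (\sum_(i <- s) F i) <= \sum_(i <- s) N1 (F i).
Proof.
elim: s => [|i s ih]; first by rewrite !big_nil N1_0.
by rewrite !big_cons (le_trans (N1D _ _))// lerD2l.
Qed.

Lemma N1_sq_le z : N1 z ^+ 2 <= 2 * sqnormc z.
Proof.
rewrite /N1 /sqnormc sqrrD !real_normK ?num_real//.
have := sqr_ge0 (`|complex.Re z| - `|complex.Im z|).
by rewrite sqrrB !real_normK ?num_real//; lra.
Qed.

Lemma sqnormc_le z : sqnormc z <= N1 z ^+ 2.
Proof.
rewrite /N1 /sqnormc sqrrD !real_normK ?num_real//.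
have := mulr_ge0 (normr_ge0 (complex.Re z)) (normr_ge0 (complex.Im z)); lra.
Qed.

Lemma sqnormc_ge0 z : 0 <= sqnormc z.
Proof. by rewrite addr_ge0 ?sqr_ge0. Qed.

End ComplexNorm.

Section QuotientDim.
Variables (R : realType) (V : lmodType R[i]).
Implicit Types (M N X : set V).

Definition lin_closed X := X 0 /\ forall a u v, X u -> X v -> X (a *: u + v).

Definition lin_on X (W : lmodType R[i]) (G : V -> W) :=
  forall a u v, X u -> X v -> G (a *: u + v) = a *: G u + G v.

Lemma lin_closedD X u v : lin_closed X -> X u -> X v -> X (u + v).
Proof. by move=> [_ h] Xu Xv; rewrite -[u]scale1r; exact: h. Qed.

Lemma lin_closedZ X a u : lin_closed X -> X u -> X (a *: u).
Proof. by move=> [h0 h] Xu; rewrite -[_ *: _]addr0; exact: h. Qed.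

Lemma lin_closedN X u : lin_closed X -> X u -> X (- u).
Proof. by move=> hX Xu; rewrite -scaleN1r; exact: lin_closedZ. Qed.

Lemma lin_closedB X u v : lin_closed X -> X u -> X v -> X (u - v).
Proof. by move=> hX Xu Xv; apply: lin_closedD => //; exact: lin_closedN. Qed.

Lemma lin_closed_sum X (I : Type) (s : seq I) (F : I -> V) :
  lin_closed X -> (forall i, X (F i)) -> X (\sum_(i <- s) F i).
Proof.
move=> hX hF; elim: s => [|i s ih]; first by rewrite big_nil; case: hX.
by rewrite big_cons; exact: lin_closedD.
Qed.

Section LinOn.
Variables (X : set V) (W : lmodType R[i]) (G : V -> W).
Hypotheses (hX : lin_closed X) (hG : lin_on X G).

Lemma lin_on0 : G 0 = 0.
Proof.
have [X0 _] := hX; have := hG 1 X0 X0; rewrite !scale1r addr0.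
by move=> /eqP; rewrite -subr_eq subrr => /eqP <-.
Qed.

Lemma lin_onD u v : X u -> X v -> G (u + v) = G u + G v.
Proof. by move=> Xu Xv; rewrite -[u in LHS]scale1r hG// scale1r. Qed.

Lemma lin_onZ a u : X u -> G (a *: u) = a *: G u.
Proof. by move=> Xu; rewrite -[a *: u]addr0 hG ?lin_on0 ?addr0//; case: hX. Qed.

Lemma lin_onN u : X u -> G (- u) = - G u.
Proof. by move=> Xu; rewrite -scaleN1r lin_onZ// scaleN1r. Qed.

Lemma lin_onB u v : X u -> X v -> G (u - v) = G u - G v.
Proof. by move=> Xu Xv; rewrite lin_onD ?lin_onN//; exact: lin_closedN. Qed.

Lemma lin_on_sum (I : Type) (s : seq I) (F : I -> V) : (forall i, X (F i)) ->
  G (\sum_(i <- s) F i) = \sum_(i <- s) G (F i).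
Proof.
move=> hF; elim: s => [|i s ih]; first by rewrite !big_nil lin_on0.
by rewrite !big_cons lin_onD ?ih//; exact: lin_closed_sum.
Qed.

End LinOn.

(** Preimages of the standard basis vectors form the basis sought. Linearity is asked of an ambient
    [X] because [M] will be the kernel of a graph, only known to lie in a space of solutions. *)
Lemma quotient_dim_coord M X N (n : nat) (psi : V -> 'rV[R[i]]_n) :
  M `<=` X -> lin_closed X -> lin_on X psi ->
  (forall v, X v -> N v <-> psi v = 0) ->
  (forall c, exists2 v, M v & psi v = c) ->
  quotient_dim M N n.
Proof.
move=> MX hM hpsi hN surj.
have /choice[e he] : forall i : 'I_n, exists v, M v /\ psi v = delta_mx 0 i.
  by move=> i; have [v] := surj (delta_mx 0 i); exists v.
have Me i : M (e i) by have [] := he i.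
have Xe i : X (e i) by exact: MX.
exists e; split => // v /MX Xv.
have psiE (c : 'rV_n) : psi (v - \sum_(i < n) c ord0 i *: e i) = psi v - c.
  rewrite (lin_onB hM hpsi)//; last first.
    by apply: lin_closed_sum => // i; exact: lin_closedZ.
  rewrite (lin_on_sum hM hpsi); last by move=> i; exact: lin_closedZ.
  congr (_ - _); rewrite [RHS]row_sum_delta; apply: eq_bigr => i _.
  by rewrite (lin_onZ hM hpsi)//; have [_ ->] := he i.
have Xsum (c : 'rV_n) : X (v - \sum_(i < n) c ord0 i *: e i).
  apply: lin_closedB => //; apply: lin_closed_sum => // i.
  exact: lin_closedZ.
exists (psi v); split.
  by apply/hN => //; rewrite psiE subrr.
by move=> c /(hN _ (Xsum c)); rewrite psiE => /eqP; rewrite subr_eq0 => /eqP.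
Qed.

(** Expressing each basis through the other gives matrices [C] and [D]; uniqueness of coordinates in
    [e] forces [C *m D] to be the identity. *)
Lemma quotient_dim_le M N (n m : nat) : lin_closed N ->
  quotient_dim M N n -> quotient_dim M N m -> (n <= m)%N.
Proof.
move=> hN [e [Me he]] [f [Mf hf]].
have /choice[c hc] : forall i : 'I_n, exists c : 'rV[R[i]]_m,
    N (e i - \sum_(j < m) c ord0 j *: f j).
  by move=> i; have [c [hc _]] := hf _ (Me i); exists c.
have /choice[d hd] : forall j : 'I_m, exists d : 'rV[R[i]]_n,
    N (f j - \sum_(i < n) d ord0 i *: e i).
  by move=> j; have [d [hd _]] := he _ (Mf j); exists d.
pose C := \matrix_(i < n, j < m) c i ord0 j.
pose D := \matrix_(j < m, i < n) d j ord0 i.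
apply: (@mulmx1_min _ _ _ C D); apply/row_matrixP => i.
have [k [_ uk]] := he _ (Me i).
transitivity k; last first.
  apply: uk; rewrite (bigD1 i)//= big1 ?addr0 => [|j ji].
    by rewrite !mxE eqxx scale1r subrr; case: hN.
  by rewrite !mxE eq_sym (negbTE ji) scale0r.
apply/esym/uk.
have -> : e i - \sum_(k0 < n) row i (C *m D) ord0 k0 *: e k0 =
   (e i - \sum_(j < m) c i ord0 j *: f j) +
   \sum_(j < m) c i ord0 j *: (f j - \sum_(k0 < n) d j ord0 k0 *: e k0).
  under [in X in _ - _ + X]eq_bigr do rewrite scalerBr.
  rewrite sumrB addrA subrK; congr (_ - _).
  under [RHS]eq_bigr do rewrite scaler_sumr.
  rewrite exchange_big/=; apply: eq_bigr => k0 _.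
  rewrite !mxE scaler_suml; apply: eq_bigr => j _.
  by rewrite !mxE scalerA.
apply: lin_closedD => //; apply: lin_closed_sum => // j.
exact: lin_closedZ.
Qed.

Lemma quotient_dim_unique M N (n m : nat) : lin_closed N ->
  quotient_dim M N n -> quotient_dim M N m -> n = m.
Proof.
move=> hN hn hm; apply/eqP; rewrite eqn_leq.
by rewrite (quotient_dim_le hN hn hm) (quotient_dim_le hN hm hn).
Qed.

End QuotientDim.

(** * Fredholm operators of index zero *)

Section AbstractFredholm.
Variables (R : realType) (V : lmodType R[i]) (X : set V) (nu : V -> R).
Variables (A : set (V * V)) (BM : set V) (G1 G2 m : V -> V).
Local Notation null := (null_space X nu).
Hypotheses (hX : lin_closed X) (hnull : lin_closed null).
Hypotheses (hBM : lin_closed BM) (BMX : BM `<=` X).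
Hypotheses (hG1 : lin_on X G1) (hG2 : lin_on X G2) (hm : lin_on X m).
Hypotheses (XG1 : forall u, X u -> X (G1 u)) (XG2 : forall u, X u -> X (G2 u)).
Hypotheses (Xm : forall u, X u -> X (m u)).
Hypotheses (BMG1 : forall u, BM u -> BM (G1 u)).
Hypotheses (BMG2m : forall u, X u -> BM (G2 (m u))).
Hypotheses (G2null : forall u, null u -> G2 u = 0).
Hypotheses (mnull : forall u, null u -> null (m u)).
(** Modulo null vectors, the two graph hypotheses make A u = v equivalent to u + G m u = G v with G
    = G1 G2. Membership of v in X stands as a premise: where this is applied, v is null or differs
    by a null vector from one known to lie in X. *)
Hypothesis graph_inv : forall u v, A (u, v) ->
  X u /\ (X v -> null (u - G1 (G2 (v - m u)))).
Hypothesis graph_mem : forall g, X g -> A (G1 (G2 g), g + m (G1 (G2 g))).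
Variables (N : nat) (l : V -> 'rV[R[i]]_N) (b : 'I_N -> V) (J : V -> V).
Hypotheses (hl : lin_on BM l) (BMb : forall j, BM (b j)).
(** [T] is G1 G2 m with the factor [G1] moved to the right, so that it acts on bounded functions.
    [F] is its finite-rank part, and [J] inverts 1 + [S]. *)
Let T k := G2 (m (G1 k)).
Let F k := \sum_(j < N) l k ord0 j *: b j.
Let S k := T k - F k.
Hypotheses (BMJ : forall h, BM h -> BM (J h)).
Hypotheses (JK : forall h, BM h -> J h + S (J h) = h).
Hypotheses (KJ : forall k, BM k -> J (k + S k) = k).
Hypothesis lJ_bound : exists C : R, 0 <= C /\ forall v j, X v ->
  N1 (l (J (G2 (m (G1 (G2 v))))) ord0 j) <= C * nu v.

Let BMT k : BM k -> BM (T k).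
Proof. by move=> hk; apply/BMG2m/XG1/BMX. Qed.

Let BMF k : BM (F k).
Proof. by apply: lin_closed_sum => // j; exact: lin_closedZ. Qed.

Let BMS k : BM k -> BM (S k).
Proof. by move=> hk; apply: lin_closedB => //; exact: BMT. Qed.

Let hT : lin_on BM T.
Proof.
move=> a u v /BMX Xu /BMX Xv.
by rewrite /T hG1// hm// ?hG2//; do ?apply: XG1; do ?apply: Xm; do ?apply: XG1.
Qed.

Let hF : lin_on BM F.
Proof.
move=> a u v Bu Bv; rewrite /F hl// scaler_sumr -big_split/=.
by apply: eq_bigr => j _; rewrite !mxE scalerDl scalerA.
Qed.

Let hS : lin_on BM S.
Proof. by move=> a u v Bu Bv; rewrite /S hT// hF// scalerBr opprD addrACA. Qed.

Let hJ : lin_on BM J.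
Proof.
move=> a u v Bu Bv; rewrite -[RHS]KJ; last by case: hBM => _; apply; exact: BMJ.
congr J; rewrite hS; [|exact: BMJ|exact: BMJ].
by rewrite addrACA -scalerDr !JK.
Qed.

Let M := \matrix_(j < N) l (J (b j)).

Let lJF (c : 'rV[R[i]]_N) : l (J (\sum_(j < N) c ord0 j *: b j)) = c *m M.
Proof.
rewrite (lin_on_sum hBM hJ); last by move=> j; exact: lin_closedZ.
rewrite (lin_on_sum hBM hl); last first.
  by move=> j; apply: BMJ; exact: lin_closedZ.
rewrite mulmx_sum_row; apply: eq_bigr => j _.
rewrite (lin_onZ hBM hJ)// (lin_onZ hBM hl); last exact: BMJ.
by rewrite rowK.
Qed.

Let P : 'M[R[i]]_N := 1%:M + M.

(* Since F has finite rank, J (k + T k) = k + J (F k): solving k + T k = h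
   amounts to a linear system for the coordinates l k. *)
Let lJ1T k : BM k -> l (J (k + T k)) = l k *m P.
Proof.
move=> Bk; have -> : k + T k = (k + S k) + F k by rewrite /S addrA subrK.
have BkS : BM (k + S k) by apply: lin_closedD => //; exact: BMS.
have BF := BMF k.
rewrite (lin_onD hJ)// (lin_onD hl); [|exact: BMJ|exact: BMJ].
by rewrite KJ// lJF mulmxDr mulmx1.
Qed.

Let solve_1T h (c : 'rV[R[i]]_N) : BM h -> l (J h) = c *m P ->
  exists k, [/\ BM k, k + T k = h & l k = c].
Proof.
move=> Bh lJh; pose f := \sum_(j < N) c ord0 j *: b j.
have Bf : BM f by apply: lin_closed_sum => // j; exact: lin_closedZ.
pose k := J (h - f).
have Bhf : BM (h - f) by exact: lin_closedB.
have lk : l k = c.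
  rewrite /k (lin_onB hBM hJ)// (lin_onB hBM hl); [|exact: BMJ|exact: BMJ].
  rewrite lJF lJh.
  by rewrite mulmxDr mulmx1 addrK.
exists k; split => //; first exact: BMJ.
have : k + S k = h - f by rewrite JK.
by rewrite /S /F lk -/f addrA => /(congr1 (+%R^~ f)); rewrite !subrK.
Qed.

Let G u := G1 (G2 u).
Let kap v := G2 (m (G v)).
Let Lam v := l (J (kap v)).

Let XG u : X u -> X (G u). Proof. by move=> Xu; exact/XG1/XG2. Qed.

Let BMkap v : X v -> BM (kap v). Proof. by move=> Xv; exact/BMG2m/XG. Qed.

Let hG : lin_on X G.
Proof. by move=> a u v Xu Xv; rewrite /G hG2// hG1// ; exact: XG2. Qed.

Let hkap : lin_on X kap.
Proof.
move=> a u v Xu Xv; have XGu := XG Xu; have XGv := XG Xv.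
by rewrite /kap hG// hm// hG2//; exact: Xm.
Qed.

Let hLam : lin_on X Lam.
Proof. by move=> a u v Xu Xv; rewrite /Lam hkap// hJ; [rewrite hl//;
    exact/BMJ/BMkap|exact: BMkap|exact: BMkap]. Qed.

Let G_null u : null u -> G u = 0.
Proof. by move=> nu0; rewrite /G G2null// (lin_on0 hX hG1). Qed.

Let X_null u : null u -> X u. Proof. by case. Qed.

(** The passage from 1 + G1 (G2 m) to 1 + (G2 m) G1. Applying G2 m to u + G m u = G v gives the
    equation for k = G2 (m u); conversely u = G v - G1 k solves the first equation. *)
Let op_rangeP v : X v ->
  op_range X nu A v <-> exists2 k, BM k & k + T k = kap v.
Proof.
move=> Xv; split=> [[_ [u [v' [Auv' nvv']]]]|[k Bk kT]].
  have [Xu +] := graph_inv Auv'.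
  have Xv' : X v' by rewrite -(subKr v v'); apply: lin_closedB => //; exact: X_null.
  move=> /(_ Xv') nu1; exists (G2 (m u)); first exact: BMG2m.
  have Xmu := Xm Xu; have Xd := lin_closedB hX Xv' Xmu.
  have /G2null : null (m (u - G (v' - m u))) by exact: mnull.
  rewrite (lin_onB hX hm)//; last exact: XG.
  rewrite (lin_onB hX hG2)//; [|exact/Xm/XG].
  rewrite (lin_onB hX hG)// (lin_onB hX hm); [|exact: XG|exact: XG].
  rewrite (lin_onB hX hG2); [|exact/Xm/XG|exact/Xm/XG].
  rewrite -/(kap v') -/(T (G2 (m u))) => /eqP; rewrite opprB addrA subr_eq0 => /eqP ->.
  by have := hkap (-1) Xv Xv'; have := G_null nvv'; rewrite /kap (lin_onB hX hG)// => /eqP;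
      rewrite subr_eq0 => /eqP ->.
split => //; pose u := G (v - m (G v - G1 k)).
have XGv := XG Xv; have XG1k := XG1 (BMX Bk).
have Xu0 := lin_closedB hX XGv XG1k.
have Gm : G (m (G v - G1 k)) = G1 k.
  rewrite /G; congr G1; rewrite (lin_onB hX hm)// (lin_onB hX hG2); [|exact: Xm|exact: Xm].
  by rewrite -/(kap v) -/(T k) -kT addrK.
have Xmu0 := Xm Xu0.
have uE : u = G v - G1 k.
  by rewrite /u (lin_onB hX hG)// Gm.
exists u, v; split; last by rewrite subrr; case: hnull.
have := graph_mem (lin_closedB hX Xv (Xm Xu0)).
by rewrite -/(G _) -/u uE subrK.
Qed.

Let op_rangeE v : X v -> op_range X nu A v <-> (Lam v <= P)%MS.
Proof.
move=> Xv; rewrite op_rangeP//; split=> [[k Bk kT]|/submxP[c hc]].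
  by apply/submxP; exists (l k); rewrite -lJ1T// kT.
by have [k [Bk kT _]] := solve_1T (BMkap Xv) hc; exists k.
Qed.

(** The N columns of [cokermx P] are dependent in general. Its column basis has the same left kernel
    and independent columns, which allows [psi] to be onto. *)
Let Q := col_base (cokermx P).

Let psi v := Lam v *m Q.

Let op_range_psi v : X v -> op_range X nu A v <-> psi v = 0.
Proof.
move=> Xv; rewrite op_rangeE// submxE -{1}(mulmx_base (cokermx _)) mulmxA.
split=> [/eqP h|h]; last by rewrite /psi in h; rewrite h mul0mx.
have /row_freeP[B hB] := row_base_free (cokermx P).
by rewrite /psi -[LHS]mulmx1 -hB mulmxA h mul0mx.
Qed.

Let hpsi : lin_on X psi.
Proof. by move=> a u v Xu Xv; rewrite /psi hLam// mulmxDl scalemxAl. Qed.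

Let psi_surj d : exists2 v, X v & psi v = d.
Proof.
pose c := - (d *m pinvmx Q); pose f := \sum_(j < N) c ord0 j *: b j.
have Bf : BM f by apply: lin_closed_sum => // j; exact: lin_closedZ.
have XG1f := XG1 (BMX Bf).
exists (m (G1 f)); first exact: Xm.
have imQ (x : 'rV_N) : x *m P *m Q = 0.
  have := mulmx_coker P; rewrite -{1}(mulmx_base (cokermx _)).
  have /row_freeP[B hB] := row_base_free (cokermx P).
  move=> h; rewrite -mulmxA -[P *m Q]mulmx1 -hB.
  by rewrite [X in _ *m X]mulmxA -[P *m Q *m _]mulmxA h mul0mx mulmx0.
have LE : Lam (m (G1 f)) = l (J (T (T f))) by [].
rewrite /psi.
(* T (T f) is f - (f + T f) + (T f + T (T f)). The last two terms give multiples of P, which Q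
   annihilates, and l (J f) = c M = c P - c leaves - c Q = d. *)
have -> : Lam (m (G1 f)) = l (J f) - l (J (f + T f)) + l (J (T f + T (T f))).
  have BT := BMT Bf; have BTT := BMT BT.
  rewrite LE !(lin_onD hJ)// !(lin_onD hl); try exact: BMJ.
  by rewrite opprD addNKr addKr.
rewrite (lJ1T Bf) (lJ1T (BMT Bf)).
rewrite lJF mulmxDl mulmxBl !imQ subr0 addr0.
have -> : c *m M = c *m P - c by rewrite mulmxDr mulmx1 addrAC subrr add0r.
rewrite mulmxBl imQ sub0r /c mulNmx opprK -mulmxA mulVpmx ?mulmx1//.
exact: col_base_full.
Qed.

Let coker_dim : quotient_dim X (op_range X nu A) (\rank (cokermx P)).
Proof. by apply: (quotient_dim_coord _ hX hpsi op_range_psi psi_surj). Qed.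

(** The range is the zero set of [psi], which [lJ_bound] makes continuous for [nu]. *)
Let closed_range : range_closed X nu A.
Proof.
move=> v_ v hv Xv vcvg; apply/op_range_psi => //.
have [C [C0 hC]] := lJ_bound.
have Xv_ n : X (v_ n) by have [] := hv n.
apply/rowP => j; rewrite [RHS]mxE; apply: N1_eq0; apply/eqP.
rewrite eq_le N1_ge0 andbT.
pose D := C * \sum_i N1 (Q i j).
have psi_le w : X w -> N1 (psi w ord0 j) <= D * nu w.
  move=> Xw; rewrite mxE (le_trans (N1_sum _ _))// /D -mulrA mulrCA mulrC.
  rewrite mulr_sumr; apply: ler_sum => i _; rewrite (le_trans (N1M _ _))//.
  by rewrite ler_wpM2r ?N1_ge0//; exact: hC.
have cv : D * nu (v_ n - v) @[n --> \oo] --> (0 : R).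
  by rewrite -[X in _ --> X](mulr0 D); apply: cvgMr vcvg.
apply: (ler_cvg_to (cvg_cst _) cv); apply: nearW => n /=.
apply: le_trans (psi_le _ (lin_closedB hX (Xv_ n) Xv)).
have /(op_range_psi (Xv_ n)) psi0 := hv n.
by rewrite (lin_onB hX hpsi)// psi0 sub0r [X in _ <= N1 X]mxE N1N.
Qed.

(** A kernel vector u is determined by the coordinates of G2 (m u), which form a left null vector of
    P; the cokernel has been read off from [psi]. As P is square, both dimensions are N minus its
    rank. *)
Lemma abstract_fredholm : exists n, fredholm_with X nu A n n.
Proof.
have hB := row_base_free (kermx P); set B := row_base _ in hB.
have eB : (B :=: kermx P)%MS by exact: eq_row_base.
exists (\rank (kermx P)); split; first exact: closed_range.
- pose Y : set V := [set u | X u /\ null (u + G1 (G2 (m u)))].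
  pose phi u := l (G2 (m u)) *m pinvmx B.
  have kerY u : op_ker X nu A u -> Y u.
    case=> v Auv nv; have [Xu /(_ (X_null nv)) nu1] := graph_inv Auv.
    split => //; have Xmu := Xm Xu; have Xv := X_null nv.
    by move: nu1; rewrite -/(G _) (lin_onB hX hG)// G_null// sub0r opprK.
  have hGm : lin_on X (fun u => G1 (G2 (m u))).
    move=> a u v Xu Xv; have Xmu := Xm Xu; have Xmv := Xm Xv.
    by rewrite hm// -!/(G _) hG.
  have hY : lin_closed Y.
    split; first by split; [case: hX|rewrite (lin_on0 hX hGm) addr0; case: hnull].
    move=> a u v [Xu nu1] [Xv nv1]; split; first by case: hX => _; apply.
    rewrite hGm// addrACA -scalerDr; case: hnull => _; exact.
  have hphi : lin_on Y phi.
    move=> a u v [Xu _] [Xv _]; have Xmu := Xm Xu; have Xmv := Xm Xv.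
    rewrite /phi hm// hG2// hl; [|exact: BMG2m|exact: BMG2m].
    by rewrite mulmxDl scalemxAl.
  have T0 u : Y u -> G2 (m u) + T (G2 (m u)) = 0.
    move=> [Xu nu1]; have Xmu := Xm Xu; have XGmu := XG Xmu.
    have Xmm := Xm XGmu.
    by rewrite -(G2null (mnull nu1)) (lin_onD hm)// (lin_onD hG2).
  have phi0 u : Y u -> null u <-> phi u = 0.
    move=> Yu; have [Xu nu1] := Yu; have Bu := BMG2m Xu; split=> [nu0|].
      by rewrite /phi (G2null (mnull nu0)) (lin_on0 hBM hl) mul0mx.
    have kerP : l (G2 (m u)) *m P = 0.
      by rewrite -lJ1T// T0// (lin_on0 hBM hJ) (lin_on0 hBM hl).
    have /mulmxKpV cE : (l (G2 (m u)) <= B)%MS by rewrite eB; apply/sub_kermxP.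
    rewrite -/(phi u) in cE => phiu0; have lu0 : l (G2 (m u)) = 0.
      by rewrite -cE phiu0 mul0mx.
    have G2mu0 : G2 (m u) = 0.
      rewrite -(KJ Bu); have -> : G2 (m u) + S (G2 (m u)) = 0.
        rewrite /S addrA T0// sub0r /F lu0 big1 ?oppr0// => i _.
        by rewrite mxE scale0r.
      by rewrite (lin_on0 hBM hJ).
    by move: nu1; rewrite G2mu0 (lin_on0 hX hG1) addr0.
  have surj c : exists2 v, op_ker X nu A v & phi v = c.
    have BP : B *m P = 0 by apply/sub_kermxP; rewrite eB.
    have lJ0 : l (J 0) = - (c *m B) *m P.
      by rewrite (lin_on0 hBM hJ) (lin_on0 hBM hl) mulNmx -mulmxA BP mulmx0 oppr0.
    have B0 : BM 0 by case: hBM.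
    have [k [Bk kT lk]] := solve_1T B0 lJ0.
    have Tk : T k = - k by apply/eqP; rewrite -addr_eq0 addrC kT.
    have XmG1k := Xm (XG1 (BMX Bk)).
    exists (G1 k); last first.
      by rewrite /phi -/(T k) Tk (lin_onN hBM hl)// lk opprK mulmxKp.
    exists 0; last by case: hnull.
    (* For g = - m (G1 k), G g = - G1 (T k) = G1 k and g + m (G1 k) = 0. *)
    have := graph_mem (lin_closedN hX XmG1k).
    rewrite (lin_onN hX hG2)// -/(T k) Tk opprK addNr; exact.
  exact: (quotient_dim_coord kerY hY hphi phi0 surj).
- by have := coker_dim; rewrite mxrank_coker mxrank_ker.
Qed.

(** An index comes with some pair of dimensions, so that uniqueness of dimensions is what decides;
    for the cokernel it uses that the range is a subspace. *)
Lemma abstract_index k : fredholm_index X nu A k -> k = 0.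
Proof.
have hrange : lin_closed (op_range X nu A).
  have X0 : X 0 by case: hX.
  split; first by apply/op_range_psi; rewrite // (lin_on0 hX hpsi).
  move=> a u v ru rv; have [[Xu _] [Xv _]] := (ru, rv).
  apply/op_range_psi; first by case: hX => _; apply.
  by move: ru rv => /(op_range_psi Xu) u0 /(op_range_psi Xv) v0;
      rewrite hpsi// u0 v0 scaler0 addr0.
move=> [n [m' [[_ hn hm'] ->]]]; have [p [_ hp hp']] := abstract_fredholm.
rewrite (quotient_dim_unique hnull hn hp) (quotient_dim_unique hrange hm' hp').
exact: subrr.
Qed.

End AbstractFredholm.

(** * Neumann series with pointwise bounds *)

Section Neumann.
Variable R : realType.

Lemma geometric_series_limit (B : R) (u : nat -> R) :
  (forall n, `|u n| <= B * 2 ^- n) ->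
  exists l, forall n, `|\sum_(i < n) u i - l| <= 2 * B * 2 ^- n.
Proof.
move=> hu; pose p n := \sum_(i < n) u i.
(* The subtracted term makes the induction on m close: the new summand is at most B 2^-m = 2 B 2^-m
   - 2 B 2^-(m+1). *)
have diff n m : (n <= m)%N -> `|p m - p n| <= 2 * B * 2 ^- n - 2 * B * 2 ^- m.
  elim: m => [|m ih]; first by rewrite leqn0 => /eqP->; rewrite !subrr normr0.
  rewrite leq_eqVlt => /predU1P[->|]; first by rewrite !subrr normr0.
  rewrite ltnS => /ih nm; rewrite {1}/p big_ord_recr/= -/(p m) addrAC.
  rewrite (le_trans (ler_normD _ _))// (le_trans (lerD nm (hu m)))//.
  by rewrite exprSr invfM; lra.
have diff' n m : (n <= m)%N -> `|p m - p n| <= 2 * B * 2 ^- n.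
  move=> /diff/le_trans; apply; rewrite lerBlDr lerDl -mulrA mulr_ge0//.
  exact: le_trans (hu m).
have cvgp : cvgn p.
  have -> : p = series u by apply/funext => n; rewrite /p /series/= big_mkord.
  apply: normed_cvg; apply: (series_le_cvg _ _ hu) => [n//|n|].
    exact: le_trans (hu n).
  have -> : (fun n => B * 2 ^- n) = geometric B (2^-1).
    by apply/funext => n; rewrite /geometric/= exprVn.
  by apply: is_cvg_geometric_series; rewrite ger0_norm; lra.
exists (limn p) => n; rewrite -/(p n) distrC.
apply: (ler_cvg_to (cvg_norm (cvgB cvgp (cvg_cst (p n)))) (cvg_cst _)).
by near=> m => /=; apply: diff'; near: m; exact: nbhs_infty_ge.
Unshelve. all: by end_near. Qed.

Lemma geometric_series_limitC (B : R) (u : nat -> R[i]) :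
  (forall n, N1 (u n) <= B * 2 ^- n) ->
  exists l, forall n, N1 (\sum_(i < n) u i - l) <= 4 * B * 2 ^- n.
Proof.
move=> hu.
have [|a ha] := @geometric_series_limit B (fun n => complex.Re (u n)).
  by move=> n; apply: le_trans (hu n); rewrite lerDl.
have [|b hb] := @geometric_series_limit B (fun n => complex.Im (u n)).
  by move=> n; apply: le_trans (hu n); rewrite lerDr.
exists (a +i* b) => n; have := lerD (ha n) (hb n).
rewrite /N1 !raddfB/= !raddf_sum/=; lra.
Qed.

Lemma half_pow_eq0 (a B : R) : 0 <= a -> (forall n, a <= B * 2 ^- n) -> a = 0.
Proof.
move=> a0 h; apply/eqP; rewrite eq_le a0 andbT.
have cv : B * 2^-1 ^+ n @[n --> \oo] --> B * 0.
  by apply: cvgMr; apply: cvg_expr; rewrite ger0_norm; lra.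
rewrite mulr0 in cv; apply: (ler_cvg_to (cvg_cst a) cv); apply: nearW => n /=.
by rewrite exprVn; exact: h.
Qed.

Variables (U : Type) (BM : set (U -> (R[i])^o)) (S : (U -> (R[i])^o) -> U -> (R[i])^o).
Hypotheses (hBM : lin_closed BM) (hS : lin_on BM S).
Hypothesis BMbd : forall k, BM k -> exists B, forall x, N1 (k x) <= B.
Hypothesis BMlim : forall (f_ : nat -> U -> (R[i])^o) f B, (forall n, BM (f_ n)) ->
  (forall n x, N1 (f_ n x - f x) <= B * 2 ^- n) -> BM f.
Hypothesis BMS : forall k, BM k -> BM (S k).
Hypothesis Shalf : forall k B, BM k -> (forall x, N1 (k x) <= B) ->
  forall x, N1 (S k x) <= B / 2.

(** The series of (- S)^n h is summed at each point. Its rate is uniform in the point, so [BMlim]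
    keeps the sum in [BM]. The 4 is a factor 2 from the geometric series and 2 from real and
    imaginary parts. *)
Lemma contraction_inverse : exists J : (U -> (R[i])^o) -> U -> (R[i])^o,
  [/\ forall h, BM h -> BM (J h), forall h, BM h -> J h + S (J h) = h,
      forall k, BM k -> J (k + S k) = k &
      forall h B, BM h -> (forall x, N1 (h x) <= B) ->
        forall x, N1 (J h x) <= 4 * B].
Proof.
have inj0 k : BM k -> k + S k = 0 -> k = 0.
  move=> Bk k0; have [B hB] := BMbd Bk.
  have kE : k = - S k by apply/eqP; rewrite -addr_eq0 k0.
  have hn n : forall x, N1 (k x) <= B * 2 ^- n.
    elim: n => [|n ih] x; first by rewrite expr0 invr1 mulr1.
    rewrite kE fctE N1N exprSr invfM.
    by rewrite mulrA; apply: Shalf.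
  by apply/funext => x; apply/N1_eq0/(half_pow_eq0 (N1_ge0 _) (hn^~ x)).
(* The implication under the existential lets choice produce a total [J], with an irrelevant value
   outside [BM]. *)
have ex h : exists k, BM h -> [/\ BM k, k + S k = h &
    forall B, (forall x, N1 (h x) <= B) -> forall x, N1 (k x) <= 4 * B].
  have [Bh|] := pselect (BM h); last by move=> nBh; exists 0.
  pose t n := iter n (fun f => - S f) h.
  have Bt n : BM (t n).
    by elim: n => [//|n ih]; apply: lin_closedN => //; exact: BMS.
  have tb B : (forall x, N1 (h x) <= B) -> forall n x, N1 (t n x) <= B * 2 ^- n.
    move=> hB; elim=> [|n ih] x; first by rewrite expr0 invr1 mulr1.
    by rewrite /t iterS -/(t n) fctE N1N exprSr invfM mulrA; apply: Shalf.
  have [B hB] := BMbd Bh.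
  have /choice[k hk] x : exists l, forall n,
      N1 (\sum_(i < n) t i x - l) <= 4 * B * 2 ^- n.
    exact: (geometric_series_limitC (tb _ hB ^~ x)).
  pose p n := \sum_(i < n) t i.
  have pE n x : p n x = \sum_(i < n) t i x by rewrite /p fct_sumE.
  have Bp n : BM (p n) by apply: lin_closed_sum => // i; exact: Bt.
  have pk n x : N1 (p n x - k x) <= 4 * B * 2 ^- n by rewrite pE.
  have Bk : BM k by exact: (BMlim Bp pk).
  exists k => _; split => //; last first.
    (* [k] was built from one bound B. For another bound the limit at x is taken again and shown to
       be the same number. *)
    move=> B' hB' x.
    have [l hl] := geometric_series_limitC (tb _ hB' ^~ x).
    have kl : k x - l = 0.
      apply/N1_eq0/(@half_pow_eq0 _ (4 * B + 4 * B')); first exact: N1_ge0.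
      move=> n; rewrite mulrDl [leRHS]addrC.
      apply: le_trans (lerD (hl n) (hk x n)); apply: le_trans (N1B _ _).
      by rewrite [X in _ <= N1 X](_ : _ = k x - l)//; ring.
    move/eqP: kl; rewrite subr_eq0 => /eqP->.
    by have := hl 0%N; rewrite big_ord0 sub0r N1N expr0 invr1 mulr1.
  have pS n : p n + S (p n) = h - t n.
    elim: n => [|n ih].
      by rewrite /p big_ord0 (lin_on0 hBM hS) addr0 subrr.
    rewrite /p big_ord_recr/= -/(p n) (lin_onD hS)//.
    by rewrite addrACA ih addrA subrK opprK.
  apply/eqP; rewrite -subr_eq0; apply/eqP/funext => x.
  (* With d = k - p n the defect is d + S d - t n; the three terms contribute 4 B, 2 B and B. *)
  apply/N1_eq0/(@half_pow_eq0 _ (4 * B + 2 * B + B)); first exact: N1_ge0.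
  move=> n; pose d := k - p n.
  have Bd : BM d by exact: lin_closedB.
  have hd y : N1 (d y) <= 4 * B * 2 ^- n by rewrite /d fctE -N1N opprB.
  have -> : k + S k - h = d + S d - t n.
    rewrite /d (lin_onB hBM hS)// addrACA -opprD pS opprB addrA.
    by rewrite [RHS]addrAC addrK.
  rewrite !fctE; apply: (le_trans (N1B _ _)); rewrite mulrDl; apply: lerD.
    apply: (le_trans (N1D _ _)); rewrite mulrDl; apply: lerD => //.
    by apply: (le_trans (Shalf Bd hd x)); lra.
  exact: tb.
have [J hJ] := choice ex; exists J; split=> h.
- by move=> /hJ[].
- by move=> /hJ[].
- move=> Bh; have BhS : BM (h + S h) by apply: lin_closedD => //; exact: BMS.
  have [BJ JE _] := hJ _ BhS.
  apply/eqP; rewrite -subr_eq0; apply/eqP/inj0; first exact: lin_closedB.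
  by rewrite (lin_onB hBM hS)// addrACA -opprD JE subrr.
- by move=> B /hJ[_ _]; exact.
Qed.

End Neumann.

(** * Smooth functions *)

Section Smooth.
Variable R : realType.
Implicit Types (f g h : R -> R) (n : nat) (x : R).

(* [dn n f]: f is n + 1 times differentiable. *)
Fixpoint dn n f : Prop := match n with
  | 0 => forall x, derivable f x 1
  | n.+1 => (forall x, derivable f x 1) /\ dn n (derive1 f)
  end.

Definition smooth f := forall n, dn n f.

Lemma dn_derivable n f x : dn n f -> derivable f x 1.
Proof. by case: n => [|n] // [] +; exact. Qed.

Lemma dnW n f : dn n.+1 f -> dn n f.
Proof.
elim: n f => [|n ih] f; first by case.
by move=> [df [df' h]]; split => //; exact: ih.
Qed.

Lemma is_derive_derive1E f g : (forall x : R, is_derive x 1 f (g x)) -> (derive1 f) = g.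
Proof. by move=> fg; apply/funext => x; rewrite derive1E; have [_ ->] := fg x. Qed.

Lemma dnS n f g : (forall x : R, is_derive x 1 f (g x)) -> dn n g -> dn n.+1 f.
Proof.
move=> fg hg; split=> [x|]; first by have [] := fg x.
by rewrite (is_derive_derive1E fg).
Qed.

Lemma dn_is n f x : dn n f -> is_derive x 1 f (derive1 f x).
Proof. by move=> /(@dn_derivable n f x) df; rewrite derive1E; exact/derivableP. Qed.

Lemma dn_cst n (c : R) : dn n (cst c).
Proof.
elim: n c => [c x|n ih c]; first exact: derivable_cst.
by apply: (dnS (g := cst 0)) => // x; exact: is_derive_cst.
Qed.

Lemma dn_id n : dn n (id : R -> R).
Proof.
case: n => [x|n]; first exact: derivable_id.
by apply: (dnS (g := cst 1)); exact: dn_cst.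
Qed.

Lemma dnD n f g : dn n f -> dn n g -> dn n (f + g).
Proof.
elim: n f g => [|n ih] f g hf hg; first by move=> x; exact: derivableD.
have [[_ hf'] [_ hg']] := (hf, hg).
apply: (dnS (g := (derive1 f) + (derive1 g))); last exact: ih.
by move=> x; apply: is_deriveD; [exact: dn_is hf|exact: dn_is hg].
Qed.

Lemma dnM n f g : dn n f -> dn n g -> dn n (f * g).
Proof.
elim: n f g => [|n ih] f g hf hg; first by move=> x; exact: derivableM.
have [[_ hf'] [_ hg']] := (hf, hg).
apply: (dnS (g := f * (derive1 g) + g * (derive1 f))).
  move=> x; have df := dn_is x hf; have dg := dn_is x hg.
  exact: is_deriveM.
by apply: dnD; apply: ih => //; exact: dnW.
Qed.

Lemma dnN n f : dn n f -> dn n (- f).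
Proof.
move=> hf; have -> : - f = cst (-1) * f.
  by apply/funext => x; rewrite !fctE mulN1r.
by apply: dnM => //; exact: dn_cst.
Qed.

Lemma dnB n f g : dn n f -> dn n g -> dn n (f - g).
Proof. by move=> hf hg; apply: dnD => //; exact: dnN. Qed.

Lemma dnV n f : (forall x, f x != 0) -> dn n f -> dn n (fun x => (f x)^-1).
Proof.
move=> f0; elim: n f f0 => [|n ih] f f0 hf.
  by move=> x; exact: derivableV.
have [_ hf'] := hf.
apply: (dnS (g := (fun x => (f x)^-1) * (fun x => (f x)^-1) * - (derive1 f))).
  move=> x; have df := dn_is x hf; apply: is_derive_eq.
  by rewrite !fctE /GRing.scale/= -expr2 exprVn mulNr mulrN.
apply: dnM; last exact: dnN.
by apply: dnM; apply: ih => //; exact: dnW.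
Qed.

Lemma is_derive_affine f (a c x l : R) : is_derive (c * x + a) 1 f l ->
  is_derive x 1 (fun y => f (c * y + a)) (c * l).
Proof.
move=> df; have da : is_derive x 1 (fun y => c * y + a) c.
  by apply: is_derive_eq; rewrite /GRing.scale/= mulr1 addr0.
by rewrite mulrC; exact: (@is_derive1_comp _ f (fun y => c * y + a) x _ _ df da).
Qed.

Lemma dn_affine n f (a c : R) : dn n f -> dn n (fun x => f (c * x + a)).
Proof.
elim: n f => [|n ih] f hf.
  by move=> x; have [] := is_derive_affine (dn_is (c * x + a) hf).
have [_ hf'] := hf.
apply: (dnS (g := cst c * (fun x => (derive1 f) (c * x + a)))).
  by move=> x; apply: is_derive_affine; exact: dn_is hf.
by apply: dnM; [exact: dn_cst|exact: ih].
Qed.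

Lemma smoothP f : smooth f <-> forall n x, derivable (derive1n n f) x 1.
Proof.
split=> [hf n|hf n].
  have := hf n; elim: n f {hf} => [//|n ih] f [_ /ih hf] x.
  by rewrite derive1Sn.
elim: n f hf => [f /(_ 0%N)//|n ih f hf]; split; first exact: (hf 0%N).
by apply: ih => m x; rewrite -derive1Sn; exact: hf.
Qed.

Lemma smooth_deriv f : smooth f -> smooth (derive1 f).
Proof. by move=> hf n; have [] := hf n.+1. Qed.

Lemma smooth_is f x : smooth f -> is_derive x 1 f (derive1 f x).
Proof. by move=> /(_ 0%N); exact: dn_is. Qed.

Lemma smooth_continuous f : smooth f -> continuous f.
Proof.
move=> hf x; apply: differentiable_continuous.
by apply/derivable1_diffP; exact: (hf 0%N).
Qed.

Lemma smoothM f g : smooth f -> smooth g -> smooth (f * g).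
Proof. by move=> hf hg n; exact: dnM. Qed.

Lemma smoothD f g : smooth f -> smooth g -> smooth (f + g).
Proof. by move=> hf hg n; exact: dnD. Qed.

Lemma smoothN f : smooth f -> smooth (- f).
Proof. by move=> hf n; exact: dnN. Qed.

End Smooth.

(** * A smooth step and its derivative *)

Section Bump.
Variable R : realType.
Implicit Types (x : R) (n : nat).

(** Serves [flat] at 0, where the defining formula changes and a quadratic bound is what is
    available. *)
Lemma is_derive_quadratic (f : R -> R) (x l C : R) :
  (forall h, `|f (x + h) - f x - l * h| <= C * h ^+ 2) -> is_derive x 1 f l.
Proof.
move=> hf.
have C0 : 0 <= C by have := le_trans (normr_ge0 _) (hf 1); rewrite expr1n mulr1.
suff cv : h^-1 *: (f (h *: (1 : R^o) + x) - f x) @[h --> 0^'] --> l.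
  split; first by apply/cvg_ex; exists l.
  exact: (cvg_lim (@Rhausdorff R)).
apply/cvgrPdist_le => e e0; near=> h.
have h0 : h != 0 by near: h; exact: nbhs_dnbhs_neq.
rewrite /GRing.scale/= mulr1 addrC.
have -> : - (h^-1 * (f (h + x) - f x)) + l = - (h^-1 * (f (x + h) - f x - l * h)).
  by rewrite [h + x]addrC; field.
rewrite normrN normrM normfV.
apply: (@le_trans _ _ (`|h|^-1 * (C * h ^+ 2))).
  by rewrite ler_wpM2l ?invr_ge0.
have -> : `|h|^-1 * (C * h ^+ 2) = C * `|h|.
  by rewrite -(real_normK (num_real h)); field; rewrite normr_eq0.
apply: (@le_trans _ _ (C * (e / (C + 1)))).
  rewrite ler_wpM2l//; near: h; apply: dnbhs0_le.
  by rewrite divr_gt0// ltr_wpDl.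
by rewrite mulrCA ger_pMr// ler_pdivrMr ?ltr_wpDl// mul1r lerDl.
Unshelve. all: by end_near. Qed.

(* x^-n exp(-1/x), extended by 0 to x <= 0. *)
Definition flat n x : R := if 0 < x then x ^- n * expR (- x^-1) else 0.

Lemma flat_le0 n x : x <= 0 -> flat n x = 0.
Proof. by rewrite /flat leNgt => /negbTE->. Qed.

Lemma flat_ge0 n x : 0 <= flat n x.
Proof.
rewrite /flat; case: ifPn => // x0.
by rewrite mulr_ge0 ?expR_ge0// invr_ge0 exprn_ge0 ?ltW.
Qed.

(** From exp y >= (y / N)^N with y = 1 / x and N = n + 2: the two powers beyond n leave the x^2 that
    gives differentiability at 0. *)
Lemma flat_le n x : `|flat n x| <= (n.+2%:R) ^+ n.+2 * x ^+ 2.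
Proof.
rewrite ger0_norm ?flat_ge0// /flat; case: ifPn => [x0|_]; last first.
  by rewrite mulr_ge0 ?sqr_ge0// exprn_ge0.
have k0 : (0 : R) < n.+2%:R by [].
have : (x^-1 / n.+2%:R) ^+ n.+2 <= expR x^-1.
  have -> : expR (x^-1) = expR (x^-1 / n.+2%:R) ^+ n.+2.
    by rewrite -expRM_natl; congr expR; field; rewrite !gt_eqF.
  rewrite lerXn2r ?nnegrE ?expR_ge0 ?divr_ge0 ?invr_ge0 ?(ltW x0)//.
  by apply: le_trans (expR_ge1Dx _); rewrite lerDr.
rewrite expRN exprMn !exprVn => h.
rewrite mulrC ler_pdivrMr ?exprn_gt0//.
rewrite -[leLHS]mul1r ler_pdivrMr ?expR_gt0//.
rewrite [leLHS](_ : _ = n.+2%:R ^+ n.+2 * x ^+ n.+2 *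
    (x ^- n.+2 / n.+2%:R ^+ n.+2)); last first.
  by field; rewrite !expf_neq0 ?gt_eqF.
rewrite -[X in _ <= X * _]mulrA -exprD add2n.
by rewrite ler_wpM2l// mulr_ge0 ?exprn_ge0// ltW.
Qed.

(** The derivative stays in the span of the family, so that one induction, for all n at once, gives
    smoothness. *)
Lemma is_derive_flat n x :
  is_derive x 1 (flat n) (flat n.+2 x - n%:R * flat n.+1 x).
Proof.
have [x0|x0|->] := ltgtP x 0.
- rewrite !flat_le0 ?(ltW x0)// mulr0 subr0.
  apply: (near_eq_is_derive _ (is_derive_cst (0 : R) x 1)).
  near=> y; rewrite flat_le0// ltW//.
  by near: y; exact: lt_nbhsl.
- have d : is_derive x 1 (fun y => y ^- n * expR (- y^-1))
      (flat n.+2 x - n%:R * flat n.+1 x).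
    have xn0 : x != 0 by rewrite gt_eqF.
    have dV : is_derive x 1 (fun y : R => y^-1) (- x ^- 2).
      have di : is_derive x 1 (fun y : R => y) 1 by exact: is_derive_id.
      by have := is_deriveV xn0 di; rewrite /GRing.scale/= mulr1.
    have dE : is_derive x 1 (fun y : R => expR (- y^-1)) (expR (- x^-1) * x ^- 2).
      have dN : is_derive x 1 (fun y : R => - y^-1) (x ^- 2).
        by apply: is_derive_eq; rewrite opprK.
      exact: (@is_derive1_comp _ expR (fun y => - y^-1) x _ _ (is_derive_expR _) dN).
    have dX : is_derive x 1 (fun y : R => y ^- n) (- n%:R * x ^- n.+1).
      have -> : (fun y : R => y ^- n) = (fun y => y^-1) ^+ n.
        by apply/funext => y; rewrite exprfctE exprVn.
      apply: is_derive_eq; rewrite /GRing.scale/= exprVn.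
      case: n => [|n]; first by rewrite mulr0n oppr0 !mul0r.
      by rewrite mulrN mulNr -mulrA -invfM -exprD addn2.
    apply: is_derive_eq.
    rewrite /GRing.scale/= /flat x0 mulrA (mulrC _ (expR _)) -mulrA -invfM -exprD addn2.
    by ring.
  apply: (near_eq_is_derive _ d).
  near=> y; rewrite /flat; case: ifPn => //; rewrite -leNgt => y0.
  suff : 0 < y by rewrite ltNge y0.
  by near: y; exact: lt_nbhsr.
- rewrite !flat_le0// mulr0 subr0.
  apply: (@is_derive_quadratic _ _ _ (n.+2%:R ^+ n.+2)) => h.
  by rewrite add0r (flat_le0 n (lexx 0)) mul0r !subr0; exact: flat_le.
Unshelve. all: by end_near. Qed.

Lemma dn_flat k n : dn k (flat n).
Proof.
elim: k n => [|k ih] n; first by move=> x; have [] := is_derive_flat n x.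
apply: (dnS (is_derive_flat n)); apply: dnB; first exact: ih.
by apply: (dnM (f := cst n%:R)); [exact: dn_cst|exact: ih].
Qed.

Definition smooth_step x : R := flat 0 x / (flat 0 x + flat 0 (1 - x)).

Lemma flat_gt0 n x : 0 < x -> 0 < flat n x.
Proof. by move=> x0; rewrite /flat x0 mulr_gt0 ?expR_gt0// invr_gt0 exprn_gt0. Qed.

Lemma smooth_smooth_step : smooth smooth_step.
Proof.
move=> n.
have dr : dn n (fun x => flat 0 (1 - x)).
  have := dn_affine (1 : R) (-1) (dn_flat n 0).
  by congr dn; apply/funext => x; rewrite mulN1r addrC.
apply: (dnM (f := flat 0)); first exact: dn_flat.
apply: (dnV (f := flat 0 + (fun x => flat 0 (1 - x)))) => [x|]; last first.
  by apply: dnD => //; exact: dn_flat.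
rewrite !fctE gt_eqF//; have [x0|x0] := leP x 0.
  by rewrite ltr_wpDl ?flat_ge0// flat_gt0//; lra.
by rewrite ltr_pwDl ?flat_ge0// flat_gt0.
Qed.

Lemma smooth_step0 x : x <= 0 -> smooth_step x = 0.
Proof. by move=> x0; rewrite /smooth_step flat_le0// mul0r. Qed.

Lemma smooth_step1 x : 1 <= x -> smooth_step x = 1.
Proof.
move=> x1; rewrite /smooth_step (flat_le0 _ (_ : 1 - x <= 0)) ?addr0; last by lra.
by rewrite divff// gt_eqF// flat_gt0//; lra.
Qed.

(** Being the derivative of a step from 0 to 1, it has integral one and a known primitive; the
    latter provides test functions with prescribed derivative. *)
Definition bump : R -> R := derive1 smooth_step.

Lemma smooth_bump : smooth bump.
Proof. exact/smooth_deriv/smooth_smooth_step. Qed.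

Lemma bump_out x : x < 0 \/ 1 < x -> bump x = 0.
Proof.
move=> h; rewrite /bump derive1E; case: h => [x0|x1].
  have := @near_eq_derive _ _ _ smooth_step (cst 0) x 1 => ->.
    by rewrite derive_cst.
  by near=> y; rewrite smooth_step0// ltW//; near: y; exact: lt_nbhsl.
have := @near_eq_derive _ _ _ smooth_step (cst 1) x 1 => ->.
  by rewrite derive_cst.
by near=> y; rewrite smooth_step1// ltW//; near: y; exact: lt_nbhsr.
Unshelve. all: by end_near. Qed.

Lemma bump_bounded : exists2 K : R, 0 < K & forall x, `|bump x| <= K.
Proof.
have cb : {within `[0, 1], continuous (fun x => `|bump x|)}.
  apply: continuous_subspaceT => x; apply: continuous_comp.
    exact/smooth_continuous/smooth_bump.
  exact: norm_continuous.
have [c _ hc] := EVT_max ler01 cb.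
exists (`|bump c| + 1); first by rewrite ltr_wpDl.
move=> x; have [x01|x01] := boolP (x \in `[0, 1]).
  by rewrite (le_trans (hc x x01))// lerDl.
rewrite bump_out ?normr0 ?addr_ge0//.
move: x01; rewrite in_itv/= negb_and -!ltNge => /orP[]; [left|right]; done.
Qed.

End Bump.

Section RealIntegral.
Context d (T : measurableType d) (R : realType).
Variables (mu : {measure set T -> \bar R}) (D : set T) (mD : measurable D).
Implicit Types f g : T -> R.
Local Notation intg f := (mu.-integrable D (EFin \o f)).

Lemma intgZ k f : intg f -> intg (fun x => k * f x).
Proof. by move=> fi; apply: eq_integrable (integrableZl mD k fi). Qed.

Lemma intgD f g : intg f -> intg g -> intg (fun x => f x + g x).
Proof. by move=> fi gi; apply: eq_integrable (integrableD mD fi gi). Qed.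

Lemma intgB f g : intg f -> intg g -> intg (fun x => f x - g x).
Proof. by move=> fi gi; apply: eq_integrable (integrableB mD fi gi). Qed.

Lemma intg_le f g : measurable_fun D f -> intg g ->
  (forall x, D x -> `|f x| <= g x) -> intg f.
Proof.
move=> mf gi fg; apply: (le_integrable mD _ _ gi); first exact/measurable_EFinP.
by move=> x Dx /=; rewrite lee_fin (le_trans (fg x Dx))// ler_norm.
Qed.

Lemma intg_norm f : intg f -> intg (fun x => `|f x|).
Proof. exact: integrable_norm. Qed.

Lemma intg_ge0P f : measurable_fun D f -> (forall x, D x -> 0 <= f x) ->
  (\int[mu]_(x in D) (f x)%:E < +oo)%E -> intg f.
Proof.
move=> mf f0 h; apply/integrableP; split; first exact/measurable_EFinP.
by under eq_integral => x /[!inE] /f0 fx do rewrite /= ger0_norm//.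
Qed.

Lemma fin_Rintegral f : intg f ->
  (\int[mu]_(x in D) (f x)%:E = (\int[mu]_(x in D) f x)%R%:E)%E.
Proof. by move=> fi; rewrite /Rintegral fineK// integrable_fin_num. Qed.

Lemma ae_eq_Rintegral f g : measurable_fun D f -> measurable_fun D g ->
  ae_eq mu D f g -> \int[mu]_(x in D) f x = \int[mu]_(x in D) g x.
Proof.
move=> mf mg fg; rewrite /Rintegral; congr fine; apply: ae_eq_integral => //.
- exact/measurable_EFinP.
- exact/measurable_EFinP.
- by apply: filterS fg => x h /h ->.
Qed.

End RealIntegral.

(** * Weak derivatives *)

Section TestFunctions.
Variable R : realType.
Implicit Types (f g u m phi : R -> R) (M : R) (x : R).
Local Notation mu := (@lebesgue_measure R).
Local Notation intg f := (mu.-integrable setT (EFin \o f)).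
Local Notation locint := (locally_integrable setT).

Lemma test_functionP phi :
  test_function phi <->
  smooth phi /\ exists M, forall x, M < `|x| -> phi x = 0.
Proof.
split=> [[sphi cphi]|[sphi [M hM]]]; split; try exact/smoothP.
  have [M [_ /(_ (M + 1))]] := compact_bounded cphi.
  rewrite ltrDl ltr01 => /(_ isT) hM; exists (M + 1) => x Mx.
  apply/eqP/negPn/negP => phix; have /hM : closure [set x | phi x != 0] x.
    exact: subset_closure.
  by rewrite /= leNgt Mx.
apply: (subclosed_compact _ (@segment_compact R (- M) M)).
  exact: closed_closure.
have cM : closed `[- M, M] by exact: itv_closed.
rewrite ((closure_id _).1 cM); apply: closure_subset => x /= phix.
rewrite in_itv/= -ler_norml leNgt; apply/negP => /hM phi0.
by rewrite phi0 eqxx in phix.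
Qed.

Lemma test_smooth phi : test_function phi -> smooth phi.
Proof. by case/test_functionP. Qed.

Lemma test_deriv phi : test_function phi -> test_function (derive1 phi).
Proof.
case/test_functionP => sphi [M hM]; apply/test_functionP; split.
  exact: smooth_deriv.
exists M => x Mx; rewrite derive1E.
have := @near_eq_derive _ _ _ phi (cst 0) x 1 => ->; first by rewrite derive_cst.
near=> y; apply: hM; near: y.
by apply: (cvgr_gt `|x|) => //; exact: norm_continuous.
Unshelve. all: by end_near. Qed.

Lemma testM m phi : smooth m -> test_function phi -> test_function (m * phi).
Proof.
move=> sm /test_functionP[sphi [M hM]]; apply/test_functionP; split.
  exact: smoothM.
by exists M => x /hM phi0; rewrite fctE phi0 mulr0.
Qed.

Lemma continuous_bounded_segment m M : continuous m ->
  exists2 B, 0 <= B & forall x, `|x| <= M -> `|m x| <= B.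
Proof.
move=> cm.
have := continuous_compact (continuous_subspaceT cm) (@segment_compact R (- M) M).
move=> /compact_bounded[B [_ /(_ (`|B| + 1))]].
rewrite ltr_pwDr ?ler_norm// => /(_ isT) hB; exists (`|B| + 1).
  by rewrite addr_ge0.
by move=> x xM; apply: hB => /=; exists x => //=; rewrite in_itv/= -ler_norml.
Qed.

Lemma locint_mul m u : continuous m -> locint u -> locint (m * u).
Proof.
move=> cm [mu_ _ hu]; split; [|exact: openT|move=> K _ cK].
  by apply: measurable_funM => //; exact: continuous_measurable_fun.
have [C [_ /(_ (`|C| + 1))]] := compact_bounded cK.
rewrite ltr_pwDr ?ler_norm// => /(_ isT) hC.
have [B B0 hB] := continuous_bounded_segment (`|C| + 1) cm.
have mK : measurable K by exact: compact_measurable.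
apply: (@le_lt_trans _ _ (\int[mu]_(x in K) (B%:E * `|u x|%:E))%E).
  apply: ge0_le_integral => //.
  - apply/measurable_EFinP/measurableT_comp => //.
    apply: measurable_funM; apply: measurable_funTS => //.
    exact: continuous_measurable_fun.
  - apply/measurable_EFinP/measurable_funM => //; apply: measurableT_comp => //.
    exact: measurable_funTS.
  - move=> x Kx; rewrite -EFinM lee_fin fctE normrM ler_wpM2r//.
    exact/hB/hC.
rewrite ge0_integralZl//; last first.
  by apply/measurable_EFinP/measurableT_comp => //; exact: measurable_funTS.
by rewrite lte_mul_pinfty//; exact: hu.
Qed.

Lemma locint_integrable_test u phi M : locint u -> continuous phi ->
  (forall x, M < `|x| -> phi x = 0) -> intg (u * phi).
Proof.
move=> lu cphi phi0; have [mu_ _ hu] : locint (phi * u) by exact: locint_mul.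
rewrite mulrC; apply/integrableP; split; first exact/measurable_EFinP.
have cM := @segment_compact R (- M) M.
apply: le_lt_trans (hu _ (@subsetT _ _) cM).
rewrite [leRHS]integral_mkcond; apply: ge0_le_integral => //.
- by do 2 apply: measurableT_comp => //.
- apply/(measurable_restrictT _ _).1 => //.
  by apply/measurable_EFinP/measurableT_comp => //; exact: measurable_funTS.
- move=> x _; rewrite /patch; case: ifPn => // /negP xM.
  rewrite /= fctE phi0 ?mul0r ?normr0//.
  by rewrite ltNge ler_norml; apply/negP => h; apply: xM; rewrite inE/= in_itv.
Qed.

Lemma test_integrable u phi : locint u -> test_function phi -> intg (u * phi).
Proof.
move=> lu /test_functionP[sphi [M hM]].
by apply: locint_integrable_test hM => //; exact: smooth_continuous.
Qed.

End TestFunctions.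

Section WeakDerivative.
Variable R : realType.
Implicit Types (f g u v m phi : R -> R) (x : R).
Local Notation mu := (@lebesgue_measure R).
Local Notation intg f := (mu.-integrable setT (EFin \o f)).
Local Notation locint := (locally_integrable setT).

Lemma weak_deriv1P u g : real_weak_deriv 1 u g <->
  [/\ locint u, locint g & forall phi, test_function phi ->
    \int[mu]_x (u x * derive1 phi x) = - \int[mu]_x (g x * phi x)].
Proof.
split=> [[lu lg h]|[lu lg h]]; split => // phi tphi.
  by rewrite (h _ tphi) expr1 mulN1r.
by rewrite expr1 mulN1r -h.
Qed.

(** Test the derivative of [u] against [m * phi] and expand (m phi)' by the Leibniz rule. *)
Lemma weak_deriv_mul m u g : smooth m -> real_weak_deriv 1 u g ->
  real_weak_deriv 1 (m * u) (derive1 m * u + m * g).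
Proof.
move=> sm /weak_deriv1P[lu lg h]; apply/weak_deriv1P.
have cm := smooth_continuous sm.
have cm' := smooth_continuous (smooth_deriv sm).
have l1 := locint_mul cm' lu; have l2 := locint_mul cm lg.
split; [exact: locint_mul|exact: locally_integrableD|move=> phi tphi].
have tmphi := testM sm tphi; have tm'phi := testM (smooth_deriv sm) tphi.
have i1 := test_integrable lu (test_deriv tmphi).
have i2 := test_integrable lu tm'phi.
have i3 := test_integrable l1 tphi; have i4 := test_integrable l2 tphi.
have dE : derive1 (m * phi) = m * derive1 phi + phi * derive1 m.
  apply: is_derive_derive1E => y.
  have dm := smooth_is y sm; have dphi := smooth_is y (test_smooth tphi).
  exact: is_deriveM.
transitivity (\int[mu]_x ((u * derive1 (m * phi)) x - (u * (derive1 m * phi)) x)).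
  by apply: eq_Rintegral => x _; rewrite dE !fctE; ring.
rewrite RintegralB// (h _ tmphi).
transitivity (- (\int[mu]_x ((m * g * phi) x + (derive1 m * u * phi) x))).
  rewrite RintegralD// opprD; congr (- _ - _).
    by apply: eq_Rintegral => x _; rewrite !fctE; ring.
  by apply: eq_Rintegral => x _; rewrite !fctE; ring.
by congr (- _); apply: eq_Rintegral => x _; rewrite !fctE; ring.
Qed.

Lemma weak_derivD u g v f : real_weak_deriv 1 u g -> real_weak_deriv 1 v f ->
  real_weak_deriv 1 (u + v) (g + f).
Proof.
move=> /weak_deriv1P[lu lg h] /weak_deriv1P[lv lf h']; apply/weak_deriv1P.
split; [exact: locally_integrableD|exact: locally_integrableD|move=> phi tphi].
have tphi' := test_deriv tphi.
have i1 := test_integrable lu tphi'; have i2 := test_integrable lv tphi'.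
have i3 := test_integrable lg tphi; have i4 := test_integrable lf tphi.
transitivity (\int[mu]_x ((u * derive1 phi) x + (v * derive1 phi) x)).
  by apply: eq_Rintegral => x _; rewrite !fctE; ring.
rewrite RintegralD//.
transitivity (- (\int[mu]_x ((g * phi) x + (f * phi) x))).
  by rewrite RintegralD// opprD; congr (_ + _); [exact: h|exact: h'].
by congr (- _); apply: eq_Rintegral => x _; rewrite !fctE; ring.
Qed.

Lemma weak_derivN u g : real_weak_deriv 1 u g -> real_weak_deriv 1 (- u) (- g).
Proof.
move=> h; have sm : smooth (cst (-1 : R)) by move=> n; exact: dn_cst.
have := weak_deriv_mul sm h.
have -> : derive1 (cst (-1 : R)) * u + cst (-1) * g = - g.
  apply/funext => x; rewrite !fctE derive1E derive_cst; ring.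
by have -> : cst (-1) * u = - u by apply/funext => x; rewrite !fctE; ring.
Qed.

Lemma weak_derivB u g v f : real_weak_deriv 1 u g -> real_weak_deriv 1 v f ->
  real_weak_deriv 1 (u - v) (g - f).
Proof. by move=> h /weak_derivN; exact: weak_derivD. Qed.

Lemma weak_deriv_comp u u1 u2 : real_weak_deriv 1 u u1 ->
  real_weak_deriv 1 u1 u2 -> real_weak_deriv 2 u u2.
Proof.
move=> /weak_deriv1P[lu l1 h] /weak_deriv1P[_ l2 h']; split => // phi tphi.
by rewrite sqrrN expr1n mul1r -[RHS]opprK -h'// -h//; exact: test_deriv.
Qed.

(** The operator's domain provides [u2] as a second derivative of [u], whereas the factorization
    differentiates [u1]; testing with phi' reconciles the two. *)
Lemma weak_deriv_succ u u1 u2 : real_weak_deriv 1 u u1 ->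
  real_weak_deriv 2 u u2 -> real_weak_deriv 1 u1 u2.
Proof.
move=> /weak_deriv1P[lu l1 h] [_ l2 h']; apply/weak_deriv1P; split => // phi tphi.
apply: oppr_inj; rewrite -h ?opprK; last exact: test_deriv.
by have := h' _ tphi; rewrite sqrrN expr1n mul1r.
Qed.

End WeakDerivative.

(** * The fundamental lemma of the calculus of variations and the lemma of du Bois-Reymond *)

Section FundamentalLemma.
Variable R : realType.
Implicit Types (f g u v m phi q : R -> R) (x a e : R).
Local Notation mu := (@lebesgue_measure R).
Local Notation intg f := (mu.-integrable setT (EFin \o f)).
Local Notation locint := (locally_integrable setT).

Lemma Rintegral_deriv f (a b : R) : smooth f -> a <= b ->
  \int[mu]_(x in `[a, b]) derive1 f x = f b - f a.
Proof.
move=> sf; rewrite le_eqVlt => /predU1P[->|ab].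
  by rewrite set_itv1 Rintegral_set1 subrr.
have cf := smooth_continuous sf.
rewrite /Rintegral (continuous_FTC2 (F := f) ab)//.
- by apply: continuous_subspaceT; exact/smooth_continuous/smooth_deriv.
- split=> [x _| |]; first exact: (sf 0%N).
  + by apply: cvg_at_right_filter; exact: cf.
  + by apply: cvg_at_left_filter; exact: cf.
Qed.

Lemma Rintegral_support f (A : set R) : measurable A ->
  (forall x, ~ A x -> f x = 0) -> \int[mu]_x f x = \int[mu]_(x in A) f x.
Proof.
move=> mA f0; rewrite [RHS]Rintegral_mkcond; apply: eq_Rintegral => x _.
rewrite /patch; case: ifPn => // /negP xA; apply: f0 => Ax.
by apply: xA; rewrite inE.
Qed.

Definition bumpe a e x := bump (e^-1 * x + - a / e).

Lemma bumpeE a e x : bumpe a e x = bump ((x - a) / e).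
Proof. by rewrite /bumpe; congr bump; ring. Qed.

Lemma bumpe_out a e x : 0 < e -> x < a \/ a + e < x -> bumpe a e x = 0.
Proof.
move=> e0 h; rewrite bumpeE bump_out//.
rewrite ltr_pdivrMr// ltr_pdivlMr// mul0r mul1r; case: h => h; [left|right]; lra.
Qed.

Lemma smooth_bumpe a e : smooth (bumpe a e).
Proof. by move=> n; apply: dn_affine; exact: smooth_bump. Qed.

Lemma test_bumpe a e : 0 < e -> test_function (bumpe a e).
Proof.
move=> e0; apply/test_functionP; split; first exact: smooth_bumpe.
exists (`|a| + e) => x hx; apply: bumpe_out => //.
by move: hx; case: (ler0P a); case: (ler0P x) => ? ? ?; [left|right|left|right]; lra.
Qed.

Definition stepe a e x : R := e * smooth_step (e^-1 * x + - a / e).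

Lemma smooth_stepe a e : smooth (stepe a e).
Proof.
move=> n; apply: (dnM (f := cst e)); first exact: dn_cst.
by apply: dn_affine; exact: smooth_smooth_step.
Qed.

Lemma deriv_stepe a e : 0 < e -> derive1 (stepe a e) = bumpe a e.
Proof.
move=> e0; apply: is_derive_derive1E => x.
have d := is_derive_affine (smooth_is (e^-1 * x + - a / e) (@smooth_smooth_step R)).
have := is_deriveZ e d; rewrite /GRing.scale/= mulrA divff ?gt_eqF// mul1r.
exact.
Qed.

Lemma stepe0 a e x : 0 < e -> x <= a -> stepe a e x = 0.
Proof.
move=> e0 xa; rewrite /stepe smooth_step0 ?mulr0//.
have -> : e^-1 * x + - a / e = (x - a) / e by ring.
by rewrite ler_pdivrMr// mul0r; lra.
Qed.

Lemma stepe1 a e x : 0 < e -> a + e <= x -> stepe a e x = e.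
Proof.
move=> e0 xa; rewrite /stepe smooth_step1 ?mulr1//.
have -> : e^-1 * x + - a / e = (x - a) / e by ring.
by rewrite ler_pdivlMr// mul1r; lra.
Qed.

Lemma Rintegral_bumpe a e : 0 < e -> \int[mu]_x bumpe a e x = e.
Proof.
move=> e0; rewrite (@Rintegral_support _ `[a, a + e])//; last first.
  move=> x /= /negP; rewrite in_itv/= negb_and -!ltNge => /orP h.
  exact: bumpe_out.
rewrite -deriv_stepe// Rintegral_deriv; [|exact: smooth_stepe|lra].
by rewrite stepe1// stepe0// subr0.
Qed.

Lemma locint_cst (c : R) : locint (cst c).
Proof.
have -> : cst c = cst c * \1_setT :> (R -> R).
  by apply/funext => x; rewrite !fctE indicT mulr1.
apply: locint_mul; first exact: cst_continuous.
by apply: locally_integrable_indic => //; exact: openT.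
Qed.

Lemma bumpe_lebesgue_pt q a : locint q -> lebesgue_pt q a ->
  forall eps : R, 0 < eps -> exists2 d : R, 0 < d &
  forall e, 0 < e < d -> `|\int[mu]_x (q x * bumpe a e x) - e * q a| <= eps * e.
Proof.
move=> lq la eps eps0; have [K K0 hK] := bump_bounded R.
(* The support [a, a + e] lies in the ball of radius 2 e, of measure 4 e, and the bump is at most K
   in absolute value: hence the divisor 4 K. *)
have epsK : 0 < eps / (4 * K) by rewrite divr_gt0// mulr_gt0.
have [r /= r0 hr] : \forall r \near 0^'+, (davg q a r < (eps / (4 * K))%:E)%E.
  by apply: (la [set y | (y < (eps / (4 * K))%:E)%E]); exact: open_ereal_lt'.
exists (r / 2) => [|e /andP[e0 er]]; first by rewrite divr_gt0.
have tb := test_bumpe a e0.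
have lqa : locint (q - cst (q a)) by apply: locally_integrableB => //; exact: locint_cst.
have i1 := test_integrable lq tb; have i2 := test_integrable (locint_cst (q a)) tb.
have i3 := test_integrable lqa tb.
have -> : \int[mu]_x (q x * bumpe a e x) - e * q a =
    \int[mu]_x ((q - cst (q a)) * bumpe a e) x.
  have -> : e * q a = \int[mu]_x (q a * bumpe a e x).
    rewrite RintegralZl//; last first.
      have := test_integrable (locint_cst 1) tb; apply: eq_integrable => // x _.
      by rewrite /= !fctE mul1r.
    by rewrite Rintegral_bumpe// mulrC.
  rewrite -RintegralB//; apply: eq_Rintegral => x _; rewrite !fctE; ring.
apply: (le_trans (le_normr_Rintegral _ i3)) => //.
pose B := ball a (2 * e); have mB : measurable B by exact: measurable_ball.
have out x : ~ B x -> bumpe a e x = 0.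
  rewrite /B /ball/= => /negP; rewrite -leNgt => h; apply: bumpe_out => //.
  by move: h; case: (ler0P (a - x)) => ? ?; [right|left]; lra.
rewrite (Rintegral_support mB); last first.
  by move=> x /out b0; rewrite !fctE b0 mulr0 normr0.
have e20 : 0 < 2 * e by rewrite mulr_gt0.
have := hr (2 * e); rewrite /ball/= sub0r normrN gtr0_norm// => /(_ _ e20).
have -> : 2 * e < r by lra.
move=> /(_ isT); rewrite /davg /iavg lebesgue_measure_ball ?(ltW e20)//.
rewrite inver mulrn_eq0/= gt_eqF// -/B => hB.
have iB : mu.-integrable B (EFin \o (fun x => `|(q - cst (q a)) x|)).
  have [mq _ hq] := lqa.
  apply/integrableP; split.
    apply/measurable_EFinP/measurableT_comp => //; exact: measurable_funTS.
  have cK := @segment_compact R (a - 2 * e) (a + 2 * e).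
  have BK : B `<=` `[a - 2 * e, a + 2 * e].
    by rewrite /B ball_itv; exact: subset_itv_oo_cc.
  apply: le_lt_trans (hq _ (@subsetT _ _) cK).
  under eq_integral do rewrite /= normr_id.
  apply: ge0_subset_integral => //.
  by apply/measurable_EFinP/measurableT_comp => //; exact: measurable_funTS.
apply: (@le_trans _ _ (\int[mu]_(x in B) (K * `|(q - cst (q a)) x|))).
  apply: le_Rintegral => //.
  - by apply: (integrableS measurableT) => //; exact: (integrable_norm i3).
  - exact: intgZ.
  - move=> x _; rewrite [X in `|X|](_ : _ = (q - cst (q a)) x * bumpe a e x)//.
    by rewrite normrM mulrC ler_wpM2r//; exact: hK.
rewrite RintegralZl//.
have hB' : \int[mu]_(x in B) `|(q - cst (q a)) x| <= eps / (4 * K) * (2 * e *+ 2).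
  move: hB; have := @fin_Rintegral _ _ _ mu B mB _ iB; rewrite /= => ->.
  rewrite -EFinM lte_fin mulrC ltr_pdivrMr; last by rewrite mulrn_wgt0.
  exact: ltW.
apply: (le_trans (ler_wpM2l (ltW K0) hB')).
rewrite le_eqVlt; apply/orP; left; apply/eqP; field; rewrite gt_eqF//.
Qed.

Lemma ae_filter_imply (P Q : R -> Prop) : (forall x, P x -> Q x) ->
  {ae mu, forall x, P x} -> {ae mu, forall x, Q x}.
Proof. by move=> PQ; exact: (@filterS _ _ (ae_filter_ringOfSetsType mu)). Qed.

(** Bumps shrinking to a Lebesgue point recover the value of [q] there. *)
Lemma fundamental_lemma q : locint q ->
  (forall phi, test_function phi -> \int[mu]_x (q x * phi x) = 0) ->
  {ae mu, forall x, q x = 0}.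
Proof.
move=> lq h; apply: ae_filter_imply (lebesgue_differentiation lq) => a la.
apply/eqP; rewrite -normr_le0; apply/ler_addgt0Pl => eps eps0; rewrite addr0.
have [d d0 hd] := bumpe_lebesgue_pt lq la eps0.
have e0 : 0 < d / 2 by rewrite divr_gt0.
have dd : 0 < d / 2 < d by rewrite e0; lra.
have := hd _ dd; rewrite h; last exact: test_bumpe.
by rewrite sub0r normrN normrM (gtr0_norm e0) [leRHS]mulrC ler_pM2l.
Qed.

Lemma test_stepeB a b e : 0 < e -> test_function (stepe a e - stepe b e).
Proof.
move=> e0; apply/test_functionP; split.
  by apply: smoothD; [|apply: smoothN]; exact: smooth_stepe.
exists (`|a| + `|b| + e) => x; rewrite !fctE => hx.
have [a1 a2 b1 b2] : [/\ a <= `|a|, - a <= `|a|, b <= `|b| & - b <= `|b|].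
  by rewrite !ler_norm -!(normrN a) -!(normrN b) !ler_norm.
have [x0|x0] := leP x 0.
  have hx' : `|a| + `|b| + e < - x by rewrite -(ler0_norm x0).
  by rewrite !stepe0 ?subrr//; clear -a1 a2 b1 b2 hx' e0; lra.
have hx' : `|a| + `|b| + e < x by rewrite -(gtr0_norm x0).
by rewrite !stepe1 ?subrr//; clear -a1 a2 b1 b2 hx' e0; lra.
Qed.

Lemma deriv_stepeB a b e : 0 < e ->
  derive1 (stepe a e - stepe b e) = bumpe a e - bumpe b e.
Proof.
move=> e0; apply: is_derive_derive1E => y.
have da := smooth_is y (smooth_stepe a e).
have db := smooth_is y (smooth_stepe b e).
by rewrite !deriv_stepe// in da db; exact: is_deriveB.
Qed.

(** [stepe a e - stepe b e] has compact support because both steps end at the height e, and its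
    derivative is a difference of bumps. So [q] takes the same value at any two Lebesgue points. *)
Lemma du_bois_reymond q : locint q ->
  (forall phi, test_function phi -> \int[mu]_x (q x * derive1 phi x) = 0) ->
  exists c : R, {ae mu, forall x, q x = c}.
Proof.
move=> lq h.
have eqq a b : lebesgue_pt q a -> lebesgue_pt q b -> q a = q b.
  move=> la lb; apply/eqP; rewrite -subr_eq0 -normr_le0.
  apply/ler_addgt0Pl => eps eps0; rewrite addr0.
  have eps20 : 0 < eps / 2 by rewrite divr_gt0.
  have [d d0 hd] := bumpe_lebesgue_pt lq la eps20.
  have [d' d'0 hd'] := bumpe_lebesgue_pt lq lb eps20.
  pose e := Num.min d d' / 2.
  have e0 : 0 < e by rewrite divr_gt0// lt_min d0.
  have [md md'] : Num.min d d' <= d /\ Num.min d d' <= d' by rewrite !ge_min !lexx orbT.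
  have := hd e; have := hd' e; rewrite e0 /e /=.
  have -> : Num.min d d' / 2 < d by lra.
  have -> : Num.min d d' / 2 < d' by lra.
  rewrite -/e => /(_ isT) hb /(_ isT) ha.
  have ta := test_bumpe a e0; have tb := test_bumpe b e0.
  have ia := test_integrable lq ta; have ib := test_integrable lq tb.
  have : \int[mu]_x (q x * bumpe a e x) = \int[mu]_x (q x * bumpe b e x).
    apply/eqP; rewrite -subr_eq0; apply/eqP.
    rewrite -(RintegralB measurableT ia ib) -[RHS](h _ (test_stepeB a b e0)).
    by apply: eq_Rintegral => x _; rewrite deriv_stepeB// !fctE mulrBr.
  move=> hab; rewrite hab in ha.
  have := ler_normB (\int[mu]_x (q x * bumpe b e x) - e * q b)
    (\int[mu]_x (q x * bumpe b e x) - e * q a).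
  rewrite (_ : _ - _ - _ = e * (q a - q b)); last by ring.
  rewrite normrM (gtr0_norm e0) => hh.
  rewrite -(ler_pM2l e0); apply: (le_trans hh); apply: (le_trans (lerD hb ha)).
  by rewrite -mulrDl -splitr mulrC.
have [|nex] := pselect (exists a, lebesgue_pt q a).
  move=> [a la]; exists (q a).
  by apply: ae_filter_imply (lebesgue_differentiation lq) => x lx; exact: eqq.
exists 0; apply: ae_filter_imply (lebesgue_differentiation lq) => x lx.
by case: nex; exists x.
Qed.

Lemma weak_deriv_unique k u g g' : real_weak_deriv k u g ->
  real_weak_deriv k u g' -> {ae mu, forall x, g x = g' x}.
Proof.
move=> [lu lg h] [_ lg' h'].
have lgg' : locint (g - g') by exact: locally_integrableB.
suff : {ae mu, forall x, (g - g') x = 0}.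
  by apply: ae_filter_imply => x /eqP; rewrite fctE subr_eq0 => /eqP.
apply: fundamental_lemma => // phi tphi.
have i := test_integrable lg tphi; have i' := test_integrable lg' tphi.
transitivity (\int[mu]_x ((g * phi) x - (g' * phi) x)).
  by apply: eq_Rintegral => x _; rewrite !fctE; ring.
rewrite RintegralB//; apply/eqP; rewrite subr_eq0; apply/eqP.
have s0 : (-1 : R) ^+ k != 0 by rewrite expf_neq0// oppr_eq0 oner_eq0.
by apply: (mulfI s0); rewrite -(h _ tphi) -(h' _ tphi).
Qed.

Lemma weak_deriv0_cst u : real_weak_deriv 1 u (cst 0) ->
  exists c : R, {ae mu, forall x, u x = c}.
Proof.
move=> /weak_deriv1P[lu _ h]; apply: du_bois_reymond => // phi tphi.
rewrite h// (_ : (fun x => cst 0 x * phi x) = cst 0).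
  by rewrite Rintegral_cst// mul0r oppr0.
by apply/funext => x; rewrite /= mul0r.
Qed.

End FundamentalLemma.

(** * Exponentially decaying kernels *)

Section RealKernel.
Variable R : realType.
Local Notation mu := (@lebesgue_measure R).
Local Notation intg f := (mu.-integrable setT (EFin \o f)).
Implicit Types (d x y : R).

Lemma measurable_Rintegral_param (g : R * R -> R) : measurable_fun setT g ->
  measurable_fun setT (fun x => \int[mu]_y g (x, y)).
Proof.
move=> mg.
have mg' : measurable_fun setT (EFin \o g) by exact/measurable_EFinP.
have -> : (fun x => \int[mu]_y g (x, y)) =
    fine \o (fun x => \int[mu]_y ((EFin \o g)^\+ (x, y)) -
                      \int[mu]_y ((EFin \o g)^\- (x, y)))%E.
  apply/funext => x; rewrite /Rintegral; congr fine; rewrite [LHS]integralE.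
  by congr (_ - _)%E; apply: eq_integral => y _; rewrite ?funeposE ?funenegE.
apply: measurableT_comp => //; apply: emeasurable_funB.
- apply: (@measurable_fun_fubini_tonelli_F _ _ _ _ _ mu) => //.
  exact: measurable_funepos.
- apply: (@measurable_fun_fubini_tonelli_F _ _ _ _ _ mu) => //.
  exact: measurable_funeneg.
Qed.

Definition ek d x y : R := expR (- d * `|x - y|).

Lemma ekC d x y : ek d x y = ek d y x.
Proof. by rewrite /ek distrC. Qed.

Lemma ek_ge0 d x y : 0 <= ek d x y. Proof. exact: expR_ge0. Qed.

Lemma ek_le1 d x y : 0 < d -> ek d x y <= 1.
Proof. by move=> d0; rewrite /ek expR_le1// mulNr oppr_le0 mulr_ge0// ltW. Qed.

Lemma ekD d x y : ek d x y = ek (d / 2) x y * ek (d / 2) x y.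
Proof. by rewrite /ek -expRD; congr expR; lra. Qed.

Lemma continuous_ek d x : continuous (ek d x).
Proof.
move=> y; apply: continuous_comp; last exact: continuous_expR.
apply: cvgMr; apply: cvg_norm; apply: cvgB; [exact: cvg_cst|exact: cvg_id].
Qed.

Lemma measurable_ek d x : measurable_fun setT (ek d x).
Proof. exact: (continuous_measurable_fun (@continuous_ek d x)). Qed.

Lemma measurable_ek2 d : measurable_fun setT (fun p : R * R => ek d p.1 p.2).
Proof.
apply: measurableT_comp => //; apply: measurable_funM => //.
by apply: measurableT_comp => //; exact: measurable_funB.
Qed.

Let ek_righty d x : 0 < d ->
  (\int[mu]_(y in `[x, +oo[) (ek d x y)%:E = (d^-1)%:E)%E.
Proof.
move=> d0; pose F y := - d^-1 * expR (- d * (y - x)).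
have dF y : is_derive y 1 F (expR (- d * (y - x))).
  have h : is_derive y 1 (fun y => expR (- d * y + d * x)) (- d * expR (- d * y + d * x)).
    exact: (is_derive_affine (is_derive_expR _)).
  have -> : F = (fun y => - d^-1 * expR (- d * y + d * x)).
    by apply/funext => z; rewrite /F; congr (_ * expR _); ring.
  have := is_deriveZ (- d^-1) h; rewrite /GRing.scale/= mulrA mulrNN mulVf ?gt_eqF// mul1r.
  by congr is_derive; congr expR; ring.
have cE : continuous (fun y => expR (- d * (y - x))).
  move=> y; apply: continuous_comp; last exact: continuous_expR.
  by apply: cvgMr; apply: cvgB; [exact: cvg_id|exact: cvg_cst].
have -> : (\int[mu]_(y in `[x, +oo[) (ek d x y)%:E =
    \int[mu]_(y in `[x, +oo[) (expR (- d * (y - x)))%:E)%E.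
  apply: eq_integral => y; rewrite inE/= in_itv/= andbT => xy.
  by rewrite /ek distrC ger0_norm// subr_ge0.
rewrite (@ge0_continuous_FTC2y _ _ F x 0)//.
- by rewrite /F subrr mulr0 expR0 mulr1 sub0e -EFinN opprK.
- exact: continuous_subspaceT.
- rewrite -[X in _ --> X](mulr0 (- d^-1)); apply: cvgMr.
  have h : d * (y - x) @[y --> +oo] --> +oo.
    by apply: gt0_cvgMry => //; exact: cvg_addrr.
  have := @cvg_comp _ _ _ (fun y => d * (y - x)) (fun z =>
      expR (- z)) _ _ _ h (@cvgr_expR R); apply: cvg_trans; apply: near_eq_cvg.
  by apply: nearW => y /=; rewrite mulNr.
- apply: cvg_at_right_filter; apply: differentiable_continuous.
  by apply/derivable1_diffP; have [] := dF x.
- by move=> y _; rewrite (is_derive_derive1E dF).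
Qed.

Lemma intg_ek d x : 0 < d -> intg (ek d x) /\ \int[mu]_y ek d x y <= 2 / d.
Proof.
move=> d0.
have mE : measurable_fun setT (EFin \o ek d x).
  by apply/measurable_EFinP; exact: measurable_ek.
have h : (\int[mu]_y (ek d x y)%:E <= (2 / d)%:E)%E.
  have -> : [set: R] = `]-oo, x[ `|` `[x, +oo[.
    by rewrite -itv_bndbnd_setU// set_itvNyy.
  rewrite ge0_integral_setU//; last 3 first.
  - exact: measurable_funTS.
  - by move=> y _; rewrite lee_fin ek_ge0.
  - apply/disj_setPLR => y /=; rewrite !in_itv/= andbT => yx.
    by apply/negP; rewrite -ltNge.
  rewrite ek_righty// integral_itv_bndo_bndc; last exact: measurable_funTS.
  rewrite -[x]opprK ge0_integration_by_substitutionNy; last 2 first.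
  - by apply: continuous_subspaceT; exact: continuous_ek.
  - by move=> y _; exact: ek_ge0.
  have -> : (\int[mu]_(y in `[(- x)%R, +oo[) ((ek d (- - x) \o -%R) y)%:E = (d^-1)%:E)%E.
    rewrite -(ek_righty (- x) d0); apply: eq_integral => y _.
    by rewrite /ek /= -normrN; congr (expR (_ * `|_|))%:E; ring.
  by rewrite -EFinD lee_fin; lra.
have fi : intg (ek d x).
  apply: intg_ge0P => //; [exact: measurable_ek|by move=> y _; exact: ek_ge0|].
  exact: le_lt_trans h (ltry _).
by split => //; rewrite -lee_fin -fin_Rintegral.
Qed.

(** Cauchy-Schwarz for the measure p dx: the integral of p (f - t)^2 is nonnegative, and t = M / A
    is its minimizer when A is nonzero. *)
Lemma weighted_jensen (p f : R -> R) : (forall x, 0 <= p x) ->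
  intg p -> intg (fun x => p x * f x) -> intg (fun x => p x * f x ^+ 2) ->
  (\int[mu]_x (p x * f x)) ^+ 2 <= \int[mu]_x p x * \int[mu]_x (p x * f x ^+ 2).
Proof.
move=> p0 ip ipf ipf2.
set A := \int[mu]_x p x; set M := \int[mu]_x (p x * f x).
set B := \int[mu]_x (p x * f x ^+ 2).
have A0 : 0 <= A by apply: Rintegral_ge0.
have q t : 0 <= B - 2 * t * M + t ^+ 2 * A.
  rewrite /A /M /B -(RintegralZl _ measurableT ipf) -(RintegralZl _ measurableT ip).
  have i1 := intgZ measurableT (2 * t) ipf; have i2 := intgZ measurableT (t ^+ 2) ip.
  rewrite -(RintegralB measurableT ipf2 i1).
  rewrite -(RintegralD measurableT (intgB measurableT ipf2 i1) i2).
  apply: Rintegral_ge0 => x _; have -> : p x * f x ^+ 2 - 2 * t * (p x * f x) +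
    t ^+ 2 * p x = p x * (f x - t) ^+ 2 by ring.
  by rewrite mulr_ge0 ?sqr_ge0.
have [A_eq0|An0] := eqVneq A 0.
  suff -> : M = 0 by rewrite A_eq0 mul0r expr0n.
  (* With A = 0 the quadratic is B - 2 t M, and this t makes it -1. *)
  apply/eqP/negPn/negP => M0; have := q ((B + 1) / (2 * M)).
  rewrite A_eq0 mulr0 addr0; have -> : 2 * ((B + 1) / (2 * M)) * M = B + 1 by field.
  by lra.
have := q (M / A); have -> : B - 2 * (M / A) * M + (M / A) ^+ 2 * A = B - M ^+ 2 / A.
  by field.
by rewrite subr_ge0 ler_pdivrMr ?lt0r ?An0// mulrC.
Qed.

Section Weighted.
Variables (w : R -> R).
Hypotheses (mw : measurable_fun setT w) (w0 : forall x, 0 < w x).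
Hypothesis w_ratio : forall d, 0 < d ->
  exists2 C, 0 <= C & forall x y, w x * ek d x y <= C * w y.

Lemma intg_ek_weighted d (F : R -> R) x : 0 < d -> measurable_fun setT F ->
  (forall y, 0 <= F y) -> intg (fun y => F y ^+ 2 * w y) ->
  intg (fun y => ek d x y * F y) /\ intg (fun y => ek d x y * F y ^+ 2).
Proof.
move=> d0 mF F0 iF; have [C C0 hC] := w_ratio d0.
have mek := measurable_ek d x.
have mF2 : measurable_fun setT (fun y => F y ^+ 2) by exact: measurable_funX.
have h2 : intg (fun y => ek d x y * F y ^+ 2).
  apply: (intg_le measurableT _ (intgZ measurableT (C / w x) iF)).
    exact: measurable_funM.
  move=> y _; rewrite ger0_norm ?mulr_ge0 ?ek_ge0 ?sqr_ge0//.
  have -> : C / w x * (F y ^+ 2 * w y) = C * w y / w x * F y ^+ 2 by ring.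
  by rewrite ler_wpM2r ?sqr_ge0// ler_pdivlMr// [leLHS]mulrC.
split => //.
have [ie _] := intg_ek x d0.
apply: (intg_le measurableT _ (intgD measurableT ie h2)).
  exact: measurable_funM.
move=> y _; rewrite ger0_norm ?mulr_ge0 ?ek_ge0//.
rewrite -[X in _ <= X + _]mulr1 -mulrDr ler_wpM2l ?ek_ge0//.
by have := sqr_ge0 (F y - 1); rewrite sqrrB1; have := F0 y; lra.
Qed.

(** A Schur test. [weighted_jensen] moves the square inside the integral at the cost of the mass 2 /
    d of the kernel; after exchanging the integrals, one half of the exponential pays for moving the
    weight from x to y and the other half is integrated in x. *)
Lemma ek_weighted_bound d : 0 < d -> exists2 C, 0 <= C &
  forall F : R -> R, measurable_fun setT F -> (forall y, 0 <= F y) ->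
  intg (fun y => F y ^+ 2 * w y) ->
  intg (fun x => (\int[mu]_y (ek d x y * F y)) ^+ 2 * w x) /\
  \int[mu]_x ((\int[mu]_y (ek d x y * F y)) ^+ 2 * w x) <=
    C * \int[mu]_x (F x ^+ 2 * w x).
Proof.
move=> d0; have d20 : 0 < d / 2 by rewrite divr_gt0.
have [C C0 hC] := w_ratio d20.
have [b0 c0] : 0 <= 2 / d /\ 0 <= 2 / (d / 2).
  by split; rewrite divr_ge0// ltW.
have W0 x : 0 <= w x by rewrite ltW.
exists (2 / d * (C * (2 / (d / 2)))).
  by rewrite (mulr_ge0 b0)// mulr_ge0.
move=> F mF F0 iF.
pose P x := \int[mu]_y (ek d x y * F y).
pose g (z : R * R) := (w z.1 * (ek d z.1 z.2 * F z.2 ^+ 2))%:E.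
have mek := measurable_ek2 d.
have mg : measurable_fun setT g.
  apply/measurable_EFinP/measurable_funM; first exact: measurableT_comp.
  apply: measurable_funM => //; apply: measurable_funX; exact: measurableT_comp.
have g0 z : (0 <= g z)%E.
  by rewrite lee_fin !mulr_ge0 ?ek_ge0 ?sqr_ge0.
have mP : measurable_fun setT P.
  apply: (@measurable_Rintegral_param (fun z => ek d z.1 z.2 * F z.2)).
  by apply: measurable_funM => //; exact: measurableT_comp.
have mPw : measurable_fun setT (fun x => P x ^+ 2 * w x).
  by apply: measurable_funM => //; exact: measurable_funX.
have h : (\int[mu]_x (P x ^+ 2 * w x)%:E <=
    (2 / d * (C * (2 / (d / 2))))%:E * \int[mu]_x (F x ^+ 2 * w x)%:E)%E.
  apply: (@le_trans _ _ (\int[mu]_x ((2 / d)%:E * \int[mu]_y g (x, y))%E)%E).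
    apply: ge0_le_integral => //.
    - by move=> x _; rewrite lee_fin mulr_ge0 ?sqr_ge0.
    - exact/measurable_EFinP.
    - apply: measurable_funeM; exact: measurable_fun_fubini_tonelli_F.
    - move=> x _; have [iF1 iF2] := intg_ek_weighted x d0 mF F0 iF.
      have [ie eb] := intg_ek x d0.
      have -> : (\int[mu]_y g (x, y) = (w x * \int[mu]_y (ek d x y * F y ^+ 2)%R)%:E)%E.
        rewrite -(RintegralZl _ measurableT iF2) -fin_Rintegral//.
        exact: intgZ.
      rewrite -EFinM lee_fin mulrCA mulrC ler_wpM2l //.
      have := weighted_jensen (ek_ge0 d x) ie iF1 iF2; move/le_trans; apply.
      rewrite ler_wpM2r//; apply: Rintegral_ge0 => y _.
      by rewrite mulr_ge0 ?ek_ge0 ?sqr_ge0.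
  rewrite ge0_integralZl//; last 2 first.
  - exact: measurable_fun_fubini_tonelli_F.
  - by move=> x _; exact: integral_ge0.
  rewrite (EFinM (2 / d)) -muleA lee_wpmul2l ?lee_fin//.
  rewrite fubini_tonelli// -ge0_integralZl//; last 3 first.
  - by apply/measurable_EFinP; apply: measurable_funM => //; exact: measurable_funX.
  - by move=> x _; rewrite lee_fin mulr_ge0 ?sqr_ge0.
  - by rewrite lee_fin mulr_ge0.
  apply: ge0_le_integral => //.
  - by move=> y _; exact: integral_ge0.
  - exact: measurable_fun_fubini_tonelli_G.
  - apply: measurable_funeM; apply/measurable_EFinP.
    by apply: measurable_funM => //; exact: measurable_funX.
  move=> y _; have [ie eb] := intg_ek y d20.
  apply: (@le_trans _ _ (\int[mu]_x ((C * (F y ^+ 2 * w y) * ek (d / 2) y x)%R%:E))%E).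
    apply: ge0_le_integral => //.
    - apply: (measurableT_comp mg); exact: measurable_pair2.
    - by apply/measurable_EFinP; apply: measurable_funM => //; exact: measurable_ek.
    - move=> x _; rewrite lee_fin /= ekD [ek _ y x]ekC.
      have -> : w x * (ek (d / 2) x y * ek (d / 2) x y * F y ^+ 2) =
        (w x * ek (d / 2) x y) * (F y ^+ 2 * ek (d / 2) x y) by ring.
      have -> : C * (F y ^+ 2 * w y) * ek (d / 2) x y =
        (C * w y) * (F y ^+ 2 * ek (d / 2) x y) by ring.
      by rewrite ler_wpM2r// mulr_ge0 ?ek_ge0 ?sqr_ge0.
  rewrite fin_Rintegral//; last exact: intgZ.
  rewrite RintegralZl// -EFinM lee_fin.
  rewrite [leRHS](_ : _ = C * (F y ^+ 2 * w y) * (2 / (d / 2))); last by ring.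
  rewrite ler_wpM2l//.
  by rewrite !mulr_ge0 ?sqr_ge0.
have ih : intg (fun x => P x ^+ 2 * w x).
  apply: intg_ge0P => //; first by move=> x _; rewrite mulr_ge0 ?sqr_ge0.
  by apply: le_lt_trans h _; rewrite fin_Rintegral// -EFinM ltry.
by split => //; rewrite -lee_fin EFinM -!fin_Rintegral.
Qed.

End Weighted.

End RealKernel.

Lemma sqr_le_ge0 (R : realType) (a b : R) : 0 <= a -> a <= b -> a ^+ 2 <= b ^+ 2.
Proof.
by move=> a0 ab; rewrite ler_sqr// nnegrE//; exact: le_trans ab.
Qed.

(** Lets 1 + c stand for the square root of c in the operator bounds below. *)
Lemma le_sqr1D (R : realType) (c : R) : 0 <= c -> c <= (1 + c) ^+ 2.
Proof.
move=> c0; have -> : (1 + c) ^+ 2 = 1 + 2 * c + c ^+ 2 by ring.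
have := sqr_ge0 c; lra.
Qed.

(** * Complex integrals and weighted square-integrable functions *)

Section ComplexIntegral.
Variable R : realType.
Local Notation mu := (@lebesgue_measure R).
Local Notation intg f := (mu.-integrable setT (EFin \o f)).
Local Notation C := ((R[i])^o).
Implicit Types (f g : R -> C) (a z : R[i]).

Lemma ae_filter_imply2 (P Q S : R -> Prop) : (forall x, P x -> Q x -> S x) ->
  {ae mu, forall x, P x} -> {ae mu, forall x, Q x} -> {ae mu, forall x, S x}.
Proof. by move=> PQS; exact: (@filterS2 _ _ (ae_filter_ringOfSetsType mu)). Qed.

Lemma cReM (z1 z2 : R[i]) : complex.Re (z1 * z2) =
  complex.Re z1 * complex.Re z2 - complex.Im z1 * complex.Im z2.
Proof. by case: z1 z2 => ? ? []. Qed.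

Lemma cImM (z1 z2 : R[i]) : complex.Im (z1 * z2) =
  complex.Re z1 * complex.Im z2 + complex.Im z1 * complex.Re z2.
Proof. by case: z1 z2 => ? ? []. Qed.

Lemma cReD (z1 z2 : R[i]) : complex.Re (z1 + z2) = complex.Re z1 + complex.Re z2.
Proof. by case: z1 z2 => ? ? []. Qed.

Lemma cImD (z1 z2 : R[i]) : complex.Im (z1 + z2) = complex.Im z1 + complex.Im z2.
Proof. by case: z1 z2 => ? ? []. Qed.

Lemma cReN z : complex.Re (- z) = - complex.Re z. Proof. by case: z. Qed.
Lemma cImN z : complex.Im (- z) = - complex.Im z. Proof. by case: z. Qed.

Lemma complexP (z1 z2 : R[i]) : complex.Re z1 = complex.Re z2 ->
  complex.Im z1 = complex.Im z2 -> z1 = z2.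
Proof. by case: z1 z2 => ? ? [] ? ? /= -> ->. Qed.

Definition cmeas d (T : measurableType d) (f : T -> C) :=
  measurable_fun setT (fun x => complex.Re (f x)) /\
  measurable_fun setT (fun x => complex.Im (f x)).

Section Cmeas.
Context d (T : measurableType d).
Implicit Types (u v : T -> C).

Lemma cmeasM u v : cmeas u -> cmeas v -> cmeas (fun x => u x * v x).
Proof.
move=> [u1 u2] [v1 v2]; split.
  under eq_fun do rewrite cReM.
  by apply: measurable_funB; exact: measurable_funM.
under eq_fun do rewrite cImM.
by apply: measurable_funD; exact: measurable_funM.
Qed.

Lemma cmeasD u v : cmeas u -> cmeas v -> cmeas (fun x => u x + v x).
Proof.
move=> [u1 u2] [v1 v2]; split.
  by under eq_fun do rewrite cReD; exact: measurable_funD.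
by under eq_fun do rewrite cImD; exact: measurable_funD.
Qed.

Lemma cmeasN u : cmeas u -> cmeas (fun x => - u x).
Proof.
move=> [u1 u2]; split.
  by under eq_fun do rewrite cReN; exact: measurableT_comp.
by under eq_fun do rewrite cImN; exact: measurableT_comp.
Qed.

Lemma cmeas_cst a : cmeas (fun _ : T => a : C).
Proof. by split. Qed.

Lemma cmeas_N1 u : cmeas u -> measurable_fun setT (fun x => N1 (u x)).
Proof. by move=> [u1 u2]; apply: measurable_funD; exact: measurableT_comp. Qed.

End Cmeas.

Definition cint f : C :=
  (\int[mu]_x complex.Re (f x)) +i* (\int[mu]_x complex.Im (f x)).

Definition cintg f :=
  intg (fun x => complex.Re (f x)) /\ intg (fun x => complex.Im (f x)).

Lemma cintg_le f (g : R -> R) : cmeas f -> intg g ->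
  (forall x, N1 (f x) <= g x) -> cintg f.
Proof.
move=> [f1 f2] ig fg; split.
  by apply: (intg_le measurableT _ ig) => // x _; apply: le_trans (fg x); rewrite lerDl.
by apply: (intg_le measurableT _ ig) => // x _; apply: le_trans (fg x); rewrite lerDr.
Qed.

Lemma cintg_N1 f : cintg f -> intg (fun x => N1 (f x)).
Proof. by move=> [i1 i2]; apply: intgD => //; exact: intg_norm. Qed.

Lemma cint_le f : cintg f -> N1 (cint f) <= \int[mu]_x N1 (f x).
Proof.
move=> [i1 i2]; rewrite (RintegralD measurableT (intg_norm i1) (intg_norm i2)).
by apply: lerD; exact: le_normr_Rintegral.
Qed.

Lemma cint_le_dom f (g : R -> R) : cmeas f -> intg g ->
  (forall x, N1 (f x) <= g x) -> N1 (cint f) <= \int[mu]_x g x.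
Proof.
move=> mf ig fg; have cf := cintg_le mf ig fg.
by apply: (le_trans (cint_le cf)); apply: le_Rintegral => //; exact: cintg_N1.
Qed.

Lemma cintg_lin a f g : cintg f -> cintg g -> cintg (fun x => a * f x + g x).
Proof.
move=> [f1 f2] [g1 g2]; split.
  under eq_fun do rewrite cReD cReM.
  by apply: intgD => //; apply: intgB => //; exact: intgZ.
under eq_fun do rewrite cImD cImM.
by apply: intgD => //; apply: intgD => //; exact: intgZ.
Qed.

Lemma cint_lin a f g : cintg f -> cintg g ->
  cint (fun x => a * f x + g x) = a * cint f + cint g.
Proof.
move=> [f1 f2] [g1 g2]; have mT := @measurableT _ (measurableTypeR R).
apply: complexP.
  rewrite cReD cReM /=; under eq_Rintegral do rewrite cReD cReM.
  rewrite RintegralD ?RintegralB ?RintegralZl//; try exact: intgZ.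
  by apply: intgB => //; exact: intgZ.
rewrite cImD cImM /=; under eq_Rintegral do rewrite cImD cImM.
rewrite RintegralD//; last by apply: intgD => //; exact: intgZ.
by rewrite RintegralD ?RintegralZl//; exact: intgZ.
Qed.

Lemma cint_ae f g : cmeas f -> cmeas g -> {ae mu, forall x, f x = g x} ->
  cint f = cint g.
Proof.
move=> [f1 f2] [g1 g2] fg; apply: complexP => /=; apply: ae_eq_Rintegral => //.
  by apply: ae_filter_imply fg => x ->.
by apply: ae_filter_imply fg => x ->.
Qed.

Section WeightedL2.
Variable w : R -> R.
Hypotheses (mw : measurable_fun setT w) (w0 : forall x, 0 < w x).
Local Notation nu := (L2norm w).

Let W0 x : 0 <= w x. Proof. exact: ltW. Qed.

Let N1w_ge0 f x : 0 <= N1 (f x) ^+ 2 * w x.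
Proof. by rewrite mulr_ge0 ?sqr_ge0 ?W0. Qed.

Let sqw_ge0 f x : 0 <= sqnormc (f x) * w x.
Proof. by rewrite mulr_ge0 ?sqnormc_ge0 ?W0. Qed.


Lemma measurable_sqnormc f : cmeas f -> measurable_fun setT (fun x => sqnormc (f x)).
Proof. by move=> [f1 f2]; apply: measurable_funD; exact: measurable_funX. Qed.

Lemma L2P f : L2 w f <-> cmeas f /\ intg (fun x => N1 (f x) ^+ 2 * w x).
Proof.
split=> [[f1 f2 h]|[[f1 f2] h]].
  have mf : cmeas f by [].
  split => //; have i : intg (fun x => sqnormc (f x) * w x).
    apply: intg_ge0P => //.
      by apply: measurable_funM => //; exact: measurable_sqnormc.
  apply: (intg_le measurableT _ (intgZ measurableT 2 i)).
    by apply: measurable_funM => //; apply: measurable_funX; exact: cmeas_N1.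
  move=> x _; rewrite (ger0_norm (N1w_ge0 _ _)) mulrA ler_wpM2r ?W0//.
  exact: N1_sq_le.
split => //; have i : intg (fun x => sqnormc (f x) * w x).
  apply: (intg_le measurableT _ h).
    by apply: measurable_funM => //; exact: measurable_sqnormc.
  move=> x _; rewrite (ger0_norm (sqw_ge0 _ _)) ler_wpM2r ?W0//.
  exact: sqnormc_le.
by rewrite fin_Rintegral// ltry.
Qed.

Lemma L2_sqnormc f : L2 w f -> intg (fun x => sqnormc (f x) * w x).
Proof.
move=> [f1 f2 h]; have mf : cmeas f by [].
apply: intg_ge0P => //.
  by apply: measurable_funM => //; exact: measurable_sqnormc.
Qed.

Lemma L2norm_sqr f : nu f ^+ 2 = \int[mu]_x (sqnormc (f x) * w x).
Proof.
rewrite /L2norm sqr_sqrtr//; apply: Rintegral_ge0 => x _.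
exact: sqw_ge0.
Qed.

Lemma L2norm_ge0 f : 0 <= nu f.
Proof. exact: sqrtr_ge0. Qed.

Lemma N1_sq_L2norm f : L2 w f ->
  \int[mu]_x (N1 (f x) ^+ 2 * w x) <= 2 * nu f ^+ 2.
Proof.
move=> Xf; have i := L2_sqnormc Xf; have [_ i'] := (L2P f).1 Xf.
rewrite L2norm_sqr -(RintegralZl _ measurableT i).
apply: le_Rintegral => //; first exact: intgZ.
by move=> x _; rewrite mulrA ler_wpM2r ?W0//; exact: N1_sq_le.
Qed.

Lemma L2norm_sq_N1 f : L2 w f ->
  nu f ^+ 2 <= \int[mu]_x (N1 (f x) ^+ 2 * w x).
Proof.
move=> Xf; have i := L2_sqnormc Xf; have [_ i'] := (L2P f).1 Xf.
rewrite L2norm_sqr; apply: le_Rintegral => //.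
by move=> x _; rewrite ler_wpM2r ?W0//; exact: sqnormc_le.
Qed.

Lemma L2_lin_closed : lin_closed (L2 w).
Proof.
split.
  apply/L2P; split; first exact: cmeas_cst.
  have -> : (fun x => N1 ((0 : R -> C) x) ^+ 2 * w x) = cst 0.
    by apply/funext => x; rewrite /= N1_0 expr0n mul0r.
  exact: integrable0.
move=> a u v /L2P[mu_ iu] /L2P[mv iv]; apply/L2P.
have m : cmeas (a *: u + v).
  by apply: cmeasD => //; apply: cmeasM => //; exact: cmeas_cst.
split => //.
apply: (intg_le measurableT _ (intgD measurableT
    (intgZ measurableT (2 * N1 a ^+ 2) iu) (intgZ measurableT 2 iv))).
  by apply: measurable_funM => //; apply: measurable_funX; exact: cmeas_N1.
move=> x _; rewrite (ger0_norm (N1w_ge0 _ _)) mulrA mulrA -mulrDl ler_wpM2r ?W0//.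
have h : N1 ((a *: u + v) x) <= N1 a * N1 (u x) + N1 (v x).
  by apply: (le_trans (N1D _ _)); rewrite lerD2r; exact: N1M.
apply: (@le_trans _ _ ((N1 a * N1 (u x) + N1 (v x)) ^+ 2)).
  by apply: sqr_le_ge0 => //; exact: N1_ge0.
have -> : 2 * N1 a ^+ 2 * N1 (u x) ^+ 2 + 2 * N1 (v x) ^+ 2 =
  (N1 a * N1 (u x) + N1 (v x)) ^+ 2 + (N1 a * N1 (u x) - N1 (v x)) ^+ 2 by ring.
by rewrite lerDl sqr_ge0.
Qed.

Lemma L2_nullP f : null_space (L2 w) nu f <->
  cmeas f /\ {ae mu, forall x, f x = 0}.
Proof.
split=> [[Xf nf]|[mf f0]].
  have [mf _] := (L2P f).1 Xf; split => //.
  have i := L2_sqnormc Xf.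
  have := L2norm_sqr f; rewrite nf expr0n/= => /esym h0.
  have m := measurable_int mu i.
  have : (\int[mu]_x `|(EFin \o (fun x => (sqnormc (f x) * w x)%R)) x| = 0)%E.
    transitivity (\int[mu]_x (sqnormc (f x) * w x)%:E)%E.
      by apply: eq_integral => x _; rewrite /= (ger0_norm (sqw_ge0 _ _)).
    by rewrite fin_Rintegral// h0.
  move/(ae_eq_integral_abs mu measurableT m); apply: ae_filter_imply.
  move=> x /(_ I) /= [] /eqP; rewrite mulf_eq0 (gt_eqF (w0 x)) orbF.
  rewrite paddr_eq0 ?sqr_ge0// !sqrf_eq0 => /andP[/eqP fr /eqP fi].
  exact: complexP.
have fw0 : {ae mu, forall x, setT x -> N1 (f x) ^+ 2 * w x = 0}.
  by apply: ae_filter_imply f0 => x -> _; rewrite N1_0 expr0n mul0r.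
have m1 : measurable_fun setT (fun x => N1 (f x) ^+ 2 * w x).
  by apply: measurable_funM => //; apply: measurable_funX; exact: cmeas_N1.
have e0 : (\int[mu]_x (N1 (f x) ^+ 2 * w x)%:E = 0)%E.
  rewrite -(integral0 mu setT); apply: ae_eq_integral => //.
    by apply/measurable_EFinP.
  by apply: ae_filter_imply fw0 => x h /h ->.
have Xf : L2 w f.
  apply/L2P; split => //; apply: intg_ge0P => //.
  by rewrite e0.
split => //; apply/eqP; rewrite -sqrf_eq0 -[X in _ == X]/0 eq_le sqr_ge0 andbT.
by apply: (le_trans (L2norm_sq_N1 Xf)); rewrite /Rintegral e0.
Qed.

Lemma L2_null_lin_closed : lin_closed (null_space (L2 w) nu).
Proof.
split; first by apply/L2_nullP; split; [exact: cmeas_cst|exact: aeW].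
move=> a u v /L2_nullP[mu_ u0] /L2_nullP[mv v0]; apply/L2_nullP; split.
  by apply: cmeasD => //; apply: cmeasM => //; exact: cmeas_cst.
apply: ae_filter_imply2 u0 v0 => x /= ux vx.
by rewrite [LHS](_ : _ = a * u x + v x)// ux vx mulr0 addr0.
Qed.

End WeightedL2.

(** Functions rather than classes: the bound holds at every point, so that point evaluations are
    well defined and bounded. *)
Definition bounded_meas : set (R -> C) :=
  [set k | cmeas k /\ exists B, forall x, N1 (k x) <= B].

Lemma bounded_meas_lin_closed : lin_closed bounded_meas.
Proof.
split; first by split; [exact: cmeas_cst|exists 0 => x; rewrite N1_0].
move=> a u v [mu_ [A hA]] [mv [B hB]]; split.
  by apply: cmeasD => //; apply: cmeasM => //; exact: cmeas_cst.
exists (N1 a * A + B) => x; apply: (le_trans (N1D _ _)); apply: lerD => //.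
by apply: (le_trans (N1M _ _)); rewrite ler_wpM2l ?N1_ge0.
Qed.

Lemma bounded_meas_L2 (w : R -> R) : measurable_fun setT w -> (forall x, 0 < w x) ->
  intg w -> bounded_meas `<=` L2 w.
Proof.
move=> mw w0 iw k [mk [B hB]]; apply/L2P => //; split => //.
apply: (intg_le measurableT _ (intgZ measurableT (B ^+ 2) iw)).
  by apply: measurable_funM => //; apply: measurable_funX; exact: cmeas_N1.
move=> x _; rewrite ger0_norm ?mulr_ge0 ?N1_ge0 ?(ltW (w0 x))//.
rewrite ler_wpM2r ?(ltW (w0 x))//.
by apply: sqr_le_ge0; [exact: N1_ge0|exact: hB].
Qed.

Lemma cmeas_limit (f_ : nat -> R -> C) f B : (forall n, cmeas (f_ n)) ->
  (forall n x, N1 (f_ n x - f x) <= B * 2 ^- n) -> cmeas f.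
Proof.
move=> mf h.
have cvg0 (g_ : nat -> R) (l : R) : (forall n, `|g_ n - l| <= B * 2 ^- n) ->
    g_ n @[n --> \oo] --> l.
  move=> hg; apply/cvgrPdist_le => e e0.
  have cv : B * 2^-1 ^+ n @[n --> \oo] --> B * 0.
    by apply: cvgMr; apply: cvg_expr; rewrite ger0_norm; lra.
  rewrite mulr0 in cv; move/cvgrPdist_le : cv => /(_ e e0).
  apply: filterS => n; rewrite sub0r normrN exprVn => hn; rewrite distrC.
  by apply: (le_trans (hg n)); apply: le_trans (ler_norm _) hn.
split.
  apply: (measurable_fun_cvg (h := fun n x => complex.Re (f_ n x))).
    by move=> n; have [] := mf n.
  move=> x _; apply: cvg0 => n; apply: le_trans (h n x).
  by rewrite /N1 -cReN -cReD lerDl.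
apply: (measurable_fun_cvg (h := fun n x => complex.Im (f_ n x))).
  by move=> n; have [] := mf n.
move=> x _; apply: cvg0 => n; apply: le_trans (h n x).
by rewrite /N1 -cImN -cImD lerDr.
Qed.

End ComplexIntegral.

(** * Integral operators on the weighted space and on bounded functions *)

Section KernelOperator.
Variable R : realType.
Local Notation mu := (@lebesgue_measure R).
Local Notation intg f := (mu.-integrable setT (EFin \o f)).
Local Notation C := ((R[i])^o).
Implicit Types (f g : R -> C) (k : R -> R -> C) (m : R -> C).
Variable w : R -> R.
Hypotheses (mw : measurable_fun setT w) (w0 : forall x, 0 < w x) (iw : intg w).
Hypothesis w_ratio : forall d, 0 < d ->
  exists2 D, 0 <= D & forall x y, w x * ek d x y <= D * w y.
Local Notation nu := (L2norm w).

Let W0 x : 0 <= w x. Proof. exact: ltW. Qed.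

Definition exp_kernel (D d : R) k :=
  [/\ 0 <= D, 0 < d, cmeas (fun p : R * R => k p.1 p.2) &
      forall x y, N1 (k x y) <= D * ek d x y].

Definition kop k f : R -> C := fun x => cint (fun y => k x y * f y).

Definition mop m f : R -> C := fun x => m x * f x.

Section Kop.
Variables (D d : R) (k : R -> R -> C).
Hypothesis hk : exp_kernel D d k.

Let D0 : 0 <= D. Proof. by case: hk. Qed.
Let d0 : 0 < d. Proof. by case: hk. Qed.
Let mk : cmeas (fun p : R * R => k p.1 p.2). Proof. by case: hk. Qed.
Lemma kernel_section_meas x : cmeas (k x).
Proof.
have [k1 k2] := mk; split.
  exact: (measurableT_comp k1 (@measurable_pair1 _ _ _ _ x)).
exact: (measurableT_comp k2 (@measurable_pair1 _ _ _ _ x)).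
Qed.

Lemma kop_meas f : cmeas f -> cmeas (kop k f).
Proof.
move=> [f1 f2]; have m : cmeas (fun p : R * R => k p.1 p.2 * f p.2).
  apply: (cmeasM mk); split.
    exact: (measurableT_comp f1 measurable_snd).
  exact: (measurableT_comp f2 measurable_snd).
have [m1 m2] := m; split.
  exact: (measurable_Rintegral_param m1).
exact: (measurable_Rintegral_param m2).
Qed.

Lemma kop_integrand_le f x y : N1 (k x y * f y) <= D * (ek d x y * N1 (f y)).
Proof.
apply: (le_trans (N1M _ _)); rewrite mulrA ler_wpM2r ?N1_ge0//.
by case: hk.
Qed.

Lemma ek_L2_intg f x : L2 w f -> intg (fun y => ek d x y * N1 (f y)).
Proof.
move=> /(L2P mw w0)[mf i].
by have [] := intg_ek_weighted w0 w_ratio x d0 (cmeas_N1 mf) (fun y => N1_ge0 (f y)) i.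
Qed.

Lemma kop_cintg f x : L2 w f -> cintg (fun y => k x y * f y).
Proof.
move=> Xf; have [mf _] := (L2P mw w0 f).1 Xf.
apply: (cintg_le _ (intgZ measurableT D (ek_L2_intg x Xf))).
  by apply: cmeasM => //; exact: kernel_section_meas.
by move=> y; exact: kop_integrand_le.
Qed.

Lemma kop_le f x : L2 w f ->
  N1 (kop k f x) <= D * \int[mu]_y (ek d x y * N1 (f y)).
Proof.
move=> Xf; have [mf _] := (L2P mw w0 f).1 Xf; have i := ek_L2_intg x Xf.
rewrite -(RintegralZl _ measurableT i); apply: cint_le_dom.
- by apply: cmeasM => //; exact: kernel_section_meas.
- exact: intgZ.
- by move=> y; exact: kop_integrand_le.
Qed.

Lemma kop_lin : lin_on (L2 w) (kop k).
Proof.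
move=> a u v Xu Xv; apply/funext => x.
rewrite [RHS](_ : _ = a * kop k u x + kop k v x)//.
rewrite /kop -(cint_lin a (kop_cintg x Xu) (kop_cintg x Xv)).
congr cint; apply/funext => y.
rewrite [X in _ * X](_ : _ = a * u y + v y)//.
by rewrite mulrDr mulrCA.
Qed.

Lemma kop_L2 : exists2 E, 0 <= E &
  forall f, L2 w f -> L2 w (kop k f) /\ nu (kop k f) <= E * nu f.
Proof.
have [B B0 hB] := ek_weighted_bound mw w0 w_ratio d0.
have b0 : 0 <= 2 * (D ^+ 2 * B) by rewrite !mulr_ge0.
exists (1 + 2 * (D ^+ 2 * B)); first by rewrite addr_ge0.
move=> f Xf; have [mf i] := (L2P mw w0 f).1 Xf.
have [i2 le2] := hB _ (cmeas_N1 mf) (fun y => N1_ge0 (f y)) i.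
have mkf := kop_meas mf.
have P0 x : 0 <= \int[mu]_y (ek d x y * N1 (f y)).
  by apply: Rintegral_ge0 => y _; rewrite mulr_ge0 ?ek_ge0 ?N1_ge0.
have h x : N1 (kop k f x) ^+ 2 * w x <=
    D ^+ 2 * ((\int[mu]_y (ek d x y * N1 (f y))) ^+ 2 * w x).
  rewrite mulrA ler_wpM2r// -exprMn.
  by apply: sqr_le_ge0; [exact: N1_ge0|exact: kop_le].
have i3 := intgZ measurableT (D ^+ 2) i2.
have i4 : intg (fun x => N1 (kop k f x) ^+ 2 * w x).
  apply: (intg_le measurableT _ i3).
    by apply: measurable_funM => //; apply: measurable_funX; exact: cmeas_N1.
  by move=> x _; rewrite ger0_norm ?mulr_ge0 ?N1_ge0.
have Xk : L2 w (kop k f) by apply/L2P.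
split => //; rewrite -(@ler_pXn2r _ 2) ?nnegrE ?mulr_ge0 ?addr_ge0 ?L2norm_ge0//.
apply: (le_trans (L2norm_sq_N1 mw w0 Xk)).
apply: (@le_trans _ _ (D ^+ 2 * (B * (2 * nu f ^+ 2)))); last first.
  rewrite exprMn [leLHS](_ : _ = 2 * (D ^+ 2 * B) * nu f ^+ 2); last by ring.
  by rewrite ler_wpM2r ?sqr_ge0//; exact: le_sqr1D.
apply: (@le_trans _ _ (D ^+ 2 * (B * \int[mu]_x (N1 (f x) ^+ 2 * w x)))).
  apply: le_trans (_ : D ^+ 2 * \int[mu]_x ((\int[mu]_y (ek d x y * N1 (f y))) ^+ 2 * w x) <= _).
    rewrite -(RintegralZl _ measurableT i2); apply: le_Rintegral => //.
  by rewrite ler_wpM2l ?sqr_ge0.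
by rewrite ler_wpM2l ?sqr_ge0// ler_wpM2l//; exact: N1_sq_L2norm.
Qed.

Lemma kop_bounded f B : cmeas f -> (forall x, N1 (f x) <= B) ->
  forall x, N1 (kop k f x) <= D * (2 / d) * B.
Proof.
move=> mf hB x; have [ie eb] := intg_ek x d0.
have B0 : 0 <= B by exact: le_trans (N1_ge0 _) (hB 0).
have i := intgZ measurableT (D * B) ie.
apply: (le_trans (cint_le_dom _ i _)).
- by apply: cmeasM => //; exact: kernel_section_meas.
- move=> y; apply: (le_trans (kop_integrand_le _ _ _)).
  by rewrite -mulrA mulrC [leRHS]mulrC ler_wpM2r// mulrC ler_wpM2r ?ek_ge0.
- rewrite (RintegralZl _ measurableT ie) [leRHS]mulrAC ler_wpM2l ?mulr_ge0//.
Qed.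

Lemma kop_bounded_meas f : bounded_meas f -> bounded_meas (kop k f).
Proof.
move=> [mf [B hB]]; split; first exact: kop_meas.
by exists (D * (2 / d) * B); exact: kop_bounded.
Qed.

(** The integral ignores null sets, so that the result is the zero function itself and not just a
    null one. *)
Lemma kop_null f : null_space (L2 w) nu f -> kop k f = 0.
Proof.
move=> /(L2_nullP mw w0)[mf f0]; apply/funext => x.
have -> : kop k f x = cint (fun _ => 0).
  apply: cint_ae; [|exact: cmeas_cst|].
    by apply: cmeasM => //; exact: kernel_section_meas.
  by apply: ae_filter_imply f0 => y ->; rewrite mulr0.
by apply: complexP; rewrite /= /Rintegral integral0.
Qed.

(** This is how the weighted space is sent to bounded functions: a multiplier dominated by [w]
    leaves the integral of w |f|, which Cauchy-Schwarz for the finite measure w dx bounds by the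
    norm of f. *)
Lemma kop_mop_bound m (Dm : R) : cmeas m -> 0 <= Dm ->
  (forall x, N1 (m x) <= Dm * w x) ->
  exists2 E, 0 <= E & forall f, L2 w f -> forall x,
    N1 (kop k (mop m f) x) <= E * nu f.
Proof.
move=> mm Dm0 hm; have I0 : 0 <= \int[mu]_x w x by apply: Rintegral_ge0.
pose E := 1 + 2 * \int[mu]_x w x.
have E0 : 0 <= E by rewrite addr_ge0// mulr_ge0.
exists (D * Dm * E) => [|f Xf x]; first by rewrite !mulr_ge0.
have [mf i] := (L2P mw w0 f).1 Xf.
have i2 : intg (fun y => w y * N1 (f y) ^+ 2).
  by apply: eq_integrable i => // y _; rewrite /= mulrC.
have i1 : intg (fun y => w y * N1 (f y)).
  apply: (intg_le measurableT _ (intgD measurableT iw i2)).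
    by apply: measurable_funM => //; exact: cmeas_N1.
  move=> y _; rewrite ger0_norm ?mulr_ge0 ?N1_ge0//.
  rewrite -[X in _ <= X + _]mulr1 -mulrDr ler_wpM2l//.
  by have := sqr_ge0 (N1 (f y) - 1); rewrite sqrrB1; have := N1_ge0 (f y); lra.
apply: (le_trans (cint_le_dom _ (intgZ measurableT (D * Dm) i1) _)).
- apply: cmeasM; first exact: kernel_section_meas.
  exact: cmeasM.
- move=> y; apply: (le_trans (kop_integrand_le _ _ _)).
  rewrite -[leRHS]mulrA ler_wpM2l//.
  apply: (@le_trans _ _ (N1 (mop m f y))).
    by rewrite -[leRHS]mul1r ler_wpM2r ?N1_ge0// ek_le1.
  apply: (le_trans (N1M _ _)).
  by rewrite mulrA ler_wpM2r ?N1_ge0.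
rewrite (RintegralZl _ measurableT i1) -[leRHS]mulrA ler_wpM2l ?mulr_ge0//.
rewrite -(@ler_pXn2r _ 2) ?nnegrE ?mulr_ge0 ?L2norm_ge0//; last first.
  by apply: Rintegral_ge0 => y _; rewrite mulr_ge0 ?N1_ge0.
apply: (le_trans (weighted_jensen W0 iw i1 i2)).
apply: (@le_trans _ _ (\int[mu]_x w x * (2 * nu f ^+ 2))).
  rewrite ler_wpM2l//; apply: le_trans (N1_sq_L2norm mw w0 Xf).
  by apply: le_Rintegral => // y _; rewrite mulrC.
rewrite exprMn mulrA ler_wpM2r ?sqr_ge0// mulrC /E.
by apply: le_sqr1D; rewrite mulr_ge0.
Qed.

End Kop.

Section Mop.
Variables (m : R -> C) (Dm : R).
Hypotheses (mm : cmeas m) (hm : forall x, N1 (m x) <= Dm).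

Lemma mop_L2 f : L2 w f -> L2 w (mop m f).
Proof.
move=> /(L2P mw w0)[mf i]; have mmf : cmeas (mop m f) by exact: cmeasM.
apply/L2P => //; split => //.
apply: (intg_le measurableT _ (intgZ measurableT (Dm ^+ 2) i)).
  by apply: measurable_funM => //; apply: measurable_funX; exact: cmeas_N1.
move=> x _; rewrite ger0_norm ?mulr_ge0 ?N1_ge0// mulrA ler_wpM2r//.
rewrite -exprMn; apply: sqr_le_ge0; first exact: N1_ge0.
by apply: (le_trans (N1M _ _)); rewrite ler_wpM2r ?N1_ge0.
Qed.

Lemma mop_lin X : lin_on X (mop m).
Proof.
move=> a u v _ _; apply/funext => x; rewrite /mop.
rewrite [RHS](_ : _ = a * (m x * u x) + m x * v x)//.
rewrite [X in _ * X](_ : _ = a * u x + v x)//.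
by rewrite mulrDr mulrCA.
Qed.

Lemma mop_null f : null_space (L2 w) nu f -> null_space (L2 w) nu (mop m f).
Proof.
move=> /(L2_nullP mw w0)[mf f0]; apply/(L2_nullP mw w0); split.
  exact: cmeasM.
by apply: ae_filter_imply f0 => x fx; rewrite /mop fx mulr0.
Qed.

Lemma mop_bounded_meas f : bounded_meas f -> bounded_meas (mop m f).
Proof.
move=> [mf [B hB]]; split; first exact: cmeasM.
exists (Dm * B) => x; apply: (le_trans (N1M _ _)).
by apply: ler_pM => //; exact: N1_ge0.
Qed.

End Mop.

End KernelOperator.

Section ComplexWeakDerivative.
Variable R : realType.
Local Notation mu := (@lebesgue_measure R).
Local Notation intg f := (mu.-integrable setT (EFin \o f)).
Local Notation C := ((R[i])^o).
Implicit Types (m u g : R -> C).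

Definition csmooth m := smooth (fun x => complex.Re (m x)) /\
  smooth (fun x => complex.Im (m x)).

Definition cderiv m : R -> C := fun x =>
  derive1 (fun x => complex.Re (m x)) x +i* derive1 (fun x => complex.Im (m x)) x.

Lemma csmooth_cmeas m : csmooth m -> cmeas m.
Proof.
by move=> [m1 m2]; split; apply: continuous_measurable_fun; exact: smooth_continuous.
Qed.

Lemma cweak_deriv_mul m u g : csmooth m -> weak_deriv 1 u g ->
  weak_deriv 1 (fun x => m x * u x) (fun x => cderiv m x * u x + m x * g x).
Proof.
move=> [m1 m2] [ug1 ug2].
pose a x := complex.Re (m x); pose b x := complex.Im (m x).
split.
  have := weak_derivB (weak_deriv_mul m1 ug1) (weak_deriv_mul m2 ug2).
  congr real_weak_deriv; apply/funext => x; rewrite !fctE.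
    by rewrite cReM.
  by rewrite cReD !cReM /=; ring.
have := weak_derivD (weak_deriv_mul m1 ug2) (weak_deriv_mul m2 ug1).
congr real_weak_deriv; apply/funext => x; rewrite !fctE.
  by rewrite cImM.
by rewrite cImD !cImM /=; ring.
Qed.

Lemma cweak_derivB u g v f : weak_deriv 1 u g -> weak_deriv 1 v f ->
  weak_deriv 1 (fun x => u x - v x) (fun x => g x - f x).
Proof.
move=> [u1 u2] [v1 v2]; split.
  have := weak_derivB u1 v1; congr real_weak_deriv; apply/funext => x.
    by rewrite !fctE cReD cReN.
  by rewrite !fctE cReD cReN.
have := weak_derivB u2 v2; congr real_weak_deriv; apply/funext => x.
  by rewrite !fctE cImD cImN.
by rewrite !fctE cImD cImN.
Qed.

Lemma cweak_deriv_comp u u1 u2 : weak_deriv 1 u u1 -> weak_deriv 1 u1 u2 ->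
  weak_deriv 2 u u2.
Proof.
by move=> [a b] [c d]; split; [exact: weak_deriv_comp a c|exact: weak_deriv_comp b d].
Qed.

Lemma cweak_deriv_succ u u1 u2 : weak_deriv 1 u u1 -> weak_deriv 2 u u2 ->
  weak_deriv 1 u1 u2.
Proof.
by move=> [a b] [c d]; split; [exact: weak_deriv_succ a c|exact: weak_deriv_succ b d].
Qed.

Lemma cweak_deriv_unique k u g g' : weak_deriv k u g -> weak_deriv k u g' ->
  {ae mu, forall x, g x = g' x}.
Proof.
move=> [a b] [c d].
apply: ae_filter_imply2 (weak_deriv_unique a c) (weak_deriv_unique b d) => x.
exact: complexP.
Qed.

Lemma weak_deriv_cmeas k u g : weak_deriv k u g -> cmeas u /\ cmeas g.
Proof. by move=> [[[u1 _ _] [g1 _ _] _] [[u2 _ _] [g2 _ _] _]]. Qed.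

End ComplexWeakDerivative.

(** * Weak derivative of a primitive *)

Section Primitive.
Variable R : realType.
Local Notation mu := (@lebesgue_measure R).
Local Notation intg f := (mu.-integrable setT (EFin \o f)).
Implicit Types (q phi : R -> R) (b : bool).

(* The primitive of q vanishing at -oo if b, at +oo otherwise. *)
Definition side b (x y : R) : R :=
  if b then (if y <= x then 1 else 0) else (if x <= y then -1 else 0).

Lemma measurable_side b : measurable_fun setT (fun p : R * R => side b p.1 p.2).
Proof.
by case: b; apply: measurable_fun_ifT => //; apply: measurable_fun_ler.
Qed.

Lemma side_norm_le1 b x y : `|side b x y| <= 1.
Proof. by rewrite /side; case: b; case: ifP; rewrite ?normrN ?normr1 ?normr0. Qed.

Lemma side_mono b (M x y : R) : `|x| <= M ->
  `|side b x y| <= `|side b (if b then M else - M) y|.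
Proof.
rewrite ler_norml => /andP[Mx xM]; rewrite /side; case: b.
  case: (leP y x) => yx; last by rewrite normr0.
  by rewrite (le_trans yx xM).
case: (leP x y) => xy; last by rewrite normr0.
by rewrite (le_trans Mx xy).
Qed.

(** Integrating phi' from y to +oo and integrating - phi' from -oo to y give the same result; this
    dictates the sign -1 in [side]. *)
Lemma side_test b phi y : test_function phi ->
  \int[mu]_x (side b x y * derive1 phi x) = - phi y.
Proof.
move=> tphi; have [sphi [M hM]] := (test_functionP phi).1 tphi.
have tphi' := test_deriv tphi.
have [sphi' [M' hM']] := (test_functionP _).1 tphi'.
pose B := `|y| + `|M| + `|M'| + 1.
have yB : `|y| <= B by rewrite /B -!addrA lerDl !addr_ge0.
have B0 : 0 <= B by exact: le_trans yB.
have MB : M < B.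
  by rewrite /B; have := ler_norm M; have := normr_ge0 y; have := normr_ge0 M'; lra.
have MB' : M' < B.
  by rewrite /B; have := ler_norm M'; have := normr_ge0 y; have := normr_ge0 M; lra.
have phiB : phi B = 0 by apply: hM; rewrite ger0_norm.
have phiNB : phi (- B) = 0 by apply: hM; rewrite normrN ger0_norm.
have phi'B x : B < `|x| -> derive1 phi x = 0.
  by move=> Bx; apply: hM'; exact: lt_trans Bx.
move: (yB); rewrite ler_norml => /andP[NBy yB'].
case: b.
  rewrite (Rintegral_support (A := `[y, B])) //; last first.
    move=> x /= /negP; rewrite in_itv/= negb_and -!ltNge => /orP[xy|Bx].
      by rewrite /side leNgt xy mul0r.
    by rewrite phi'B ?mulr0// (lt_le_trans Bx (ler_norm x)).
  transitivity (\int[mu]_(x in `[y, B]) derive1 phi x).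
    apply: eq_Rintegral => x; rewrite inE/= in_itv/= => /andP[yx _].
    by rewrite /side yx mul1r.
  by rewrite Rintegral_deriv// phiB sub0r.
rewrite (Rintegral_support (A := `[- B, y])) //; last first.
  move=> x /= /negP; rewrite in_itv/= negb_and -!ltNge => /orP[Bx|yx].
    rewrite phi'B ?mulr0//; rewrite -normrN; apply: lt_le_trans (ler_norm _).
    by rewrite ltrNr.
  by rewrite /side leNgt yx mul0r.
have i : mu.-integrable `[- B, y] (EFin \o derive1 phi).
  apply: (integrableS measurableT) => //.
  have := test_integrable (@locint_cst R 1) tphi'.
  by apply: eq_integrable => // x _; rewrite /= !fctE mul1r.
transitivity (\int[mu]_(x in `[- B, y]) (-1 * derive1 phi x)).
  apply: eq_Rintegral => x; rewrite inE/= in_itv/= => /andP[_ xy].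
  by rewrite /side xy.
by rewrite RintegralZl// Rintegral_deriv// phiNB subr0 mulN1r.
Qed.

(** Fubini for side x y * q y * phi' x, whose integral in x is given by [side_test]. *)
Lemma weak_deriv_primitive b q : measurable_fun setT q ->
  (forall x, intg (fun y => side b x y * q y)) ->
  real_weak_deriv 1 (fun x => \int[mu]_y (side b x y * q y)) q.
Proof.
move=> mq iq; pose P x := \int[mu]_y (side b x y * q y).
have mside2 := measurable_side b.
have mg : measurable_fun setT (fun p : R * R => side b p.1 p.2 * q p.2).
  by apply: measurable_funM => //; exact: (measurableT_comp mq measurable_snd).
have mP : measurable_fun setT P by exact: (measurable_Rintegral_param mg).
(* The point of [-M, M] at which |side b x y| is largest, whatever y is; it bounds the primitive
   uniformly on the segment. *)
pose c M : R := if b then M else - M.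
pose I M := \int[mu]_y `|side b (c M) y * q y|.
have PI M x : `|x| <= M -> \int[mu]_y `|side b x y * q y| <= I M.
  move=> xM; apply: le_Rintegral => //; try exact: intg_norm.
  by move=> y _; rewrite !normrM ler_wpM2r// side_mono.
have PI' M x : `|x| <= M -> `|P x| <= I M.
  by move=> xM; apply: le_trans (PI M x xM); exact: le_normr_Rintegral.
have compactb (K : set R) : compact K -> exists M, K `<=` `[- M, M].
  move=> /compact_bounded[M [_ /(_ (`|M| + 1))]].
  rewrite ltr_pwDr ?ler_norm// => /(_ isT) hM; exists (`|M| + 1) => x /hM /=.
  by rewrite in_itv/= ler_norml.
have lP : locally_integrable setT P.
  split => //; [exact: openT|move=> K _ cK].
  have [M KM] := compactb K cK; have mK : measurable K by exact: compact_measurable.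
  apply: (@le_lt_trans _ _ (\int[mu]_(x in K) (cst (I M)%:E x))%E).
    apply: ge0_le_integral => //.
    - by apply/measurable_EFinP/measurableT_comp => //; exact: measurable_funTS.
    - move=> x /KM; rewrite /= in_itv/= -ler_norml => xM.
      by rewrite lee_fin PI'.
  rewrite integral_cst//= lte_mul_pinfty//; last exact: compact_finite_measure.
  by rewrite lee_fin; apply: Rintegral_ge0.
have lq : locally_integrable setT q.
  split => //; [exact: openT|move=> K _ cK].
  have [M KM] := compactb K cK; have mK : measurable K by exact: compact_measurable.
  have /integrableP[m +] := iq (c M); apply: le_lt_trans.
  rewrite [leLHS]integral_mkcond; apply: ge0_le_integral => //.
  - by move=> x _; rewrite erestrict_ge0.
  - apply/(measurable_restrictT _ _).1 => //.
    by apply/measurable_EFinP/measurableT_comp => //; exact: measurable_funTS.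
  - exact: measurableT_comp.
  - move=> y _; rewrite /patch; case: ifPn => [/set_mem/KM|_]; last exact: abse_ge0.
    rewrite /= in_itv/= => /andP[My yM]; rewrite lee_fin normrM.
    by rewrite /side /c; case: (b); rewrite ?yM ?My ?normrN normr1 mul1r.
apply/weak_deriv1P; split => // phi tphi.
have tphi' := test_deriv tphi.
have [sphi' [M hM]] := (test_functionP _).1 tphi'.
have cphi' := smooth_continuous sphi'.
have mphi' : measurable_fun setT (derive1 phi) by exact: continuous_measurable_fun.
have iphi' : intg (derive1 phi).
  have := test_integrable (@locint_cst R 1) tphi'.
  by apply: eq_integrable => // x _; rewrite /= !fctE mul1r.
pose g (p : R * R) : R := side b p.1 p.2 * q p.2 * derive1 phi p.1.
have mgg : measurable_fun setT g.
  by apply: measurable_funM => //; exact: (measurableT_comp mphi' measurable_fst).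
have mgE : measurable_fun setT (EFin \o g) by exact/measurable_EFinP.
have ix x : intg (fun y => side b x y * q y * derive1 phi x).
  by apply: eq_integrable (intgZ measurableT (derive1 phi x) (iq x)) => // y _; rewrite /= mulrC.
have igx x : (\int[mu]_y `|(EFin \o g) (x, y)| <= (I M * `|derive1 phi x|)%:E)%E.
  have [xM|xM] := leP `|x| M; last first.
    rewrite hM// normr0 mulr0.
    have -> : (fun y => `|(EFin \o g) (x, y)|)%E = cst 0%E.
      by apply/funext => y; rewrite /g /= hM// mulr0 normr0.
    by rewrite integral0.
  have -> : (\int[mu]_y `|(EFin \o g) (x, y)| =
      (\int[mu]_y `|side b x y * q y * derive1 phi x|)%:E)%E.
    by rewrite -fin_Rintegral//; exact: intg_norm.
  rewrite lee_fin; under eq_Rintegral do rewrite normrM.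
  have -> : \int[mu]_y (`|side b x y * q y| * `|derive1 phi x|) =
      `|derive1 phi x| * \int[mu]_y `|side b x y * q y|.
    by under eq_Rintegral do rewrite mulrC; rewrite RintegralZl//; exact: intg_norm.
  by rewrite mulrC ler_wpM2r// PI.
have ig : (mu \x mu)%E.-integrable setT (EFin \o g).
  apply/integrable12ltyP => //.
  apply: (@le_lt_trans _ _ (\int[mu]_x (I M * `|derive1 phi x|)%:E)%E).
    apply: ge0_le_integral => //.
    - by move=> x _; exact: integral_ge0.
    - apply: (@measurable_fun_fubini_tonelli_F _ _ _ _ _ mu (abse \o (EFin \o g))).
        exact: measurableT_comp.
      by move=> p; exact: abse_ge0.
    - apply/measurable_EFinP; apply: measurable_funM => //; exact: measurableT_comp.
  rewrite fin_Rintegral ?ltry//; apply: intgZ => //; exact: intg_norm.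
have := Fubini ig.
have -> : (\int[mu]_x \int[mu]_y (EFin \o g) (x, y) =
    \int[mu]_x ((P x * derive1 phi x)%R%:E))%E.
  apply: eq_integral => x _.
  transitivity (\int[mu]_y (side b x y * q y * derive1 phi x))%R%:E.
    by rewrite -fin_Rintegral.
  congr EFin; under eq_Rintegral do rewrite mulrC.
  by rewrite RintegralZl// mulrC.
have -> : (\int[mu]_y \int[mu]_x (EFin \o g) (x, y) =
    \int[mu]_y ((- (q y * phi y))%R%:E))%E.
  apply: eq_integral => y _.
  have iy : intg (fun x => side b x y * derive1 phi x).
    apply: (intg_le measurableT _ (intg_norm iphi')).
      apply: measurable_funM => //.
      exact: (measurableT_comp mside2 (@measurable_pair2 _ _ _ _ y)).
    by move=> x _; rewrite normrM -[leRHS]mul1r ler_wpM2r// side_norm_le1.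
  have iy' := intgZ measurableT (q y) iy.
  transitivity (\int[mu]_x (q y * (side b x y * derive1 phi x)))%R%:E.
    rewrite -fin_Rintegral//; apply: eq_integral => x _.
    by rewrite /g /=; congr EFin; ring.
  by rewrite RintegralZl// side_test// mulrN.
move=> h.
have ->  : - (\int[mu]_x (q x * phi x)) = \int[mu]_x (- (q x * phi x)).
  have iqphi := test_integrable lq tphi.
  have := @RintegralZl _ _ _ mu setT (q * phi) (-1) measurableT iqphi.
  rewrite mulN1r => <-.
  by apply: eq_Rintegral => x _; rewrite mulN1r.
by rewrite /Rintegral h.
Qed.

End Primitive.

(** * First-order operators *)

Section FirstOrder.
Variable R : realType.
Local Notation mu := (@lebesgue_measure R).
Local Notation intg f := (mu.-integrable setT (EFin \o f)).
Local Notation C := ((R[i])^o).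
Variable w : R -> R.
Hypotheses (mw : measurable_fun setT w) (w0 : forall x, 0 < w x).
Hypothesis w_ratio : forall d, 0 < d ->
  exists2 D, 0 <= D & forall x y, w x * ek d x y <= D * w y.
Local Notation nu := (L2norm w).
Variables (b : bool) (E F rho : R -> C) (D d : R).
Hypotheses (sE : csmooth E) (sF : csmooth F) (EF : forall x, E x * F x = 1).
Hypotheses (dE : forall x, cderiv E x = rho x * E x)
  (dF : forall x, cderiv F x = - (rho x * F x)).
Hypotheses (D0 : 0 <= D) (d0 : 0 < d).
Hypothesis decay : forall x y, side b x y != 0 -> N1 (E x * F y) <= D * ek d x y.

(* Green's kernel of u |-> u' - rho u on the side where it decays. *)
Definition fo_kernel (x y : R) : C := (side b x y)%:C * (E x * F y).

Lemma fo_exp_kernel : exp_kernel D d fo_kernel.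
Proof.
split => //.
  have [mE mF] := (csmooth_cmeas sE, csmooth_cmeas sF).
  apply: cmeasM; first by split; [exact: measurable_side|exact: measurable_cst].
  have [[e1 e2] [f1 f2]] := (mE, mF).
  apply: cmeasM; split.
  - exact: (measurableT_comp e1 measurable_fst).
  - exact: (measurableT_comp e2 measurable_fst).
  - exact: (measurableT_comp f1 measurable_snd).
  - exact: (measurableT_comp f2 measurable_snd).
move=> x y; have [s0|s0] := eqVneq (side b x y) 0.
  by rewrite /fo_kernel s0 mul0r N1_0 mulr_ge0// ek_ge0.
apply: (le_trans (N1M _ _)); rewrite N1_real.
apply: le_trans (decay s0); rewrite -[leRHS]mul1r ler_wpM2r ?N1_ge0//.
exact: side_norm_le1.
Qed.

Lemma fo_kopE f x : L2 w f ->
  kop fo_kernel f x = E x * cint (fun y => (side b x y)%:C * (F y * f y)) /\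
  cintg (fun y => (side b x y)%:C * (F y * f y)).
Proof.
move=> Xf; have i := kop_cintg mw w0 w_ratio fo_exp_kernel x Xf.
have i0 : cintg (fun _ : R => 0 : C) by split; exact: integrable0.
have eq1 : (fun y => F x * (fo_kernel x y * f y) + 0) =
    (fun y => (side b x y)%:C * (F y * f y)).
  apply/funext => y; rewrite addr0 /fo_kernel -[RHS]mul1r -(EF x).
  by rewrite !mulrA [F x * _]mulrC; ring.
have := cintg_lin (F x) i i0; have := cint_lin (F x) i i0.
rewrite eq1 => -> ?; split => //.
have -> : cint (fun _ : R => 0 : C) = 0.
  by apply: complexP; rewrite /= /Rintegral integral0.
by rewrite addr0 mulrA EF mul1r.
Qed.

(** Variation of constants: the function is [E] times a primitive of F f. *)
Lemma fo_weak_deriv f : L2 w f ->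
  weak_deriv 1 (kop fo_kernel f) (fun x => rho x * kop fo_kernel f x + f x).
Proof.
move=> Xf; have [mf _] := (L2P mw w0 f).1 Xf.
have [q1 q2] : cmeas (fun y => F y * f y).
  by apply: cmeasM => //; exact: csmooth_cmeas.
pose P x := cint (fun y => (side b x y)%:C * (F y * f y)).
have Re_side x y (z : R[i]) : complex.Re ((side b x y)%:C * z) = side b x y * complex.Re z.
  by rewrite cReM /= mul0r subr0.
have Im_side x y (z : R[i]) : complex.Im ((side b x y)%:C * z) = side b x y * complex.Im z.
  by rewrite cImM /= mul0r addr0.
have wP : weak_deriv 1 P (fun y => F y * f y).
  split.
    have -> : (fun x => complex.Re (P x)) =
        (fun x => \int[mu]_y (side b x y * complex.Re (F y * f y))).
      by apply/funext => x; apply: eq_Rintegral => y _; rewrite Re_side.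
    apply: weak_deriv_primitive => // x; have [_ [i _]] := fo_kopE x Xf.
    by apply: eq_integrable i => // y _; rewrite /= Re_side.
  have -> : (fun x => complex.Im (P x)) =
      (fun x => \int[mu]_y (side b x y * complex.Im (F y * f y))).
    by apply/funext => x; apply: eq_Rintegral => y _; rewrite Im_side.
  apply: weak_deriv_primitive => // x; have [_ [_ i]] := fo_kopE x Xf.
  by apply: eq_integrable i => // y _; rewrite /= Im_side.
have := cweak_deriv_mul sE wP; congr (weak_deriv 1); apply/funext => x.
  by have [->] := fo_kopE x Xf.
have [-> _] := fo_kopE x Xf.
rewrite -/(P x); transitivity (rho x * (E x * P x) + (E x * F x) * f x).
  by rewrite dE; ring.
by rewrite EF mul1r.
Qed.

(** [decay], read with x = 0, makes [E] grow like exp (d |z|) on the half-line [S], which outweighs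
    the subexponential decay of [w]: N1 (E z) ^+ 2 * w z is bounded below on a set of infinite
    measure. *)
Lemma fo_not_L2 : ~ L2 w E.
Proof.
move=> /(L2P mw w0)[mE iE].
have d20 : 0 < 2 * d by rewrite mulr_gt0.
have [B B0 hB] := w_ratio d20.
pose S := if b then `]-oo, 0]%classic else `[(0:R), +oo[%classic.
have mS : measurable S by rewrite /S; case: (b); exact: measurable_itv.
have muS : mu S = +oo%E.
  by rewrite /S; case: (b); rewrite lebesgue_measure_itv/= ?ltNyr ?ltry ?oppr0 ?sub0e
      ?adde0 ?oppe0 ?sube0.
have E00 : E 0 != 0.
  by apply/eqP => E0; have /eqP := EF 0; rewrite E0 mul0r eq_sym oner_eq0.
have E0gt0 : 0 < N1 (E 0).
  by rewrite lt0r N1_ge0 andbT; apply: contra_neq E00; exact: N1_eq0.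
pose c := N1 (E 0) ^+ 2 * w 0.
have c0 : 0 < c by rewrite mulr_gt0// exprn_gt0.
have h z : S z -> c <= D ^+ 2 * B * (N1 (E z) ^+ 2 * w z).
  move=> Sz; have sz : side b 0 z != 0.
    move: Sz; rewrite /S /side; case: (b) => /=; rewrite in_itv/= ?andbT => ->.
      by rewrite oner_neq0.
    by rewrite oppr_eq0 oner_neq0.
  have h1 : N1 (E 0) <= D * ek d 0 z * N1 (E z).
    rewrite -[E 0 in leLHS]mulr1 -(EF z) [E z * F z]mulrC mulrA.
    by apply: (le_trans (N1M _ _)); rewrite ler_wpM2r ?N1_ge0// decay.
  have h2 := sqr_le_ge0 (N1_ge0 _) h1.
  have ekE : ek d 0 z ^+ 2 = ek (2 * d) 0 z.
    by rewrite [RHS]ekD expr2 (_ : 2 * d / 2 = d)//; field.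
  apply: (le_trans (ler_wpM2r (ltW (w0 0)) h2)).
  rewrite !exprMn ekE.
  have -> : D ^+ 2 * ek (2 * d) 0 z * N1 (E z) ^+ 2 * w 0 =
    D ^+ 2 * N1 (E z) ^+ 2 * (w 0 * ek (2 * d) 0 z) by ring.
  have -> : D ^+ 2 * B * (N1 (E z) ^+ 2 * w z) =
    D ^+ 2 * N1 (E z) ^+ 2 * (B * w z) by ring.
  by rewrite ler_wpM2l// mulr_ge0 ?sqr_ge0.
have i := intgZ measurableT (D ^+ 2 * B) iE.
have : (\int[mu]_(x in S) c%:E < +oo)%E.
  have /integrableP[m lty] := i.
  apply: le_lt_trans lty.
  rewrite [leLHS]integral_mkcond; apply: ge0_le_integral => //.
  - by move=> x _; rewrite erestrict_ge0// => y _; rewrite lee_fin ltW.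
  - by apply/(measurable_restrictT _ _).1.
  - exact: measurableT_comp.
  - move=> x _; rewrite /patch; case: ifPn => [/set_mem/h hx|_]; last exact: abse_ge0.
    by rewrite lee_fin; apply: le_trans hx (ler_norm _).
rewrite integral_cst// [X in (_ * X)%E](_ : _ = +oo%E); last exact: muS.
by rewrite gt0_muley ?lte_fin.
Qed.

(** After multiplication by [F] the equation says that F y has derivative zero. So y is almost
    everywhere a multiple of [E], which is not in the space. *)
Lemma fo_unique y : L2 w y -> weak_deriv 1 y (fun x => rho x * y x) ->
  null_space (L2 w) nu y.
Proof.
move=> Xy wy; have [my _] := (L2P mw w0 y).1 Xy.
apply/(L2_nullP mw w0); split => //.
have wF : weak_deriv 1 (fun x => F x * y x) (fun _ => 0).
  have := cweak_deriv_mul sF wy; congr (weak_deriv 1); apply/funext => x.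
  by rewrite dF; ring.
have [[c1 h1] [c2 h2]] := (weak_deriv0_cst wF.1, weak_deriv0_cst wF.2).
pose c : R[i] := c1 +i* c2.
have yE : {ae mu, forall x, y x = c * E x}.
  apply: ae_filter_imply2 h1 h2 => x x1 x2.
  have <- : F x * y x = c by apply: complexP.
  by rewrite mulrC mulrA EF mul1r.
have [c0|c0] := eqVneq c 0.
  by apply: ae_filter_imply yE => x ->; rewrite c0 mul0r.
case: fo_not_L2.
have mE := csmooth_cmeas sE.
have XN : null_space (L2 w) nu (y - (c : R[i]) *: E).
  apply/(L2_nullP mw w0); split.
    apply: cmeasD => //; apply: cmeasN; apply: cmeasM => //; exact: cmeas_cst.
  by apply: ae_filter_imply yE => x yx; rewrite [LHS](_ : _ = y x - c * E x)// yx subrr.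
have hL := L2_lin_closed mw w0.
have XcE : L2 w (c *: E).
  rewrite -(subKr y (c *: E)); apply: lin_closedB => //; by case: XN.
have := lin_closedZ c^-1 hL XcE; rewrite scalerA mulVf// scale1r; exact.
Qed.

Lemma fo_inverse u f : L2 w u -> L2 w f ->
  weak_deriv 1 u (fun x => rho x * u x + f x) ->
  null_space (L2 w) nu (u - kop fo_kernel f).
Proof.
move=> Xu Xf wu.
have [E' _ hk] := kop_L2 mw w0 w_ratio fo_exp_kernel.
have Xk : L2 w (kop fo_kernel f) by have [] := hk f Xf.
apply: fo_unique; first by apply: lin_closedB => //; exact: L2_lin_closed.
have := cweak_derivB wu (fo_weak_deriv Xf); congr (weak_deriv 1).
apply/funext => x; rewrite [(u - _) x](_ : _ = u x - kop fo_kernel f x)//; ring.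
Qed.

End FirstOrder.

(** * Complex exponentials of a real variable *)

Section ComplexExponential.
Variable R : realType.
Local Notation C := ((R[i])^o).
Implicit Types (u v du dv : R -> R).

Definition cexp u v : R -> C := fun x => (expR (u x) * cos (v x)) +i* (expR (u x) * sin (v x)).

Lemma is_derive_expRcos u v (x du dv : R) : is_derive x 1 u du -> is_derive x 1 v dv ->
  is_derive x 1 (fun x => expR (u x) * cos (v x))
    (du * (expR (u x) * cos (v x)) - dv * (expR (u x) * sin (v x))).
Proof.
move=> hu hv.
have he := @is_derive1_comp R expR u x (expR (u x)) du (is_derive_expR _) hu.
have hc := @is_derive1_comp R cos v x (- sin (v x)) dv (is_derive_cos _) hv.
have hm := is_deriveM he hc; apply: (is_derive_eq hm).
by rewrite /GRing.scale/=; ring.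
Qed.

Lemma is_derive_expRsin u v (x du dv : R) : is_derive x 1 u du -> is_derive x 1 v dv ->
  is_derive x 1 (fun x => expR (u x) * sin (v x))
    (du * (expR (u x) * sin (v x)) + dv * (expR (u x) * cos (v x))).
Proof.
move=> hu hv.
have he := @is_derive1_comp R expR u x (expR (u x)) du (is_derive_expR _) hu.
have hc := @is_derive1_comp R sin v x (cos (v x)) dv (is_derive_sin _) hv.
have hm := is_deriveM he hc; apply: (is_derive_eq hm).
by rewrite /GRing.scale/=; ring.
Qed.

Section Rate.
Variables (u v du dv : R -> R).
Hypotheses (hu : forall x : R, is_derive x 1 u (du x)) (hv : forall x : R, is_derive x 1 v
    (dv x)).

(** The derivative of each function involves the other, hence the joint induction. *)
Lemma cexp_dn n : (forall k, dn k du) -> (forall k, dn k dv) ->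
  dn n (fun x => expR (u x) * cos (v x)) /\ dn n (fun x => expR (u x) * sin (v x)).
Proof.
move=> su sv; elim: n => [|n [IHc IHs]].
  split=> x.
    exact: (@ex_derive _ _ _ _ _ _ _ (is_derive_expRcos (hu x) (hv x))).
  exact: (@ex_derive _ _ _ _ _ _ _ (is_derive_expRsin (hu x) (hv x))).
split.
  apply: (dnS (fun x => is_derive_expRcos (hu x) (hv x))).
  exact: (dnB (dnM (su n) IHc) (dnM (sv n) IHs)).
apply: (dnS (fun x => is_derive_expRsin (hu x) (hv x))).
exact: (dnD (dnM (su n) IHs) (dnM (sv n) IHc)).
Qed.

Lemma cexp_csmooth : smooth du -> smooth dv -> csmooth (cexp u v).
Proof. by move=> su sv; split => n; have [] := cexp_dn n su sv. Qed.

Lemma cexp_cderiv x : cderiv (cexp u v) x = ((du x +i* dv x) : C) * cexp u v x.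
Proof.
rewrite /cderiv.
have -> : derive1 (fun x => complex.Re (cexp u v x)) =
  (fun x => du x * (expR (u x) * cos (v x)) - dv x * (expR (u x) * sin (v x))).
  by apply: is_derive_derive1E => y; exact: is_derive_expRcos.
have -> : derive1 (fun x => complex.Im (cexp u v x)) =
  (fun x => du x * (expR (u x) * sin (v x)) + dv x * (expR (u x) * cos (v x))).
  by apply: is_derive_derive1E => y; exact: is_derive_expRsin.
by apply: complexP; rewrite ?cReM ?cImM.
Qed.

End Rate.

Lemma cexpV u v x : cexp u v x * cexp (fun x => - u x) (fun x => - v x) x = 1.
Proof.
have e1 : expR (u x) * expR (- u x) = 1 by rewrite -expRD subrr expR0.
have c1 := cos2Dsin2 (v x).
apply: complexP; rewrite ?cReM ?cImM /= cosN sinN.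
  transitivity ((expR (u x) * expR (- u x)) * (cos (v x) ^+ 2 + sin (v x) ^+ 2)); first ring.
  by rewrite e1 c1 mulr1.
by ring.
Qed.

Lemma N1_cexp u v x : N1 (cexp u v x) <= 2 * expR (u x).
Proof.
rewrite /N1 /= !normrM ger0_norm ?expR_ge0// -mulrDr mulrC ler_wpM2r ?expR_ge0//.
rewrite (_ : 2 = 1 + 1)// lerD//.
  by rewrite ler_norml cos_geN1 cos_le1.
by rewrite ler_norml sin_geN1 sin_le1.
Qed.

End ComplexExponential.

Section FrontGreen.
Variable R : realType.
Local Notation C := ((R[i])^o).
Variables (h L : R -> R).
Hypotheses (hL : forall x : R, is_derive x 1 L (h x)) (sh : smooth h)
  (h01 : forall x, 0 <= h x <= 1).

Definition lin_phase (p q : R) : R -> R := fun x => p * x + q * L x.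
(** As [L] is a primitive of [h], this is exp (p x + q L x), a solution of u' = (p + q h) u in
    closed form. *)
Definition front_exp (p q : R[i]) : R -> C :=
  cexp (lin_phase (complex.Re p) (complex.Re q)) (lin_phase (complex.Im p) (complex.Im q)).
Definition front_rate (p q : R[i]) : R -> C := fun x => p + q * (h x)%:C.

Lemma is_derive_lin_phase p q (x : R) : is_derive x 1 (lin_phase p q) (p + q * h x).
Proof.
have h1 := @is_deriveZ R R R id p x 1 1 (is_derive_id _ _).
have h2 := @is_deriveZ R R R L q x 1 (h x) (hL x).
have := is_deriveD h1 h2; rewrite /GRing.scale/= mulr1; exact.
Qed.

Lemma smooth_lin_rate p q : smooth (fun x => p + q * h x).
Proof.
move=> n; have := dnD (dn_cst n p) (dnM (dn_cst n q) (sh n)); exact.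
Qed.

Lemma front_exp_csmooth p q : csmooth (front_exp p q).
Proof.
apply: (@cexp_csmooth _ _ _ _ _ (is_derive_lin_phase _ _) (is_derive_lin_phase _ _));
  exact: smooth_lin_rate.
Qed.

Lemma front_exp_cderiv p q x : cderiv (front_exp p q) x = front_rate p q x * front_exp p q x.
Proof.
rewrite (cexp_cderiv (is_derive_lin_phase _ _) (is_derive_lin_phase _ _)).
congr (_ * _); rewrite /front_rate.
by apply: complexP; rewrite ?cReD ?cImD ?cReM ?cImM /=; ring.
Qed.

Lemma front_expN p q x : front_exp (- p) (- q) x =
  cexp (fun x => - lin_phase (complex.Re p) (complex.Re q) x)
       (fun x => - lin_phase (complex.Im p) (complex.Im q) x) x.
Proof.
by rewrite /front_exp /cexp /lin_phase !cReN !cImN !mulNr -!opprD.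
Qed.

Lemma front_expV p q x : front_exp p q x * front_exp (- p) (- q) x = 1.
Proof. by rewrite front_expN cexpV. Qed.

Lemma front_expN_cderiv p q x : cderiv (front_exp (- p) (- q)) x =
  - (front_rate p q x * front_exp (- p) (- q) x).
Proof. by rewrite front_exp_cderiv /front_rate; ring. Qed.

(** The slope p + q h is a convex combination of p and p + q, so that it is at most - d everywhere
    and not just in the limits. *)
Lemma lin_phase_le p q d x y : p <= - d -> p + q <= - d -> y <= x ->
  lin_phase p q x - lin_phase p q y <= - d * (x - y).
Proof.
move=> pd pqd; rewrite le_eqVlt => /predU1P[->|yx]; first by rewrite !subrr mulr0.
have := @MVT R (lin_phase p q) (fun z => p + q * h z) y x yx
  (fun z _ => is_derive_lin_phase p q z).
case.
  by apply: derivable_within_continuous => z _; apply: ex_derive; exact: is_derive_lin_phase.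
move=> z _ ->; rewrite ler_pM2r ?subr_gt0//.
have /andP[h0 h1] := h01 z.
have : (1 - h z) * p + h z * (p + q) <= (1 - h z) * - d + h z * - d.
  by rewrite lerD// ler_wpM2l// subr_ge0.
by congr (_ <= _); ring.
Qed.

Lemma front_decay b p q (d : R) :
  (if b then complex.Re p <= - d /\ complex.Re (p + q) <= - d
   else d <= complex.Re p /\ d <= complex.Re (p + q)) ->
  forall x y, side b x y != 0 ->
    N1 (front_exp p q x * front_exp (- p) (- q) y) <= 4 * ek d x y.
Proof.
move=> hpq x y s0.
apply: (le_trans (N1M _ _)).
apply: (le_trans (ler_pM (N1_ge0 _) (N1_ge0 _) (N1_cexp _ _ _) (N1_cexp _ _ _))).
rewrite mulrACA -natrM ler_wpM2l// -expRD ler_expR.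
have -> : lin_phase (complex.Re (- p)) (complex.Re (- q)) y =
    - lin_phase (complex.Re p) (complex.Re q) y.
  by rewrite /lin_phase !cReN !mulNr opprD.
case: b hpq s0; rewrite /side => -[h1 h2].
  case: ifP => [yx _|_]; last by rewrite eqxx.
  rewrite ger0_norm ?subr_ge0//; apply: lin_phase_le => //.
  by rewrite -cReD.
case: ifP => [xy _|_]; last by rewrite eqxx.
rewrite distrC ger0_norm ?subr_ge0//.
have := @lin_phase_le (- complex.Re p) (- complex.Re q) d y x.
have lN z : lin_phase (- complex.Re p) (- complex.Re q) z = - lin_phase (complex.Re p)
    (complex.Re q) z.
  by rewrite /lin_phase !mulNr opprD.
rewrite !lN opprK => hl; rewrite addrC; apply: hl => //; first by rewrite lerN2.
by rewrite -opprD lerN2 -cReD.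
Qed.

End FrontGreen.

(** * The weight *)

Section Weight.
Variables (R : realType) (beta : R).
Hypothesis hbeta : 2 < beta.
Local Notation mu := (@lebesgue_measure R).
Local Notation intg f := (mu.-integrable setT (EFin \o f)).
Implicit Types (x y d : R).

Lemma half_beta_gt1 : 1 < beta / 2.
Proof. by rewrite ltr_pdivlMr// mul1r. Qed.

Lemma oneDsqr_gt0 x : 0 < 1 + x ^+ 2.
Proof. by rewrite ltr_pwDl// sqr_ge0. Qed.

Lemma weightE x : weight beta x = expR (- (beta / 2 * ln (1 + x ^+ 2))).
Proof.
by rewrite /weight real_normK ?num_real// /powR gt_eqF ?oneDsqr_gt0// !mulNr.
Qed.

Lemma weight_gt0 x : 0 < weight beta x.
Proof. by rewrite weightE expR_gt0. Qed.

Definition weight_sqrt x : R := Num.sqrt (weight beta x).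
(** The logarithmic derivative of [weight_sqrt]. *)
Definition weight_rate x : R := - (beta / 2) * (x / (1 + x ^+ 2)).
Definition weight_rate' x : R := - (beta / 2) * ((1 - x ^+ 2) / (1 + x ^+ 2) ^+ 2).

Lemma weight_sqrt_sqr x : weight_sqrt x ^+ 2 = weight beta x.
Proof. by rewrite sqr_sqrtr// ltW// weight_gt0. Qed.

Lemma weight_sqrt_gt0 x : 0 < weight_sqrt x.
Proof. by rewrite sqrtr_gt0 weight_gt0. Qed.

Lemma weight_sqrtE x : weight_sqrt x = expR (- (beta / 4) * ln (1 + x ^+ 2)).
Proof.
rewrite /weight_sqrt weightE.
rewrite (_ : expR _ = expR (- (beta / 4) * ln (1 + x ^+ 2)) ^+ 2) ?sqrtr_sqr.
  by rewrite ger0_norm// expR_ge0.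
by rewrite [RHS]expr2 -expRD; congr expR; field.
Qed.

Lemma is_derive_oneDsqr x : is_derive x 1 (fun y => 1 + y ^+ 2) (2 * x).
Proof.
by apply: is_derive_eq; rewrite /GRing.scale/=; ring.
Qed.

Lemma is_derive_weight_sqrt x :
  is_derive x 1 weight_sqrt (weight_rate x * weight_sqrt x).
Proof.
rewrite (_ : weight_sqrt = fun x => expR (- (beta / 4) * ln (1 + x ^+ 2))); last first.
  by apply/funext => y; exact: weight_sqrtE.
have q0 := oneDsqr_gt0 x.
have h1 := @is_derive1_comp R (@ln R) (fun y => 1 + y ^+ 2) x _ _
  (is_derive1_ln q0) (is_derive_oneDsqr x).
have h2 := @is_deriveZ R R R _ (- (beta / 4)) x 1 _ h1.
have h3 := @is_derive1_comp R expR _ x _ _ (is_derive_expR _) h2.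
apply: (is_derive_eq h3); rewrite /GRing.scale/= /weight_rate.
by rewrite mulrC; congr (_ * _); field; rewrite gt_eqF.
Qed.

Lemma is_derive_weight_rate x : is_derive x 1 weight_rate (weight_rate' x).
Proof.
have q0 : 1 + x ^+ 2 != 0 by rewrite gt_eqF// oneDsqr_gt0.
have h1 := @is_deriveV R (fun y => 1 + y ^+ 2) x _ 1 q0 (is_derive_oneDsqr x).
have h2 := is_deriveM (is_derive_id (x : R) 1) h1.
have h3 := @is_deriveZ R R R _ (- (beta / 2)) x 1 _ h2.
apply: (is_derive_eq h3); rewrite /GRing.scale/= /weight_rate'.
by field.
Qed.

Lemma smooth_oneDsqrV : smooth (fun x => (1 + x ^+ 2)^-1).
Proof.
move=> n; apply: dnV => [x|]; first by rewrite gt_eqF// oneDsqr_gt0.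
have := dnD (dn_cst n 1) (dnM (@dn_id R n) (@dn_id R n)); exact.
Qed.

Lemma smooth_weight_rate : smooth weight_rate.
Proof.
move=> n; have := dnM (dn_cst n (- (beta / 2))) (dnM (@dn_id R n) (smooth_oneDsqrV n)).
exact.
Qed.

Lemma smooth_weight_sqrt : smooth weight_sqrt.
Proof.
elim=> [x|n IH]; first exact: (@ex_derive _ _ _ _ _ _ _ (is_derive_weight_sqrt x)).
exact: (dnS is_derive_weight_sqrt (dnM (smooth_weight_rate n) IH)).
Qed.

Lemma smooth_weight_sqrtV : smooth (fun x => (weight_sqrt x)^-1).
Proof.
move=> n; apply: dnV; last exact: smooth_weight_sqrt.
by move=> x; rewrite gt_eqF// weight_sqrt_gt0.
Qed.

Lemma is_derive_weight_sqrtV x :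
  is_derive x 1 (fun x => (weight_sqrt x)^-1) (- weight_rate x * (weight_sqrt x)^-1).
Proof.
have q0 : weight_sqrt x != 0 by rewrite gt_eqF// weight_sqrt_gt0.
have h1 := @is_deriveV R weight_sqrt x _ 1 q0 (is_derive_weight_sqrt x).
by apply: (is_derive_eq h1); rewrite /GRing.scale/=; field.
Qed.

Lemma weight_rate_bound x : `|weight_rate x| <= beta.
Proof.
have q0 := oneDsqr_gt0 x; have b0 : 0 <= beta / 2 by apply: ltW; apply: lt_trans half_beta_gt1.
rewrite /weight_rate normrM normrN (ger0_norm b0) normrM normfV (gtr0_norm q0).
suff : `|x| / (1 + x ^+ 2) <= 1 by move=> /(ler_wpM2l b0) h; apply: (le_trans h);
    rewrite mulr1 ler_pdivrMr// ler_peMr// ?ler1n// (le_trans _ (ltW hbeta)).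
rewrite ler_pdivrMr// mul1r -(real_normK (num_real x)).
set t := `|x|; have t0 : 0 <= t by exact: normr_ge0.
have : 0 <= (t - 1) * (t - 1) by rewrite -expr2 sqr_ge0.
by rewrite expr2; clear -t0; nra.
Qed.

Lemma weight_rate'_bound x : `|weight_rate' x| <= beta.
Proof.
have q0 := oneDsqr_gt0 x; have b0 : 0 <= beta / 2 by apply: ltW; apply: lt_trans half_beta_gt1.
rewrite /weight_rate' normrM normrN (ger0_norm b0).
suff : `|(1 - x ^+ 2) / (1 + x ^+ 2) ^+ 2| <= 1.
  by move=> /(ler_wpM2l b0) h; apply: (le_trans h);
      rewrite mulr1 ler_pdivrMr// ler_peMr// ?ler1n// (le_trans _ (ltW hbeta)).
rewrite normrM normfV [X in _ / X]ger0_norm ?sqr_ge0// ler_pdivrMr ?exprn_gt0// mul1r.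
have := sqr_ge0 x; set t := x ^+ 2 => s0.
have : 0 <= t * t by rewrite mulr_ge0.
by clear -s0; rewrite expr2 ler_norml => ?; apply/andP; split; lra.
Qed.

Lemma measurable_weight : measurable_fun setT (weight beta).
Proof.
rewrite (_ : weight beta = fun x => weight_sqrt x * weight_sqrt x).
  by apply: measurable_funM; apply: continuous_measurable_fun;
    exact: smooth_continuous smooth_weight_sqrt.
by apply/funext => x; rewrite -expr2 weight_sqrt_sqr.
Qed.

(** exp (d t) >= (1 + d t / 2)^2, whose quadratic term becomes t^2 once multiplied by 4 / d^2. *)
Lemma oneDsqr_le_expR d x : 0 < d -> 1 + x ^+ 2 <= (1 + 4 / d ^+ 2) * expR (d * `|x|).
Proof.
move=> d0; have e1 := expR_ge1Dx (d * `|x| / 2).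
have h : (1 + d * `|x| / 2) ^+ 2 <= expR (d * `|x|).
  rewrite (_ : expR _ = expR (d * `|x| / 2) ^+ 2); last first.
    by rewrite [RHS]expr2 -expRD; congr expR; field.
  by apply: sqr_le_ge0 e1; rewrite addr_ge0// divr_ge0// mulr_ge0// ltW.
have c0 : 0 <= 1 + 4 / d ^+ 2 by rewrite addr_ge0// divr_ge0// sqr_ge0.
apply: le_trans (ler_wpM2l c0 h).
rewrite -(real_normK (num_real x)); set t := `|x|; have t0 : 0 <= t by exact: normr_ge0.
have -> : (1 + 4 / d ^+ 2) * (1 + d * t / 2) ^+ 2 =
   1 + t ^+ 2 + (4 / d ^+ 2 + (1 + 4 / d ^+ 2) * (d * t) + (d * t / 2) ^+ 2).
  by field; rewrite gt_eqF.
rewrite lerDl !addr_ge0 ?sqr_ge0// ?mulr_ge0 ?(ltW d0)//.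
by rewrite invr_ge0 sqr_ge0.
Qed.

(** Peetre's inequality. *)
Lemma oneDsqr_submul x y : 1 + y ^+ 2 <= 2 * (1 + x ^+ 2) * (1 + (x - y) ^+ 2).
Proof.
have := sqr_ge0 (2 * x - y); have := mulr_ge0 (sqr_ge0 x) (sqr_ge0 (x - y)).
by rewrite !expr2; nra.
Qed.

(** The ratio w x / w y is the power beta / 2 of (1 + y^2) / (1 + x^2), which Peetre's inequality
    bounds by a polynomial in x - y and then by an exponential. The rate d' is d / (beta / 2), so
    that the power restores d. *)
Lemma weight_ratio d : 0 < d ->
  exists2 D, 0 <= D & forall x y, weight beta x * ek d x y <= D * weight beta y.
Proof.
move=> d0; have b0 : 0 < beta / 2 by apply: lt_trans half_beta_gt1.
pose d' := d / (beta / 2); have d'0 : 0 < d' by rewrite divr_gt0.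
pose K := 2 * (1 + 4 / d' ^+ 2).
have K0 : 0 < K by rewrite mulr_gt0// ltr_pwDl// divr_ge0// sqr_ge0.
exists (expR (beta / 2 * ln K)) => [|x y]; first exact: expR_ge0.
rewrite !weightE /ek -!expRD ler_expR.
have [qx qy] := (oneDsqr_gt0 x, oneDsqr_gt0 y).
have e0 := expR_gt0 (d' * `|x - y|).
have : ln (1 + y ^+ 2) <= ln K + ln (1 + x ^+ 2) + d' * `|x - y|.
  have -> : d' * `|x - y| = ln (expR (d' * `|x - y|)) by rewrite expRK.
  have Kq : 0 < K * (1 + x ^+ 2) by exact: mulr_gt0.
  rewrite -lnM ?posrE// -lnM ?posrE//.
  rewrite ler_ln ?posrE//; last exact: mulr_gt0.
  apply: (le_trans (oneDsqr_submul x y)).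
  have := oneDsqr_le_expR (x - y) d'0 => /(ler_wpM2l (mulr_ge0 (ler0n R 2) (ltW qx))) h.
  by apply: (le_trans h); rewrite /K le_eqVlt; apply/orP; left; apply/eqP; ring.
move=> /(ler_wpM2l (ltW b0)); rewrite !mulrDr /d'.
rewrite [X in _ <= _ + X](_ : _ = d * `|x - y|); last by field;
    rewrite !gt_eqF// (lt_trans _ hbeta).
by lra.
Qed.

(** As beta / 2 > 1, the weight lies below 1 / (1 + x^2). *)
Lemma intg_weight : intg (weight beta).
Proof.
have i1 : intg (fun x => (oneDsqr x)^-1).
  apply/integrableP; split.
    by apply/measurable_EFinP; apply: continuous_measurable_fun; exact: continuous_oneDsqrV.
  have -> : (\int[mu]_x `|(EFin \o fun x : R => ((oneDsqr x)^-1)%R) x|)%E =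
      (\int[mu]_x ((oneDsqr x)^-1)%R%:E)%E.
    by apply: eq_integral => x _; rewrite /= ger0_norm// invr_ge0 ltW// oneDsqr_gt0.
  rewrite (@ge0_symfun_integralT R (fun x => (oneDsqr x)^-1)).
  - rewrite (_ : [set x | (0 <= x)%R] = `[0, +oo[%classic).
      by rewrite integral0y_oneDsqr -EFinM ltry.
    by apply/seteqP; split => x /=; rewrite in_itv/= andbT.
  - by move=> x; rewrite invr_ge0 ltW// oneDsqr_gt0.
  - exact: continuous_oneDsqrV.
  - by move=> x; rewrite /oneDsqr /= sqrrN.
apply: (intg_le measurableT _ i1) => [|x _]; first exact: measurable_weight.
rewrite gtr0_norm ?weight_gt0// weightE.
have q0 := oneDsqr_gt0 x; rewrite -[leRHS]lnK ?posrE ?invr_gt0// ler_expR lnV ?posrE//.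
rewrite lerN2 ler_peMl//; last exact: ltW half_beta_gt1.
by rewrite ln_ge0// lerDl sqr_ge0.
Qed.

End Weight.

(** * Derivatives in the weighted space and the domain of the operator *)

Section WeightTransfer.
Variables (R : realType) (beta : R).
Hypothesis hbeta : 2 < beta.
Local Notation mu := (@lebesgue_measure R).
Local Notation C := ((R[i])^o).
Local Notation w := (weight beta).
Local Notation nu := (L2norm w).
Local Notation X := (L2 w).
Local Notation om := (weight_sqrt beta).
Local Notation ka := (weight_rate beta).
Implicit Types (f u : R -> C).

Lemma measurable_cst1 : measurable_fun setT (cst 1 : R -> R).
Proof. exact: measurable_cst. Qed.

Lemma cst1_gt0 (x : R) : 0 < (cst 1 : R -> R) x.
Proof. exact: ltr01. Qed.

Lemma csmooth_real (g : R -> R) : smooth g -> csmooth (fun x => (g x)%:C : C).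
Proof. by move=> sg; split => // n; exact: dn_cst. Qed.

Lemma cderiv_real (g : R -> R) (l : R -> R) x : (forall x : R, is_derive x 1 g (l x)) ->
  cderiv (fun x => (g x)%:C : C) x = (l x)%:C.
Proof.
move=> gl; rewrite /cderiv /=; congr (_ +i* _); first by rewrite (is_derive_derive1E gl).
by rewrite derive1E derive_val.
Qed.

Lemma cweak_derivD u g v f : weak_deriv 1 u g -> weak_deriv 1 v f ->
  weak_deriv 1 (fun x => u x + v x : C) (fun x => g x + f x).
Proof.
move=> [u1 u2] [v1 v2]; split.
  have := weak_derivD u1 v1; congr real_weak_deriv; apply/funext => x.
    by rewrite !fctE cReD.
  by rewrite !fctE cReD.
have := weak_derivD u2 v2; congr real_weak_deriv; apply/funext => x.
  by rewrite !fctE cImD.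
by rewrite !fctE cImD.
Qed.

Lemma L2_ae f g : X f -> cmeas g -> {ae mu, forall x, g x = f x} -> X g.
Proof.
move=> Xf mg fg; have [mf _] := (L2P (measurable_weight beta) (weight_gt0 beta) f).1 Xf.
have hL := L2_lin_closed (measurable_weight beta) (weight_gt0 beta).
have : null_space X nu (g - f).
  apply/(L2_nullP (measurable_weight beta) (weight_gt0 beta)); split.
    by apply: cmeasD => //; exact: cmeasN.
  by apply: ae_filter_imply fg => x gx; rewrite [LHS](_ : _ = g x - f x)// gx subrr.
by move=> [/(lin_closedD hL) /(_ Xf)]; rewrite subrK.
Qed.

Lemma L2_weight_mul u : cmeas u -> L2 (cst 1) (fun x => (om x)%:C * u x) <-> X u.
Proof.
move=> mu1; have mom : cmeas (fun x => (om x)%:C : C).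
  exact: csmooth_cmeas (csmooth_real (smooth_weight_sqrt beta)).
have E : (fun x => N1 ((om x)%:C * u x) ^+ 2 * (cst 1 : R -> R) x) =
  (fun x => N1 (u x) ^+ 2 * w x).
  apply/funext => x; rewrite /= mulr1 -weight_sqrt_sqr.
  have o0 := ltW (weight_sqrt_gt0 beta x).
  rewrite /N1 cReM cImM /= !mul0r subr0 addr0 !normrM (ger0_norm o0).
  by rewrite -mulrDr exprMn mulrC.
split=> [/(L2P measurable_cst1 cst1_gt0)[_]|/(L2P (measurable_weight beta) (weight_gt0
    beta))[_ i]].
  by rewrite E => i; apply/(L2P (measurable_weight beta) (weight_gt0 beta)).
apply/(L2P measurable_cst1 cst1_gt0); split; last by rewrite E.
exact: cmeasM.
Qed.

(** Writing u as om^-1 (om u), its derivative is om^-1 (om u)' - ka u. The logarithmic derivative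
    [ka] of [om] is bounded, so both terms lie in X. *)
Lemma H2_weight_deriv u u1 : H2 (weight_isometry beta u) -> weak_deriv 1 u u1 ->
  X u /\ X u1.
Proof.
move=> [L0 [g1 [_ [Lg1 _ wg1 _]]]] wu; have [mu0 mu1] := weak_deriv_cmeas wu.
have Xu : X u by apply/L2_weight_mul.
split => //.
have sV := csmooth_real (smooth_weight_sqrtV beta).
have [mg _] := (L2P measurable_cst1 cst1_gt0 _).1 Lg1.
have := cweak_deriv_mul sV wg1.
rewrite (_ : (fun x => (om x)^-1%:C * weight_isometry beta u x) = u); last first.
  apply/funext => x; rewrite /weight_isometry mulrA -rmorphM/= mulVf ?mul1r//.
  by rewrite gt_eqF// weight_sqrt_gt0.
move=> wu'; apply: (L2_ae _ mu1 (cweak_deriv_unique wu wu')).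
have om0 x : om x != 0 by rewrite gt_eqF// weight_sqrt_gt0.
have -> : (fun x => cderiv (fun y =>
    (om y)^-1%:C : C) x * weight_isometry beta u x + (om x)^-1%:C * g1 x) =
    mop (fun x => (- ka x)%:C : C) u + (fun x => (om x)^-1%:C * g1 x).
  apply/funext => x; rewrite [RHS](_ : _ = (- ka x)%:C * u x + (om x)^-1%:C * g1 x)//.
  congr (_ + _); rewrite (cderiv_real x (is_derive_weight_sqrtV beta)).
  by rewrite /weight_isometry mulrA -rmorphM/= -mulrA mulVf ?mulr1.
have hL := L2_lin_closed (measurable_weight beta) (weight_gt0 beta).
apply: lin_closedD => //.
  apply: (mop_L2 (measurable_weight beta) (weight_gt0 beta) (Dm := beta)) => //.
    exact: csmooth_cmeas (csmooth_real (smoothN (smooth_weight_rate beta))).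
  by move=> x; rewrite N1_real normrN weight_rate_bound.
apply/L2_weight_mul.
  by apply: cmeasM => //; exact: csmooth_cmeas.
rewrite (_ : (fun x => _) = g1)//; apply/funext => x.
by rewrite mulrA -rmorphM/= mulfV ?mul1r.
Qed.

(** The second derivative of om u is om (u2 + 2 ka u1 + (ka' + ka^2) u), with [ka] and its
    derivative bounded. *)
Lemma H2_weight u u1 u2 : X u -> X u1 -> X u2 ->
  weak_deriv 1 u u1 -> weak_deriv 1 u1 u2 -> H2 (weight_isometry beta u).
Proof.
move=> Xu Xu1 Xu2 w1 w2.
have [[mu0 mu1] [_ mu2]] := (weak_deriv_cmeas w1, weak_deriv_cmeas w2).
have sO := csmooth_real (smooth_weight_sqrt beta).
have sKO := csmooth_real (smoothM (smooth_weight_rate beta) (smooth_weight_sqrt beta)).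
have dKO (x : R) : is_derive x 1 (ka * om)
    ((weight_rate' beta x + ka x ^+ 2) * om x).
  have := is_deriveM (is_derive_weight_rate beta x) (is_derive_weight_sqrt beta x).
  by move=> hm; apply: (is_derive_eq hm); rewrite /GRing.scale/=; ring.
have v1 := cweak_deriv_mul sO w1.
have v2 := cweak_derivD (cweak_deriv_mul sKO w1) (cweak_deriv_mul sO w2).
set g1 := (X in weak_deriv 1 _ X) in v1.
set g2 := (X in weak_deriv 1 _ X) in v2.
have Eg1 : (fun x => ((ka * om) x)%:C * u x + (om x)%:C * u1 x) = g1.
  apply/funext => x; rewrite /g1 (cderiv_real x (is_derive_weight_sqrt beta)).
  by [].
rewrite Eg1 in v2.
have hL := L2_lin_closed measurable_cst1 cst1_gt0.
have LO f : X f -> L2 (cst 1) (fun x => (om x)%:C * f x).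
  by move=> Xf; apply/L2_weight_mul => //;
      have [] := (L2P (measurable_weight beta) (weight_gt0 beta) f).1 Xf.
have mK := csmooth_cmeas (csmooth_real (smooth_weight_rate beta)).
have mK' : cmeas (fun x => (weight_rate' beta x)%:C : C).
  apply: csmooth_cmeas; apply: csmooth_real.
  rewrite -(is_derive_derive1E (is_derive_weight_rate beta)).
  exact/smooth_deriv/smooth_weight_rate.
have mopL := fun m Dm mm hm f Lf => @mop_L2 R (cst 1) measurable_cst1 cst1_gt0 m Dm mm hm f Lf.
have LK f : L2 (cst 1) f -> L2 (cst 1) (mop (fun x => (ka x)%:C : C) f).
  by apply: (mopL _ beta) => // x; rewrite N1_real weight_rate_bound.
have LK' f : L2 (cst 1) f -> L2 (cst 1) (mop (fun x => (weight_rate' beta x)%:C : C) f).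
  by apply: (mopL _ beta) => // x; rewrite N1_real weight_rate'_bound.
split; first exact: LO.
exists g1, g2; split.
- have := lin_closedD hL (LK _ (LO _ Xu)) (LO _ Xu1); congr (L2 _).
  by rewrite -Eg1; apply/funext => x;
      rewrite [RHS](_ : _ = (ka x * om x)%:C * u x + (om x)%:C * u1 x)// rmorphM -mulrA.
- have := lin_closedD hL (lin_closedD hL (LK' _ (LO _ Xu)) (LK _ (LK _ (LO _ Xu))))
    (lin_closedD hL (lin_closedD hL (LK _ (LO _ Xu1)) (LK _ (LO _ Xu1))) (LO _ Xu2)).
  congr (L2 _); apply/funext => x; rewrite /g2 (cderiv_real x dKO).
  rewrite (cderiv_real x (is_derive_weight_sqrt beta)).
  rewrite [LHS](_ : _ = (weight_rate' beta x)%:C * ((om x)%:C * u x) + (ka x)%:C * ((ka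
      x)%:C * ((om x)%:C * u x)) +
    ((ka x)%:C * ((om x)%:C * u1 x) + (ka x)%:C * ((om x)%:C * u1 x) + (om x)%:C * u2 x))//.
  rewrite [((ka * om) x)%:C](_ : _ = (ka x)%:C * (om x)%:C); last by rewrite -rmorphM.
  rewrite [((weight_rate' beta x + ka x ^+ 2) * om x)%:C](_ : _ =
    (weight_rate' beta x)%:C * (om x)%:C + (ka x)%:C * (ka x)%:C * (om x)%:C); last first.
    by apply: complexP; rewrite ?cReD ?cImD ?cReM ?cImM /=; ring.
  rewrite ?(rmorphM _ (ka x)).
  by ring.
- exact: v1.
- exact: cweak_deriv_comp v1 v2.
Qed.

End WeightTransfer.

(** * Factorization of the linearized operator *)

Section Factorization.
Variables (R : realType) (beta : R).
Hypothesis hbeta : 2 < beta.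
Local Notation C := ((R[i])^o).
Local Notation w := (weight beta).
Local Notation nu := (L2norm w).
Local Notation X := (L2 w).
Variables (h L dh : R -> R).
Hypotheses (hL : forall x : R, is_derive x 1 L (h x)) (sh : smooth h)
  (hdh : forall x : R, is_derive x 1 h (dh x)) (h01 : forall x, 0 <= h x <= 1).
Variables (p q : R[i]) (s d : R) (P V : R -> C) (Dm Dh : R).
Hypothesis dhB : forall x, `|dh x| <= Dh.
Hypotheses (d0 : 0 < d) (hp : complex.Re p <= - d) (hq : complex.Re (p + q) <= - d).
Let p2 : R[i] := - (s%:C + p).
Let q2 : R[i] := - q.
Hypotheses (hp2 : d <= complex.Re p2) (hq2 : d <= complex.Re (p2 + q2)).
Local Notation r := (front_rate h p q).
(** The zeroth-order term of (D + s + r)(D - r) is - (r' + s r + r^2), and r' = q dh. *)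
Hypothesis PV : forall x, P x = V x - (q * (dh x)%:C + s%:C * r x + r x ^+ 2).
Hypotheses (mV : cmeas V) (hV : forall x, N1 (V x) <= Dm).

Definition second_order_graph : set ((R -> C) * (R -> C)) :=
  [set u | H2 (weight_isometry beta u.1) /\
     exists u1 u2, [/\ weak_deriv 1 u.1 u1, weak_deriv 2 u.1 u2
       & u.2 = fun x => u2 x + s%:C * u1 x + P x * u.1 x]].

(* The operator factors as [(D + s + r) (D - r) + V]; these are the inverses of the factors. *)
Definition green1 : (R -> C) -> R -> C :=
  kop (fo_kernel true (front_exp L p q) (front_exp L (- p) (- q))).
Definition green2 : (R -> C) -> R -> C :=
  kop (fo_kernel false (front_exp L p2 q2) (front_exp L (- p2) (- q2))).

Let mw := measurable_weight beta.
Let w0 := weight_gt0 beta.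
Let w_ratio := weight_ratio hbeta.

Let decay1 : forall x y, side true x y != 0 ->
    N1 (front_exp L p q x * front_exp L (- p) (- q) y) <= 4 * ek d x y.
Proof. exact: (front_decay hL h01 (b := true) (conj hp hq)). Qed.

Let decay2 : forall x y, side false x y != 0 ->
    N1 (front_exp L p2 q2 x * front_exp L (- p2) (- q2) y) <= 4 * ek d x y.
Proof. exact: (front_decay hL h01 (b := false) (conj hp2 hq2)). Qed.

Lemma green1_kernel : exp_kernel 4 d (fo_kernel true (front_exp L p q) (front_exp L (- p) (- q))).
Proof.
by apply: (fo_exp_kernel _ _ _ d0 decay1) => //; exact: front_exp_csmooth.
Qed.

Lemma green2_kernel : exp_kernel 4 d (fo_kernel false (front_exp L p2 q2) (front_exp L (-
    p2) (- q2))).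
Proof.
by apply: (fo_exp_kernel _ _ _ d0 decay2) => //; exact: front_exp_csmooth.
Qed.

Lemma green1_L2 u : X u -> X (green1 u).
Proof. by move=> Xu; have [E _ /(_ u Xu)[]] := kop_L2 mw w0 w_ratio green1_kernel. Qed.

Lemma green2_L2 u : X u -> X (green2 u).
Proof. by move=> Xu; have [E _ /(_ u Xu)[]] := kop_L2 mw w0 w_ratio green2_kernel. Qed.

Lemma green1_weak_deriv f : X f ->
  weak_deriv 1 (green1 f) (fun x => r x * green1 f x + f x).
Proof.
move=> Xf; apply: (fo_weak_deriv mw w0 w_ratio (rho := r) _ _ _ _ _ d0 decay1 Xf) => //.
- exact: front_exp_csmooth.
- exact: front_exp_csmooth.
- exact: front_expV.
- exact: front_exp_cderiv.
Qed.

Lemma green2_weak_deriv f : X f ->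
  weak_deriv 1 (green2 f) (fun x => front_rate h p2 q2 x * green2 f x + f x).
Proof.
move=> Xf; apply: (fo_weak_deriv mw w0 w_ratio (rho := front_rate h p2 q2) _ _ _ _ _ d0
    decay2 Xf) => //.
- exact: front_exp_csmooth.
- exact: front_exp_csmooth.
- exact: front_expV.
- exact: front_exp_cderiv.
Qed.

Lemma green1_inverse u f : X u -> X f -> weak_deriv 1 u (fun x => r x * u x + f x) ->
  null_space X nu (u - green1 f).
Proof.
move=> Xu Xf; apply: (fo_inverse mw w0 w_ratio (rho := r) _ _ _ _ _ _ d0 decay1 Xu Xf) => //.
- exact: front_exp_csmooth.
- exact: front_exp_csmooth.
- exact: front_expV.
- exact: front_exp_cderiv.
- exact: front_expN_cderiv.
Qed.

Lemma green2_inverse u f : X u -> X f ->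
  weak_deriv 1 u (fun x => front_rate h p2 q2 x * u x + f x) ->
  null_space X nu (u - green2 f).
Proof.
move=> Xu Xf; apply: (fo_inverse mw w0 w_ratio (rho := front_rate h p2 q2) _ _ _ _ _ _ d0
    decay2 Xu Xf) => //.
- exact: front_exp_csmooth.
- exact: front_exp_csmooth.
- exact: front_expV.
- exact: front_exp_cderiv.
- exact: front_expN_cderiv.
Qed.

Lemma front_rate2 x : front_rate h p2 q2 x = - (s%:C + r x).
Proof. by rewrite /front_rate /p2 /q2; ring. Qed.

Lemma front_rate_csmooth : csmooth r.
Proof.
have E t1 t2 : smooth (fun x => t1 + t2 * h x) by exact: smooth_lin_rate.
split.
  have := E (complex.Re p) (complex.Re q); congr smooth; apply/funext => x.
  by rewrite /front_rate cReD cReM /= mulr0 subr0.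
have := E (complex.Im p) (complex.Im q); congr smooth; apply/funext => x.
by rewrite /front_rate cImD cImM /= mulr0 add0r.
Qed.

Lemma front_rate_cderiv x : cderiv r x = q * (dh x)%:C.
Proof.
have E t1 t2 : derive1 (fun x => t1 + t2 * h x) x = t2 * dh x.
  have -> // : derive1 (fun x => t1 + t2 * h x) = (fun x => t2 * dh x).
  apply: is_derive_derive1E => y.
  have h2 := is_deriveD (is_derive_cst t1 (y : R) 1) (@is_deriveZ R R R h t2 y 1 (dh y) (hdh y)).
  by apply: (is_derive_eq h2); rewrite add0r.
apply: complexP; rewrite ?cReM ?cImM /= mulr0 ?subr0 ?addr0.
  rewrite -(E (complex.Re p)); congr (derive1 _ _); apply/funext => y.
  by rewrite /front_rate cReD cReM /= mulr0 subr0.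
rewrite add0r -(E (complex.Im p)); congr (derive1 _ _); apply/funext => y.
by rewrite /front_rate cImD cImM /= mulr0 add0r.
Qed.

Lemma front_rate_bound x : N1 (r x) <= N1 p + N1 q.
Proof.
apply: (le_trans (N1D _ _)); rewrite lerD2l.
apply: (le_trans (N1M _ _)); rewrite N1_real ler_piMr ?N1_ge0//.
by have /andP[h0 h1] := h01 x; rewrite ger0_norm.
Qed.

Let hX := L2_lin_closed mw w0.

Lemma rate_L2 u : X u -> X (mop r u).
Proof.
apply: (mop_L2 mw w0 _ front_rate_bound); exact: csmooth_cmeas front_rate_csmooth.
Qed.

Lemma potential_L2 u : X u -> X (mop V u).
Proof. exact: mop_L2. Qed.

(** Two successive first-order problems: y = u' - r u satisfies y' + (s + r) y = v - V u, which
    determines y up to null sets, and then u' - r u = y determines u. *)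
Lemma graph_inverse u v : second_order_graph (u, v) ->
  X u /\ (X v -> null_space X nu (u - green1 (green2 (v - mop V u)))).
Proof.
move=> [/= Hu [u1 [u2 [w1 w2 vE]]]].
have [Xu Xu1] := H2_weight_deriv hbeta Hu w1.
split => // Xv; have w12 := cweak_deriv_succ w1 w2.
pose y : R -> C := u1 - mop r u.
have Xy : X y by apply: lin_closedB => //; exact: rate_L2.
have Xf : X (v - mop V u) by apply: lin_closedB => //; exact: potential_L2.
have ny : null_space X nu (y - green2 (v - mop V u)).
  apply: green2_inverse => //.
  have := cweak_derivB w12 (cweak_deriv_mul front_rate_csmooth w1).
  congr (weak_deriv 1); apply/funext => x.
  rewrite [(v - _) x](_ : _ = v x - V x * u x)// vE PV front_rate2 front_rate_cderiv.
  by rewrite [y x](_ : _ = u1 x - r x * u x)//; ring.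
have nu1 : null_space X nu (u - green1 y).
  apply: green1_inverse => //; move: w1; congr (weak_deriv 1); apply/funext => x.
  by rewrite [y x](_ : _ = u1 x - r x * u x)// addrC subrK.
have Xg2 := green2_L2 Xf.
have e1 : green1 (y - green2 (v - mop V u)) = 0.
  exact: (kop_null mw w0 green1_kernel ny).
have := lin_onB hX (kop_lin mw w0 w_ratio green1_kernel) Xy Xg2.
by rewrite -/green1 e1 => /esym/eqP; rewrite subr_eq0 => /eqP <-.
Qed.

Lemma graph_member g : X g ->
  second_order_graph (green1 (green2 g), g + mop V (green1 (green2 g))).
Proof.
move=> Xg; set f := green2 g; set u := green1 f.
have Xf : X f by exact: green2_L2.
have Xu : X u by exact: green1_L2.
have w1 := green1_weak_deriv Xf; rewrite -/u in w1.
have wf := green2_weak_deriv Xg; rewrite -/f in wf.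
pose u1 : R -> C := fun x => r x * u x + f x; rewrite -/u1 in w1.
have w2 := cweak_derivD (cweak_deriv_mul front_rate_csmooth w1) wf.
set u2 := (X in weak_deriv 1 _ X) in w2; rewrite -/u1 in w2.
have Xu1 : X u1 by exact: (lin_closedD hX (rate_L2 Xu) Xf).
have E x : u2 x = (g x + V x * u x) - s%:C * u1 x - P x * u x.
  by rewrite /u2 /u1 front_rate_cderiv front_rate2 PV; ring.
(* In the derivative of u1 = r u + f, replacing f' by g - (s + r) f leaves g and bounded multiples
   of vectors of X. *)
have Xu2 : X u2.
  have -> : u2 = (q : R[i]) *: mop (fun x =>
      (dh x)%:C : C) u + mop r u1 - (s%:C *: f + mop r f) + g.
    by apply/funext => x; rewrite [RHS](_ : _ = q * ((dh x)%:C * u x) + r x * u1 x - (s%:C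
        * f x + r x * f x) + g x)// /u2 front_rate_cderiv front_rate2; ring.
  have Xdh : X (mop (fun x => (dh x)%:C : C) u).
    apply: (mop_L2 mw w0 (Dm := Dh)) => // [|x]; last by rewrite N1_real.
    apply: csmooth_cmeas; apply: csmooth_real.
    by rewrite -(is_derive_derive1E hdh); exact: smooth_deriv.
  apply: lin_closedD => //; apply: (lin_closedB hX).
    exact: (lin_closedD hX (lin_closedZ q hX Xdh) (rate_L2 Xu1)).
  exact: (lin_closedD hX (lin_closedZ _ hX Xf) (rate_L2 Xf)).
split => /=; first exact: (H2_weight hbeta Xu Xu1 Xu2 w1 w2).
exists u1, u2; split => //; first exact: cweak_deriv_comp w1 w2.
apply/funext => x; rewrite [LHS](_ : _ = g x + V x * u x)// E; ring.
Qed.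

End Factorization.

(** * Splitting into a contraction and a finite-rank operator *)

Section Splitting.
Variable R : realType.
Local Notation mu := (@lebesgue_measure R).
Local Notation intg f := (mu.-integrable setT (EFin \o f)).
Local Notation C := ((R[i])^o).
Variable w : R -> R.
Hypotheses (mw : measurable_fun setT w) (w0 : forall x, 0 < w x) (iw : intg w).
Hypothesis w_ratio : forall d, 0 < d ->
  exists2 D, 0 <= D & forall x y, w x * ek d x y <= D * w y.
Local Notation nu := (L2norm w).
Local Notation X := (L2 w).
Local Notation BM := (@bounded_meas R).
Variables (E F : R -> C) (k2 : R -> R -> C) (D d : R).
Hypotheses (sE : csmooth E) (sF : csmooth F) (EF : forall x, E x * F x = 1).
Hypotheses (D0 : 0 <= D) (d0 : 0 < d).
Hypothesis decay : forall x y, side true x y != 0 -> N1 (E x * F y) <= D * ek d x y.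
Hypothesis hk2 : exp_kernel D d k2.
Variables (V : R -> C) (K a : R).
Hypotheses (mV : cmeas V) (K0 : 0 <= K) (a0 : 0 < a).
Hypothesis hV : forall x, N1 (V x) <= K * ek a 0 x.
Local Notation G1 := (kop (fo_kernel true E F)).
Local Notation G2 := (kop k2).

Let hk1 : exp_kernel D d (fo_kernel true E F) := fo_exp_kernel sE sF D0 d0 decay.
Let BMX : BM `<=` X := bounded_meas_L2 mw w0 iw.
Let hBM := @bounded_meas_lin_closed R.
Let hX := L2_lin_closed mw w0.
Let G1lin := kop_lin mw w0 w_ratio hk1.
Let G2lin := kop_lin mw w0 w_ratio hk2.

Let V_le x : N1 (V x) <= K.
Proof. by apply: (le_trans (hV x)); rewrite ler_piMr// ek_le1. Qed.

Lemma cint0 : cint (fun _ : R => 0 : C) = 0.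
Proof. by apply: complexP; rewrite /= /Rintegral integral0. Qed.

(* [G1 k / E] is a primitive of [F k], so it varies slowly on short intervals. *)
Lemma green_step k B x y : BM k -> (forall x, N1 (k x) <= B) -> y <= x ->
  N1 (G1 k x - E x * (F y * G1 k y)) <= D * B * (x - y).
Proof.
move=> Bk kB yx; have Xk := BMX Bk; have [mk _] := Bk.
have B0 : 0 <= B by exact: le_trans (N1_ge0 _) (kB 0).
have [-> ix] := fo_kopE mw w0 w_ratio sE sF EF D0 d0 decay x Xk.
have [-> iy] := fo_kopE mw w0 w_ratio sE sF EF D0 d0 decay y Xk.
set fx := (X in cintg X) in ix; set fy := (X in cintg X) in iy.
have i0 : cintg (fun _ : R => 0 : C) by split; exact: integrable0.
have i1 := cintg_lin (-1) iy ix; have e1 := cint_lin (-1) iy ix.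
have := cint_lin (E x) i1 i0; rewrite e1 cint0 addr0 => e2.
have -> : E x * cint fx - E x * (F y * (E y * cint fy)) =
   E x * (-1 * cint fy + cint fx).
  by rewrite [F y * _]mulrA [F y * E y]mulrC EF mul1r; ring.
rewrite -e2.
pose S := `]y, x]%classic : set R.
have mS : measurable S by exact: measurable_itv.
have i1S : intg (\1_S : R -> R) by exact: (integrable_indic_itv y x false false).
have iS := intgZ measurableT (D * B) i1S.
apply: (le_trans (cint_le_dom _ iS _)).
- have [mE mF] := (csmooth_cmeas sE, csmooth_cmeas sF).
  have ms t : cmeas (fun z => (side true t z)%:C : C).
    split; last exact: measurable_cst.
    exact: (measurableT_comp (measurable_side true) (@measurable_pair1 _ _ _ _ t)).
  apply: cmeasD; last exact: cmeas_cst.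
  apply: cmeasM; first exact: cmeas_cst.
  apply: cmeasD; last by apply: cmeasM => //; exact: cmeasM.
  apply: cmeasM; first exact: cmeas_cst.
  by apply: cmeasM => //; exact: cmeasM.
- move=> z; rewrite addr0 indicE.
  have -> : E x * (-1 * fy z + fx z) =
      (side true x z - side true y z)%:C * ((E x * F z) * k z).
    by rewrite /fx /fy rmorphB; ring.
  have [zx|zx] := leP z x; last first.
    have -> : side true x z - side true y z = 0.
      by rewrite /side !leNgt zx (le_lt_trans yx zx)/= subrr.
    by rewrite mul0r N1_0 mulr_ge0// mulr_ge0.
  have [zy|zy] := leP z y.
    have -> : side true x z - side true y z = 0 by rewrite /side zx zy subrr.
    by rewrite mul0r N1_0 mulr_ge0// mulr_ge0.
  have -> : side true x z - side true y z = 1.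
    by rewrite /side zx leNgt zy subr0.
  rewrite mul1r mem_set ?mulr1; last by rewrite /S/= in_itv/= zy.
  apply: (le_trans (N1M _ _)); apply: ler_pM => //; try exact: N1_ge0.
  apply: (le_trans (decay _)); first by rewrite /side zx oner_neq0.
  by rewrite ler_piMr// ek_le1.
- rewrite (RintegralZl _ measurableT i1S) ler_wpM2l ?mulr_ge0//.
  rewrite /Rintegral integral_indic// setIT [X in fine X](_ : _ = (x - y)%:E)//.
  rewrite [LHS](_ : _ = mu S)// /S lebesgue_measure_itv/= lte_fin.
  by case: ltP => // xy; have -> : x = y; [apply/le_anti; rewrite xy yx|rewrite subrr].
Qed.

Section Grid.
Variable M : nat.
Hypothesis M0 : (0 < M)%N.
(** The number of cells of length 1 / M that cover [-M, M): a single parameter both enlarges the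
    window and refines the mesh. *)
Let N := (2 * M ^ 2)%N.

Definition cell (j : nat) (x : R) : bool := j%:R <= (x + M%:R) * M%:R < j.+1%:R.
Definition node (j : nat) : R := j%:R / M%:R - M%:R.

Let Mp : 0 < M%:R :> R. Proof. by rewrite ltr0n. Qed.

Lemma cell_node j x : cell j x -> node j <= x /\ x - node j <= M%:R^-1.
Proof.
move=> /andP[h1 h2]; rewrite /node; split.
  by rewrite lerBlDr ler_pdivrMr.
have e : M%:R^-1 + j%:R / M%:R = j.+1%:R / M%:R :> R.
  by rewrite -natr1 mulrDl mul1r addrC.
by rewrite opprB addrA lerBlDr e ler_pdivlMr// ltW.
Qed.

Lemma cell_uniq i j x : cell i x -> cell j x -> i = j.
Proof.
move=> /andP[h1 h2] /andP[h3 h4]; apply/eqP; rewrite eqn_leq -ltnS -(ltnS j).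
by rewrite -!(ltr_nat R) (le_lt_trans h1 h4) (le_lt_trans h3 h2).
Qed.

Lemma cell_exists x : - M%:R <= x -> x < M%:R -> exists j : 'I_N, cell j x.
Proof.
move=> h1 h2; have y0 : 0 <= (x + M%:R) * M%:R.
  by rewrite mulr_ge0// -lerBlDr sub0r.
have /andP[t1 t2] := Num.Theory.truncn_itv y0.
suff lt : (Num.truncn ((x + M%:R) * M%:R) < N)%N.
  by exists (Ordinal lt); rewrite /cell t1 t2.
rewrite -(ltr_nat R); apply: (le_lt_trans t1).
by rewrite /N natrM natrX expr2 mulrA ltr_pM2r// mulr_natl mulr2n ltrD2r.
Qed.

Lemma cell_range j x : (j < N)%N -> cell j x -> `|x| <= M%:R.
Proof.
move=> jN /andP[h1 h2]; rewrite ler_norml; apply/andP; split.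
  rewrite -[- _]add0r lerBlDr; have : 0 <= (x + M%:R) * M%:R by exact: le_trans h1.
  by rewrite pmulr_lge0.
have : (x + M%:R) * M%:R < N%:R by apply: (lt_le_trans h2); rewrite ler_nat.
rewrite /N natrM natrX expr2 mulrA ltr_pM2r// mulr_natl mulr2n ltrD2r.
exact: ltW.
Qed.

Definition cell_exp (j : nat) : R -> C := fun x => (cell j x)%:R%:C * E x.
(** As [F] is the inverse of [E], these are the values at the nodes of the primitive G1 k / E. *)
Definition grid_coord (k : R -> C) : 'rV[R[i]]_N :=
  \row_j (F (node j) * G1 k (node j) : R[i]).
Definition grid_vec (j : 'I_N) : R -> C := G2 (mop V (cell_exp j)).

Lemma cell_exp_bounded (j : 'I_N) : BM (cell_exp j).
Proof.
have [e1 e2] := sE; split.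
  apply: cmeasM; last exact: csmooth_cmeas.
  split; last exact: measurable_cst.
  have -> : (fun x => complex.Re ((cell j x)%:R%:C : C)) =
      \1_([set x | j%:R <= (x + M%:R) * M%:R] `&` [set x | (x + M%:R) * M%:R < j.+1%:R]).
    apply/funext => x; rewrite indicE/= /cell; congr (_%:R).
    have [/andP[h1 h2]|hn] := boolP (_ && _); first by rewrite mem_set.
    by rewrite memNset//= => -[h1 h2]; move: hn; rewrite h1 h2.
  apply: measurable_indic.
  have mf : measurable_fun setT (fun x : R => (x + M%:R) * M%:R).
    by apply: measurable_funM => //; apply: measurable_funD.
  apply: measurableI.
    rewrite -[X in measurable X]setTI; exact: measurable_fun_ler.
  rewrite -[X in measurable X]setTI; exact: measurable_fun_ltr.
have [B1 B10 h1] := continuous_bounded_segment M%:R (smooth_continuous e1).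
have [B2 B20 h2] := continuous_bounded_segment M%:R (smooth_continuous e2).
exists (B1 + B2) => x; rewrite /cell_exp; have [cx|cx] := boolP (cell j x).
  by rewrite mul1r lerD// ?h1 ?h2//; exact: cell_range cx.
by rewrite mul0r N1_0 addr_ge0.
Qed.

Let VE_bounded (j : 'I_N) : BM (mop V (cell_exp j)).
Proof. exact: (mop_bounded_meas mV V_le (cell_exp_bounded j)). Qed.

Lemma grid_vec_bounded j : BM (grid_vec j).
Proof. exact: (kop_bounded_meas hk2 (VE_bounded j)). Qed.

Lemma grid_coord_lin : lin_on BM grid_coord.
Proof.
move=> c u v Bu Bv; apply/rowP => j; rewrite !mxE.
rewrite (G1lin c (BMX Bu) (BMX Bv)).
by rewrite [(_ + _) (node j)](_ : _ = c * G1 u (node j) + G1 v (node j))//; ring.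
Qed.

(** Replaces G1 k by E times the value of G1 k / E at the left node of each cell, and by 0 outside
    [-M, M). *)
Definition grid_sum k : R -> C := \sum_(j < N) grid_coord k ord0 j *: cell_exp j.

Lemma grid_sum_bounded k : BM (grid_sum k).
Proof.
by apply: lin_closed_sum => // j; apply: lin_closedZ => //; exact: cell_exp_bounded.
Qed.

Lemma grid_sumE k x : grid_sum k x =
  \sum_(j < N) grid_coord k ord0 j * ((cell j x)%:R%:C * E x).
Proof. by rewrite /grid_sum fct_sumE. Qed.

Lemma grid_remainder k : BM k ->
  G2 (mop V (G1 k)) - \sum_(j < N) grid_coord k ord0 j *: grid_vec j =
  G2 (mop V (G1 k - grid_sum k)).
Proof.
move=> Bk; have BG : BM (G1 k) := kop_bounded_meas hk1 Bk.
have BV u : BM u -> BM (mop V u) by move=> Bu; exact: (mop_bounded_meas mV V_le Bu).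
have Bs := grid_sum_bounded k.
rewrite (lin_onB hBM (@mop_lin _ V BM) BG Bs).
rewrite (lin_onB hX G2lin (BMX (BV _ BG)) (BMX (BV _ Bs))); congr (_ - _).
rewrite /grid_sum (lin_on_sum hBM (@mop_lin _ V BM)); last first.
  by move=> j; apply: lin_closedZ => //; exact: cell_exp_bounded.
rewrite (lin_on_sum hX G2lin); last first.
  move=> j; apply/BMX/BV; apply: lin_closedZ => //; exact: cell_exp_bounded.
apply: eq_bigr => j _.
rewrite (lin_onZ hBM (@mop_lin _ V BM) _ (cell_exp_bounded j)).
by rewrite (lin_onZ hX G2lin _ (BMX (VE_bounded j))).
Qed.

(** Inside the window N1 (V x) <= K and [green_step] over a cell gives D B / M. Outside, G1 k is
    only bounded, by D (2 / d) B, but N1 (V x) <= K exp (- a M) <= K / (a M). The stated constant is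
    the sum of both bounds. *)
Lemma grid_remainder_le k B x : BM k -> (forall x, N1 (k x) <= B) ->
  N1 (mop V (G1 k - grid_sum k) x) <= K * D * (1 + 2 / (d * a)) / M%:R * B.
Proof.
move=> Bk kB; have B0 : 0 <= B by exact: le_trans (N1_ge0 _) (kB 0).
have da0 : 0 < d * a by exact: mulr_gt0.
have M1 : 0 <= M%:R^-1 :> R by rewrite invr_ge0 ltW.
rewrite /mop (_ : (G1 k - grid_sum k) x = G1 k x - grid_sum k x)//.
apply: (le_trans (N1M _ _)); rewrite grid_sumE.
have [/andP[x1 x2]|xo] := boolP (- M%:R <= x < M%:R).
  have [j cj] := cell_exists x1 x2.
  rewrite (bigD1 j)//= cj big1 ?addr0; last first.
    move=> i ij; have [ci|_] := boolP (cell i x); last by rewrite mul0r mulr0.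
    by case/eqP: ij; apply/val_inj; exact: cell_uniq ci cj.
  rewrite mul1r mxE [_ * E x]mulrC.
  have [n1 n2] := cell_node cj.
  have h := green_step Bk kB n1.
  apply: (le_trans (ler_pM (N1_ge0 _) (N1_ge0 _) (V_le x) h)).
  have -> : K * D * (1 + 2 / (d * a)) / M%:R * B =
    K * (D * B * M%:R^-1) + K * D * (2 / (d * a)) / M%:R * B by ring.
  rewrite -[leLHS]addr0 lerD//; first by rewrite ler_wpM2l// ler_wpM2l// mulr_ge0.
  by rewrite !mulr_ge0// invr_ge0 ltW.
rewrite big1 ?subr0; last first.
  move=> j _; have [cj|_] := boolP (cell j x); last by rewrite mul0r mulr0.
  case/negP: xo; move: cj (ltn_ord j) => /andP[h1 h2] jN.
  apply/andP; split.
    rewrite -[- _]add0r lerBlDr; have : 0 <= (x + M%:R) * M%:R by exact: le_trans h1.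
    by rewrite pmulr_lge0.
  have : (x + M%:R) * M%:R < N%:R by apply: (lt_le_trans h2); rewrite ler_nat.
  by rewrite /N natrM natrX expr2 mulrA ltr_pM2r// mulr_natl mulr2n ltrD2r.
have [mk _] := Bk; have hG := kop_bounded hk1 mk kB x.
have xM : M%:R <= `|x|.
  move: xo; rewrite negb_and -ltNge -leNgt => /orP[xM|xM].
    have xn : x < 0 by apply: (lt_trans xM); rewrite oppr_lt0.
    by rewrite (ltr0_norm xn) lerNr; exact: ltW.
  by rewrite (ger0_norm (le_trans (ltW Mp) xM)).
have e : ek a 0 x <= (a * M%:R)^-1.
  rewrite /ek sub0r normrN mulNr expRN lef_pV2 ?posrE ?expR_gt0 ?mulr_gt0//.
  apply: le_trans (expR_ge1Dx _); rewrite -[leLHS]add0r lerD//.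
  by rewrite ler_pM2l.
have hVx : N1 (V x) <= K * (a * M%:R)^-1.
  by apply: (le_trans (hV x)); rewrite ler_wpM2l.
apply: (le_trans (ler_pM (N1_ge0 _) (N1_ge0 _) hVx hG)).
have -> : K * (a * M%:R)^-1 * (D * (2 / d) * B) = K * D * (2 / (d * a)) / M%:R * B.
  by field; rewrite !gt_eqF.
by rewrite ler_wpM2r// ler_wpM2r// ler_wpM2l ?mulr_ge0// lerDr.
Qed.

End Grid.

Lemma finite_rank_splitting : exists N (l : (R -> C) -> 'rV[R[i]]_N)
    (b : 'I_N -> R -> C) (J : (R -> C) -> R -> C),
  let S k := G2 (mop V (G1 k)) - \sum_(j < N) l k ord0 j *: b j in
  [/\ lin_on BM l, forall j, BM (b j), forall h, BM h -> BM (J h) &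
    [/\ forall h, BM h -> J h + S (J h) = h, forall k, BM k -> J (k + S k) = k
    & exists B, 0 <= B /\ forall v j, X v ->
        N1 (l (J (G2 (mop V (G1 (G2 v))))) ord0 j) <= B * nu v]].
Proof.
pose c := D * (2 / d) * (K * D * (1 + 2 / (d * a))).
have da0 : 0 < d * a by exact: mulr_gt0.
have c0 : 0 <= c.
  by rewrite /c !mulr_ge0// ?addr_ge0// ?divr_ge0// ?invr_ge0 ltW.
(* [grid_remainder_le] followed by the bound D (2 / d) for [G2] makes the norm of [S] at most c / M,
   so that M > 2 c gives the factor 1/2. *)
pose M := (Num.truncn (2 * c)).+1.
have M0 : (0 < M)%N by [].
have cM : c / M%:R <= 1 / 2.
  have c20 : 0 <= 2 * c by rewrite mulr_ge0.
  have /andP[_ lt] := Num.Theory.truncn_itv c20.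
  rewrite ler_pdivrMr ?ltr0n// mul1r mulrC ler_pdivlMr// mulrC.
  exact: ltW.
exists (2 * M ^ 2)%N, (@grid_coord M), (@grid_vec M).
set S := (fun k : R -> C => G2 (mop V (G1 k)) - \sum_(j < 2 * M ^ 2) grid_coord M k ord0 j
    *: grid_vec j).
have mopVB u : BM u -> BM (mop V u) by move=> Bu; exact: (mop_bounded_meas mV V_le Bu).
have SE k : BM k -> S k = G2 (mop V (G1 k - grid_sum M k)) by exact: grid_remainder.
have GB k : BM k -> BM (G1 k) by move=> Bk; exact: (kop_bounded_meas hk1 Bk).
have RB k : BM k -> BM (mop V (G1 k - grid_sum M k)).
  by move=> Bk; apply: mopVB; apply: lin_closedB => //; [exact: GB|exact: grid_sum_bounded].
have BMS k : BM k -> BM (S k).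
  by move=> Bk; rewrite SE//; exact: (kop_bounded_meas hk2 (RB _ Bk)).
have Slin : lin_on BM S.
  move=> e u v Bu Bv; rewrite /S (G1lin e (BMX Bu) (BMX Bv)).
  rewrite (@mop_lin _ V BM e _ _ (GB _ Bu) (GB _ Bv)).
  rewrite (G2lin e (BMX (mopVB _ (GB _ Bu))) (BMX (mopVB _ (GB _ Bv)))).
  rewrite (grid_coord_lin M e Bu Bv).
  under eq_bigr do rewrite mxE mxE scalerDl -scalerA.
  by rewrite big_split -scaler_sumr /= scalerBr opprD addrACA.
have Shalf k B : BM k -> (forall x, N1 (k x) <= B) -> forall x, N1 (S k x) <= B / 2.
  move=> Bk kB x; rewrite SE//; have [mR _] := RB _ Bk.
  have B0 : 0 <= B by exact: le_trans (N1_ge0 _) (kB 0).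
  apply: (le_trans (kop_bounded hk2 mR (fun y => grid_remainder_le M0 y Bk kB) x)).
  have -> : D * (2 / d) * (K * D * (1 + 2 / (d * a)) / M%:R * B) = c / M%:R * B.
    by rewrite /c; ring.
  by rewrite [leRHS]mulrC -[2^-1]mul1r; exact: ler_wpM2r.
have BMlim (f_ : nat -> R -> C) f B : (forall n, BM (f_ n)) ->
    (forall n x, N1 (f_ n x - f x) <= B / 2 ^+ n) -> BM f.
  move=> hf hB; split; first by apply: (cmeas_limit (f_ := f_) (B := B)) => // n; have [] := hf n.
  have [_ [B1 hB1]] := hf 0; exists (B1 + B) => x.
  rewrite -[f x](subKr (f_ 0 x)); apply: (le_trans (N1B _ _)); rewrite lerD//.
  by have := hB 0 x; rewrite expr0 divr1.
have [J [JB JK KJ Jle]] := contraction_inverse hBM Slin (fun k Bk => Bk.2) BMlim BMS Shalf.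
exists J; split => //; first exact: grid_coord_lin; first exact: grid_vec_bounded.
split => //.
have [Cw Cw0 hCw] := w_ratio a0.
have hVw x : N1 (V x) <= K * (Cw / w 0) * w x.
  apply: (le_trans (hV x)); rewrite -mulrA ler_wpM2l//.
  rewrite mulrAC ler_pdivlMr// mulrC; exact: hCw.
have Kw0 : 0 <= K * (Cw / w 0) by rewrite mulr_ge0// divr_ge0// ltW.
have [E1 E10 h1] := kop_mop_bound mw w0 iw hk2 mV Kw0 hVw.
have [E2 E20 h2] := kop_L2 mw w0 w_ratio hk1.
have [E3 E30 h3] := kop_L2 mw w0 w_ratio hk2.
have D20 : 0 <= D * (2 / d) by rewrite mulr_ge0// divr_ge0// ltW.
(* E1 E2 E3 bounds G2 V G1 G2 from X to bounded functions, 4 bounds [J], D (2 / d) bounds [G1], and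
   F at the node comes from the coordinate; the sum over j makes the bound independent of j. *)
exists (\sum_(j < 2 * M ^ 2) N1 (F (node M j)) * (D * (2 / d) * (4 * (E1 * (E2 * E3))))).
have T0 : 0 <= D * (2 / d) * (4 * (E1 * (E2 * E3))).
  by apply: (mulr_ge0 D20); rewrite !mulr_ge0.
split=> [|v j Xv]; first by apply: sumr_ge0 => j _; rewrite mulr_ge0 ?N1_ge0.
have [X3 n3] := h3 v Xv; have [X2 n2] := h2 _ X3.
have bd x : N1 (G2 (mop V (G1 (G2 v))) x) <= E1 * (E2 * E3) * nu v.
  apply: (le_trans (h1 _ X2 x)); rewrite -mulrA ler_wpM2l// -mulrA.
  by apply: (le_trans n2); rewrite ler_wpM2l.
have BG : BM (G2 (mop V (G1 (G2 v)))).
  split; last by exists (E1 * (E2 * E3) * nu v).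
  by apply: (kop_meas hk2); apply: cmeasM => //; have [] := (L2P mw w0 _).1 X2.
have [mJ _] := JB _ BG.
have hJ := kop_bounded hk1 mJ (Jle _ _ BG bd) (node M j).
rewrite mxE; apply: (le_trans (N1M _ _)).
set T := D * (2 / d) * _ in T0 *.
have le1 : N1 (F (node M j)) * T <= \sum_(j < 2 * M ^ 2) N1 (F (node M j)) * T.
  rewrite (bigD1 j)//= lerDl; apply: sumr_ge0 => i _; exact: mulr_ge0 (N1_ge0 _) T0.
apply: le_trans (ler_wpM2r (L2norm_ge0 _ _) le1).
rewrite -mulrA ler_wpM2l ?N1_ge0//; apply: (le_trans hJ).
by rewrite /T le_eqVlt; apply/orP; left; apply/eqP; ring.
Qed.

End Splitting.

Section SecondOrderFredholm.
Variables (R : realType) (beta : R).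
Hypothesis hbeta : 2 < beta.
Local Notation C := ((R[i])^o).
Local Notation w := (weight beta).
Local Notation nu := (L2norm w).
Local Notation X := (L2 w).
Variables (h L dh : R -> R).
Hypotheses (hL : forall x : R, is_derive x 1 L (h x)) (sh : smooth h)
  (hdh : forall x : R, is_derive x 1 h (dh x)) (h01 : forall x, 0 <= h x <= 1).
Variables (p q : R[i]) (s d : R) (P V : R -> C) (Dh K a : R).
Hypotheses (dhB : forall x, `|dh x| <= Dh) (d0 : 0 < d).
Hypotheses (hp : complex.Re p <= - d) (hq : complex.Re (p + q) <= - d).
Hypotheses (hp2 : d <= complex.Re (- (s%:C + p))) (hq2 : d <= complex.Re (- (s%:C + p) - q)).
Hypothesis PV : forall x, P x = V x -
  (q * (dh x)%:C + s%:C * front_rate h p q x + front_rate h p q x ^+ 2).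
Hypotheses (mV : cmeas V) (K0 : 0 <= K) (a0 : 0 < a).
Hypothesis hV : forall x, N1 (V x) <= K * ek a 0 x.

Lemma second_order_fredholm :
  (exists n, fredholm_with X nu (second_order_graph beta s P) n n) /\
  forall k, fredholm_index X nu (second_order_graph beta s P) k -> k = 0.
Proof.
have mw := measurable_weight beta; have w0 := weight_gt0 beta.
have w_ratio := weight_ratio hbeta; have iw := intg_weight hbeta.
have V_le x : N1 (V x) <= K by apply: (le_trans (hV x)); rewrite ler_piMr// ek_le1.
have k1 := green1_kernel hL sh h01 d0 hp hq.
have k2 := green2_kernel hL sh h01 d0 hp2 hq2.
have hX := L2_lin_closed mw w0.
have decay1 := fun x y => @front_decay _ _ _ hL h01 true _ _ _ (conj hp hq) x y.
have [N [l [b [J [ll Bb JB [JK KJ lJ]]]]]] := finite_rank_splitting mw w0 iw w_ratio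
  (front_exp_csmooth hL sh p q) (front_exp_csmooth hL sh (- p) (- q))
  (front_expV L p q) (ler0n _ 4) d0 decay1 k2 mV K0 a0 hV.
have BMX := bounded_meas_L2 mw w0 iw.
have [Cw Cw0 hCw] := w_ratio _ a0.
(* An exponentially decaying potential is dominated by the polynomial weight, as [kop_mop_bound]
   requires. *)
have hVw x : N1 (V x) <= K * (Cw / w 0) * w x.
  apply: (le_trans (hV x)); rewrite -mulrA ler_wpM2l//.
  rewrite mulrAC ler_pdivlMr// mulrC; exact: hCw.
have Kw0 : 0 <= K * (Cw / w 0) by rewrite mulr_ge0// divr_ge0// ltW.
have BMG2m u : X u -> bounded_meas (green2 L p q s (mop V u)).
  move=> Xu; have [E _ hE] := kop_mop_bound mw w0 iw k2 mV Kw0 hVw.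
  split; last by exists (E * nu u) => x; exact: hE.
  by apply: (kop_meas k2); apply: cmeasM => //; have [] := (L2P mw w0 _).1 Xu.
have hyps := (@abstract_fredholm _ _ X nu (second_order_graph beta s P) (@bounded_meas R)
  (green1 L p q) (green2 L p q s) (mop V) hX (L2_null_lin_closed mw w0)
  (@bounded_meas_lin_closed R) BMX (kop_lin mw w0 w_ratio k1) (kop_lin mw w0 w_ratio k2)
  (@mop_lin _ V X) (green1_L2 hbeta hL sh h01 d0 hp hq) (green2_L2 hbeta hL sh h01 d0 hp2 hq2)
  (potential_L2 mV V_le) BMG2m (fun u nu0 => kop_null mw w0 k2 nu0)
  (fun u => mop_null mw w0 mV (f := u))).
have gi := graph_inverse hbeta hL sh hdh h01 d0 hp hq hp2 hq2 PV mV V_le.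
have gm := graph_member hbeta hL sh hdh h01 dhB d0 hp hq hp2 hq2 PV.
split; first exact: (hyps gi gm N l b J ll Bb JB JK KJ lJ).
exact: (@abstract_index _ _ X nu (second_order_graph beta s P) (@bounded_meas R)
  (green1 L p q) (green2 L p q s) (mop V) hX (L2_null_lin_closed mw w0)
  (@bounded_meas_lin_closed R) BMX (kop_lin mw w0 w_ratio k1) (kop_lin mw w0 w_ratio k2)
  (@mop_lin _ V X) (green1_L2 hbeta hL sh h01 d0 hp hq) (green2_L2 hbeta hL sh h01 d0 hp2 hq2)
  (potential_L2 mV V_le) BMG2m (fun u nu0 => kop_null mw w0 k2 nu0)
  (fun u => mop_null mw w0 mV (f := u)) gi gm N l b J ll Bb JB JK KJ lJ).
Qed.

End SecondOrderFredholm.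

(** * The front *)

Section Logistic.
Variables (R : realType) (a : R).
Hypothesis a0 : 0 < a.

Definition logistic (x : R) : R := (1 + expR (- (a * x)))^-1.
Definition logistic_prim (x : R) : R := x - ln (logistic x) / a.

Let den_gt0 (x : R) : 0 < 1 + expR (- (a * x)).
Proof. by rewrite addr_gt0// expR_gt0. Qed.

Lemma logistic_gt0 x : 0 < logistic x.
Proof. by rewrite invr_gt0. Qed.

Lemma logistic_le1 x : logistic x <= 1.
Proof. by rewrite invf_le1// lerDl expR_ge0. Qed.

Lemma logistic_itv x : 0 <= logistic x <= 1.
Proof. by rewrite logistic_le1 ltW// logistic_gt0. Qed.

Lemma is_derive_logistic (x : R) :
  is_derive x 1 logistic (a * (logistic x * (1 - logistic x))).
Proof.
have h1 := is_deriveN (@is_deriveZ R R R id a x 1 1 (is_derive_id _ _)).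
have h2 := @is_derive1_comp R expR _ x _ _ (is_derive_expR _) h1.
have h3 := is_deriveD (is_derive_cst (1 : R) (x : R) 1) h2.
have n0 : 1 + expR (- (a * x)) != 0 by rewrite gt_eqF.
have h4 := @is_deriveV R _ x _ 1 n0 h3.
apply: (is_derive_eq h4); rewrite /GRing.scale/= /logistic !fctE.
by field.
Qed.

Lemma smooth_logistic : smooth logistic.
Proof.
elim=> [x|n IH]; first exact: (@ex_derive _ _ _ _ _ _ _ (is_derive_logistic x)).
apply: (dnS is_derive_logistic).
exact: (dnM (dn_cst n a) (dnM IH (dnB (dn_cst n 1) IH))).
Qed.

(** From h' = a h (1 - h), the derivative of ln h is a (1 - h). *)
Lemma is_derive_logistic_prim (x : R) : is_derive x 1 logistic_prim (logistic x).
Proof.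
have h1 := @is_derive1_comp R (@ln R) logistic x _ _
  (is_derive1_ln (logistic_gt0 x)) (is_derive_logistic x).
have h2 := is_deriveB (is_derive_id (x : R) 1) (@is_deriveZ R R R _ a^-1 x 1 _ h1).
have -> : logistic_prim = id - a^-1 \*: (@ln R \o logistic).
  by apply/funext => y; rewrite /logistic_prim mulrC.
apply: (is_derive_eq h2); rewrite /GRing.scale/=.
by field; rewrite !gt_eqF ?logistic_gt0.
Qed.

(** The identity 1 - h = exp (- a x) h settles x >= 0, and h <= exp (a x) settles x < 0. *)
Lemma logistic_bump_le (x : R) : logistic x * (1 - logistic x) <= ek a 0 x.
Proof.
have /andP[h0 h1] := logistic_itv x.
have e : 1 - logistic x = expR (- (a * x)) * logistic x.
  rewrite /logistic; apply: (mulIf (lt0r_neq0 (den_gt0 x))).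
  by rewrite mulrBl -mulrA mulVf ?gt_eqF// mul1r mulr1 addrC addKr.
rewrite /ek sub0r normrN; have [x0|x0] := leP 0 x.
  rewrite mulNr (ger0_norm x0) e mulrCA ler_piMr ?expR_ge0//.
  exact: mulr_ile1.
rewrite (ltr0_norm x0) mulrN mulNr opprK.
apply: (@le_trans _ _ (logistic x)); first by rewrite ler_piMr// lerBlDr lerDl.
rewrite -[leRHS]invrK -expRN lef_pV2 ?posrE ?expR_gt0//.
by rewrite lerDr.
Qed.

End Logistic.

Section Front.
Variable R : realType.
Local Notation C := ((R[i])^o).

(* The exponent with [Re r < 0] of [u'' + s u' + p u], the other one, [- (s + r)], having
   positive real part. *)
Lemma char_root (s : R) (p : R[i]) : complex.Re p < 0 ->
  exists r : R[i], [/\ r ^+ 2 + s%:C * r + p = 0, complex.Re r < 0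
    & 0 < complex.Re (- (s%:C + r))].
Proof.
(* The roots are - s / 2 - t and - s / 2 + t with t^2 = D and Re t >= 0. Then (Re t)^2 >= Re (t^2) =
   s^2 / 4 - Re p > (s / 2)^2, so that Re t exceeds |s / 2| and decides both signs. *)
move=> p0; pose D : R[i] := (s ^+ 2 / 4)%:C - p.
have [t tD tp] : exists2 t : R[i], t ^+ 2 = D & 0 <= complex.Re t.
  have [t0|t0] := leP 0 (complex.Re (sqrtc D)).
    by exists (sqrtc D) => //; rewrite sqr_sqrtc.
  exists (- sqrtc D); first by rewrite sqrrN sqr_sqrtc.
  by rewrite cReN oppr_ge0 ltW.
have Rt : complex.Re t ^+ 2 - complex.Im t ^+ 2 = s ^+ 2 / 4 - complex.Re p.
  by rewrite !expr2 -cReM -expr2 tD /D cReD cReN.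
have lt : (s / 2) ^+ 2 < complex.Re t ^+ 2.
  have := sqr_ge0 (complex.Im t); rewrite exprMn exprVn -natrX.
  by move: Rt; clear -p0; lra.
have nt : `|s / 2| < complex.Re t.
  rewrite -(ger0_norm tp) -ltr_sqr ?nnegrE// !real_normK ?num_real//.
exists (- (s / 2)%:C - t); split.
- have -> : (- (s / 2)%:C - t) ^+ 2 + s%:C * (- (s / 2)%:C - t) + p =
    t ^+ 2 - D + ((s / 2)%:C ^+ 2 + (s / 2)%:C * t *+ 2 - s%:C * (s / 2)%:C - s%:C * t + (s
        ^+ 2 / 4)%:C).
    by rewrite /D; ring.
  rewrite tD subrr add0r; apply: complexP; rewrite ?cReD ?cReN ?cReM ?cImD ?cImN ?cImM /=.
    by field.
  by field.
- rewrite cReD !cReN /=; move: nt; rewrite ltr_norml => /andP[n1 n2].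
  by rewrite subr_lt0 ltrNl; move: n1; rewrite ltrNl.
- rewrite cReN cReD cReD !cReN /=; move: nt; rewrite ltr_norml => /andP[n1 n2].
  by clear -n1 n2; lra.
Qed.

End Front.

(** * Linearization about the front *)

Section FrontOperator.
Variable R : realType.
Local Notation C := ((R[i])^o).
Variables (alpha beta eps zm z0 zp : R).
Hypotheses (hbeta : 2 < beta) (zmp : zm < zp).

Definition nagumo_deriv (u : R) : R :=
  - 3 * u ^+ 2 + 2 * (1 + alpha) * u + (3 * eps ^- 2 - alpha).

Lemma derive1_nagumo : derive1 (nagumo alpha eps) = nagumo_deriv.
Proof.
apply: is_derive_derive1E => x.
have h2 := is_deriveX 2 (is_derive_id (x : R) 1).
have h3 := is_deriveX 3 (is_derive_id (x : R) 1).
have h4 := is_deriveB (is_deriveD (is_deriveD (is_deriveN h3)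
    (@is_deriveZ R R R _ (1 + alpha) x 1 _ h2))
    (@is_deriveZ R R R _ (3 * eps ^- 2 - alpha) x 1 _ (is_derive_id (x : R) 1)))
  (is_derive_cst ((1 + alpha) * eps ^- 2) (x : R) 1).
have [d4 e4] := h4.
set f := (X in derivable X _ _) in d4 e4.
have -> : nagumo alpha eps = f by apply/funext => y; rewrite /f /nagumo !fctE /GRing.scale/=.
by apply: (is_derive_eq h4); rewrite /GRing.scale/= /nagumo_deriv; ring.
Qed.

(** The two inequalities say that the limits [pm] and [pp] of the potential have negative real part,
    which separates the exponents at either end as [char_root] does. *)
Lemma linearization_not_essential (lambda : R[i]) :
  nagumo_deriv zm < complex.Re lambda -> nagumo_deriv zp < complex.Re lambda ->
  ~ essential_spectrum (L2 (weight beta)) (L2norm (weight beta))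
      (linearization alpha beta eps zm z0 zp) lambda.
Proof.
move=> lm lp.
pose s := front_speed zm z0 zp; pose A := zp - zm; pose a := A / Num.sqrt 2.
have A0 : 0 < A by rewrite subr_gt0.
have s2 : 0 < Num.sqrt 2 :> R by rewrite sqrtr_gt0.
have a0 : 0 < a by rewrite divr_gt0.
pose h := logistic a.
have frontE x : front zm zp x = A * h x + zm.
  rewrite /front -/A /huxley /h /logistic; congr (_ * (1 + expR _)^-1 + _).
  by rewrite /a; field; rewrite gt_eqF.
pose pm : R[i] := (nagumo_deriv zm)%:C - lambda.
pose pp : R[i] := (nagumo_deriv zp)%:C - lambda.
have pm0 : complex.Re pm < 0 by rewrite cReD cReN subr_lt0.
have pp0 : complex.Re pp < 0 by rewrite cReD cReN subr_lt0.
have [rm [em rm0 sm0]] := char_root s pm0.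
have [rp [ep rp0 sp0]] := char_root s pp0.
pose q := rp - rm.
have rmq : rm + q = rp by rewrite /q addrC subrK.
pose P x : C := (derive1 (nagumo alpha eps) (front zm zp x))%:C - lambda.
(* The coefficient of h (1 - h) in P + r' + s r + r^2. A quadratic with leading coefficient c is its
   linear interpolation minus c h (1 - h): f' has leading coefficient - 3 A^2 in h, r^2 has q^2, and
   r' is q a h (1 - h). *)
pose kap : R[i] := (3 * A ^+ 2)%:C + q * a%:C - q ^+ 2.
pose V x : C := kap * (h x * (1 - h x))%:C.
pose dh x := a * (h x * (1 - h x)).
have PV x : P x = V x - (q * (dh x)%:C + s%:C * front_rate h rm q x + front_rate h rm q x ^+ 2).
  rewrite /P derive1_nagumo frontE.
  have e1 : (nagumo_deriv (A * h x + zm))%:C - lambda =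
      pm + (pp - pm) * (h x)%:C + (3 * A ^+ 2)%:C * ((h x)%:C - (h x)%:C ^+ 2).
    have -> : pp - pm = (nagumo_deriv zp - nagumo_deriv zm)%:C.
      by rewrite /pp /pm rmorphB /=; ring.
    have -> : zp = A + zm by rewrite /A subrK.
    have -> : pm = (nagumo_deriv zm)%:C - lambda by [].
    apply: complexP; rewrite (expr2 (h x)%:C) ?cReD ?cImD ?cReN ?cImN ?cReM ?cImM ?cReD
        ?cImD ?cReN ?cImN ?cReM ?cImM /=.
      by rewrite /nagumo_deriv; ring.
    by ring.
  have eh : (h x * (1 - h x))%:C = (h x)%:C * (1 - (h x)%:C) :> R[i].
    by rewrite rmorphM rmorphB.
  rewrite e1 /V /kap /dh /front_rate (rmorphM _ a) eh.
  have -> : pm = - (rm ^+ 2 + s%:C * rm) by apply/eqP; rewrite -addr_eq0 addrC em.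
  have -> : pp = - (rp ^+ 2 + s%:C * rp) by apply/eqP; rewrite -addr_eq0 addrC ep.
  by rewrite -rmq; ring.
(* A common decay rate for both factors at both ends: the least distance of the four exponents to
   the imaginary axis. *)
pose d := Num.min (Num.min (- complex.Re rm) (- complex.Re rp))
  (Num.min (complex.Re (- (s%:C + rm))) (complex.Re (- (s%:C + rp)))).
have d0 : 0 < d by rewrite !lt_min !oppr_gt0 rm0 rp0 sm0 sp0.
have hp : complex.Re rm <= - d by rewrite lerNr !ge_min lexx.
have hq : complex.Re (rm + q) <= - d by rewrite rmq lerNr !ge_min lexx orbT.
have hp2 : d <= complex.Re (- (s%:C + rm)) by rewrite !ge_min lexx !orbT.
have hq2 : d <= complex.Re (- (s%:C + rm) - q).
  by rewrite -opprD -addrA rmq !ge_min lexx !orbT.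
have hV x : N1 (V x) <= N1 kap * ek a 0 x.
  apply: (le_trans (N1M _ _)); rewrite ler_wpM2l ?N1_ge0// N1_real.
  have /andP[h0 h1] := logistic_itv a x.
  by rewrite ger0_norm ?mulr_ge0 ?subr_ge0//; exact: logistic_bump_le.
have h01 x : 0 <= h x <= 1 by exact: logistic_itv.
have dhB x : `|dh x| <= a.
  have /andP[h0 h1] := h01 x.
  have b0 : 0 <= h x * (1 - h x) by rewrite mulr_ge0 ?subr_ge0.
  rewrite /dh normrM (gtr0_norm a0) (ger0_norm b0) ler_piMr ?(ltW a0)//.
  by rewrite mulr_ile1 ?subr_ge0// lerBlDr lerDl.
have sh : smooth h by exact: smooth_logistic.
have mV : cmeas V.
  apply: cmeasM; first exact: cmeas_cst.
  apply: csmooth_cmeas; apply: csmooth_real => n.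
  exact: (dnM (sh n) (dnB (dn_cst n 1) (sh n))).
have := second_order_fredholm hbeta (is_derive_logistic_prim a0) sh
  (is_derive_logistic a) h01 dhB d0 hp hq hp2 hq2 PV mV (N1_ge0 kap) a0 hV.
have -> : second_order_graph beta s P = op_shift (linearization alpha beta eps zm z0 zp) lambda.
  have fE (u1 u2 u : R -> C) : (fun x => u2 x + s%:C * u1 x + P x * u x) =
      (fun x => u2 x + s%:C * u1 x + (derive1 (nagumo alpha eps) (front zm zp x))%:C * u x)
      - lambda *: u.
    apply/funext => x; rewrite /P [RHS](_ : _ = u2 x + s%:C * u1 x +
      (derive1 (nagumo alpha eps) (front zm zp x))%:C * u x - lambda * u x)//.
    by ring.
  apply/seteqP; split => -[u v].
    move=> [Hu [u1 [u2 [w1 w2 vE]]]]; rewrite /= in Hu w1 w2 vE.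
    exists (fun x => u2 x + s%:C * u1 x + (derive1 (nagumo alpha eps) (front zm zp x))%:C * u x).
      by split => //; exists u1, u2.
    by rewrite /= vE fE.
  move=> [v' [Hu [u1 [u2 [w1 w2 vE']]]] vE]; rewrite /= in Hu w1 w2 vE vE'.
  split => //; exists u1, u2; split => //.
  by rewrite /= vE vE' fE.
move=> [[n hn] hk] [|[k /hk ->]]; last by rewrite eqxx.
by apply; exists n, n.
Qed.

End FrontOperator.

(** With x = 1 / eps the leading part of f'(z) is - 9 x^2 + 3 x^2 = - 6 x^2. As the square root of 3
    is at most 2, the remaining terms are at most 24 x + 3 (2 x + 2) = 30 x + 6, which is below 5
    x^2 once x >= 10. *)
Lemma nagumo_deriv_far (R : realType) (alpha eps z sg : R) : 0 < alpha < 1 / 2 ->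
  0 < eps <= 1 / 10 -> sg ^+ 2 = 1 -> `|z - sg * Num.sqrt 3 / eps| <= 2 ->
  nagumo_deriv alpha eps z < - eps ^- 2.
Proof.
move=> /andP[a0 a1] /andP[e0 e1] sg1 zd.
pose x := eps^-1; pose t : R := Num.sqrt 3; pose dl := z - sg * t * x.
have x10 : 10 <= x by rewrite -[10]invrK lef_pV2 ?posrE// -[10^-1]mul1r.
have t3 : t ^+ 2 = 3 by rewrite sqr_sqrtr.
have t0 : 0 <= t by exact: sqrtr_ge0.
have t2 : t <= 2 by rewrite -ler_sqr ?nnegrE// t3 -natrX ler_nat.
have sgn1 : `|sg| <= 1.
  by rewrite -ler_sqr ?nnegrE// real_normK ?num_real// sg1 expr1n.
have hd : `|dl| <= 2 by [].
have x0 : 0 <= x by exact: le_trans x10.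
have h1 : `|sg * t * x| <= 2 * x.
  rewrite normrM (ger0_norm x0) ler_wpM2r// normrM (ger0_norm t0) -[2]mul1r.
  exact: ler_pM.
have h2 : `|sg * t * x * dl| <= 4 * x.
  rewrite normrM (_ : 4 * x = 2 * x * 2); last by ring.
  by apply: ler_pM.
have ex : eps ^- 2 = x ^+ 2 by rewrite /x exprVn.
have zE : z = sg * t * x + dl by rewrite /dl addrC subrK.
have z2 : z ^+ 2 = 3 * x ^+ 2 + 2 * (sg * t * x * dl) + dl ^+ 2.
  rewrite zE; have -> : (sg * t * x + dl) ^+ 2 = sg ^+ 2 * t ^+ 2 * x ^+ 2 + 2 * (sg * t *
      x * dl) + dl ^+ 2 by ring.
  by rewrite sg1 t3 mul1r.
have zb : z <= 2 * x + 2.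
  rewrite zE lerD//; [exact: le_trans (ler_norm _) h1|exact: le_trans (ler_norm _) hd].
have az : 2 * (1 + alpha) * z <= 3 * (2 * x + 2).
  have c0 : 0 <= 2 * (1 + alpha) by clear -a0; lra.
  apply: (le_trans (ler_wpM2l c0 zb)); rewrite ler_wpM2r//; first by clear -x0; lra.
  by clear -a1; lra.
have xx : 10 * x <= x ^+ 2 by rewrite expr2 ler_wpM2r.
have d2 := sqr_ge0 dl; have h3 : - (4 * x) <= sg * t * x * dl.
  by move: h2; rewrite ler_norml => /andP[].
rewrite /nagumo_deriv ex z2; clear -az xx d2 h3 x10 a0.
lra.
Qed.

(** Over the complex field the constant and the radius hidden in the big O are themselves complex
    numbers with zero imaginary part; their real parts are what real estimates need. *)
Lemma bigO_real_part (R : realType) (g : (R[i])^o -> (R[i])^o) :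
  g =O_ ((0 : (R[i])^o)^') (fun e : (R[i])^o => e) ->
  exists r K : R, [/\ 0 < r, 0 <= K &
    forall e : R, 0 < e < r -> `|complex.Re (g e%:C)| <= K * e].
Proof.
move=> /eqO_exP[k k0 hk].
move: hk; rewrite /dnbhs /within => /nbhs_ballP[r r0 hr].
have [r1 r2] : complex.Im r = 0 /\ 0 < complex.Re r.
  by move: r0; rewrite /= ltcE /= => /andP[/eqP].
have [k1 k2] : complex.Im k = 0 /\ 0 < complex.Re k.
  by move: k0; rewrite ltcE /= => /andP[/eqP].
exists (complex.Re r), (complex.Re k); split => //; first exact: ltW.
move=> e /andP[e0 er].
have eN : `|e%:C : R[i]| = e%:C by rewrite ger0_norm// lecR ltW.
have : `|g e%:C| <= k * `|e%:C : R[i]|.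
  apply: hr; last by apply/eqP => -[] /eqP; rewrite gt_eqF.
  by rewrite /ball/= sub0r normrN eN ltcE /= r1 eqxx.
rewrite eN => h; have := le_trans (normc_ge_Re (g e%:C)) h.
by rewrite lecE cReM /= mulr0 subr0 => /andP[_].
Qed.

Theorem theorem3p2 (R : realType) (alpha beta eps0 : R)
    (zm z0 zp : (R[i])^o -> (R[i])^o)
    (halpha : 0 < alpha < 1 / 2) (hbeta : 2 < beta) (heps0 : 0 < eps0)
    (hol_zm : holomorphic_on (punctured_disc eps0) zm)
    (hol_z0 : holomorphic_on (punctured_disc eps0) z0)
    (hol_zp : holomorphic_on (punctured_disc eps0) zp)
    (root_z : forall e, punctured_disc eps0 e ->
       [/\ nagumo (alpha%:C : R[i]) e (zm e) = 0,
           nagumo (alpha%:C : R[i]) e (z0 e) = 0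
         & nagumo (alpha%:C : R[i]) e (zp e) = 0])
    (real_z : forall eps : R, 0 < eps < eps0 ->
       [/\ complex.Im (zm eps%:C) = 0,
           complex.Im (z0 eps%:C) = 0,
           complex.Im (zp eps%:C) = 0
         & complex.Re (zm eps%:C) < complex.Re (z0 eps%:C)
             < complex.Re (zp eps%:C)])
    (asym_z0 : (fun e : (R[i])^o => z0 e - ((1 + alpha) / 3)%:C)
       =O_ ((0 : (R[i])^o)^') (fun e : (R[i])^o => e ^+ 2))
    (asym_zp : (fun e : (R[i])^o =>
         zp e - ((Num.sqrt 3)%:C * e^-1 + ((1 + alpha) / 3)%:C))
       =O_ ((0 : (R[i])^o)^') (fun e : (R[i])^o => e))
    (asym_zm : (fun e : (R[i])^o =>
         zm e - (- (Num.sqrt 3)%:C * e^-1 + ((1 + alpha) / 3)%:C))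
       =O_ ((0 : (R[i])^o)^') (fun e : (R[i])^o => e)) :
  exists (eps1 c : R) (r : R -> R),
    [/\ 0 < eps1 <= eps0, 0 < c,
        r =O_ (0^'+) (fun eps : R => eps^-1)
      & forall eps : R, 0 < eps < eps1 ->
          essential_spectrum (L2 (weight beta)) (L2norm (weight beta))
            (linearization alpha beta eps (complex.Re (zm eps%:C))
               (complex.Re (z0 eps%:C)) (complex.Re (zp eps%:C)))
          `&` [set z : R[i] | - c * eps ^- 2 + r eps <= complex.Re z] = set0].
Proof.
have [rp [Kp [rp0 Kp0 hp]]] := bigO_real_part asym_zp.
have [rm [Km [rm0 Km0 hm]]] := bigO_real_part asym_zm.
pose K := Kp + Km + 1; have K0 : 0 < K by rewrite ltr_wpDl ?addr_ge0.
(* [eps0] for the roots to be ordered, 1 / 10 for [nagumo_deriv_far], [rp] and [rm] for the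
   expansions to hold, and 1 / K for their errors to be at most 1; the 1 added in K keeps it
   positive. *)
pose e1 := Num.min (Num.min eps0 (1 / 10)) (Num.min (Num.min rp rm) (1 / K)).
have e10 : 0 < e1 by rewrite !lt_min heps0 rp0 rm0 !divr_gt0.
exists e1, 1, (fun=> 0); split => //.
- by rewrite e10 !ge_min lexx.
- apply/eqO_exP; exists 1 => //; apply: nearW => x.
  by rewrite normr0 mul1r normr_ge0.
move=> eps /andP[ep0]; rewrite !lt_min => /andP[/andP[ee0 e10']] /andP[/andP[erp erm] eK].
have [_ _ _ /andP[zm0 z0p]] := real_z eps (introT andP (conj ep0 ee0)).
(* The distance 2 covers the error k eps <= 1 and the constant term (1 + alpha) / 3 < 1/2 of the
   expansion. *)
have close (z : R[i]) sg k : 0 <= k -> k <= K ->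
    `|complex.Re (z - (sg%:C * (Num.sqrt 3)%:C * (eps%:C)^-1 + ((1 + alpha) / 3)%:C))| <= k
        * eps ->
    `|complex.Re z - sg * Num.sqrt 3 / eps| <= 2.
  move=> k0 kK; rewrite -(fmorphV (real_complex R)) -!rmorphM -rmorphD cReD cReN /= => h.
  have ke : k * eps <= 1.
    apply: (@le_trans _ _ (K * eps)); first by rewrite ler_wpM2r// ltW.
    by rewrite mulrC -ler_pdivlMr// ltW.
  move: (le_trans h ke); rewrite !ler_norml => /andP[h1 h2].
  move: halpha => /andP[al0 al1]; clear -h1 h2 al0 al1.
  by apply/andP; split; lra.
have ep10 : 0 < eps <= 1 / 10 by rewrite ep0 ltW.
have [kp km] : Kp <= K /\ Km <= K by split; rewrite /K; lra.
have fp : nagumo_deriv alpha eps (complex.Re (zp eps%:C)) < - eps ^- 2.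
  apply: (@nagumo_deriv_far _ _ _ _ 1 halpha ep10); first by rewrite expr1n.
  apply: (close _ _ _ Kp0 kp); rewrite mul1r; apply: hp; by rewrite ep0.
have fm : nagumo_deriv alpha eps (complex.Re (zm eps%:C)) < - eps ^- 2.
  apply: (@nagumo_deriv_far _ _ _ _ (-1) halpha ep10); first by rewrite sqrrN expr1n.
  apply: (close _ _ _ Km0 km); rewrite rmorphN mulN1r; apply: hm; by rewrite ep0.
apply/seteqP; split => // lambda [/= ess]; rewrite addr0 mulN1r => hl.
apply: (linearization_not_essential hbeta _ _ _ ess).
- exact: lt_trans zm0 z0p.
- exact: lt_le_trans fm hl.
- exact: lt_le_trans fp hl.
Qed.
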